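(* The decision version of the propositional Sketched Answer Set Problem is in NP. That is, the following decision problem belongs to NP: given a propositional (ground, stratified) sketched answer set program $P$ with sketched variables $S$ with domains $D$, preferences $f$, and finite sets $\mathbf{E}^+$ and $\mathbf{E}^-$ of positive and negative examples, decide whether there exists a substitution $\theta:S\to D$, preferred by $f$, such that $P\theta\cup e$ has an answer set for every $e\in\mathbf{E}^+$ and has an answer set for no $e\in\mathbf{E}^-$.
   Context: **ASP.** An (ordinary) program is a finite set of rules $a \leftarrow a_1,\dots,a_k,\mathit{not}\ a_{k+1},\dots,\mathit{not}\ a_n$ with $a$ and the $a_i$ atoms; a rule with no head (head $\bot$) is an integrity constraint. Answer sets are stable models (Gelfond–Lifschitz). Propositional means that all rules are ground (contain no variables). **Sketched programs.** A sketched program $P$ is a finite set of such rules (no choice rules) in which in addition the following sketched constructs may be used: - sketched atoms $?q(t_1,\dots,t_n)$, where $?q$ is a sketched predicate variable with a finite domain $d_q$ (given as part of the input) of ordinary predicates of arity $n$; these may be used in the same places as any other atom; - sketched inequality $X\ ?{=}\ Y$, with domain $\{=,\neq,<,>,\geq,\leq,\top\}$, where $\top$ is always true; - sketched arithmetic $X\ ?{+}\ Y$, with domain $\{+,-,\times,\div,\mathit{dist}\}$, where $\mathit{dist}(a,b)=|a-b|$; - sketched negation $?\mathit{not}\ A$ applied to an atom $A$, with domain $\{\emptyset,\mathit{not}\}$, i.e. meaning either $A$ or $\mathit{not}\ A$. The set of all sketched predicates, negations, inequalities and arithmetic operators of $P$ is $S$. A substitution $\theta:S\to D$ assigns to every sketched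 variable an element of its domain; $P\theta$ is the ordinary program obtained by replacing each sketched variable by its value. **Stratification.** Predicate $p$ directly positively (negatively) depends on $q$ iff $q$ occurs positively (negatively) in the body of a rule with $p$ in the head, or $p$ is a sketched predicate and $q$ is in its domain (a positive dependency); an atom under $?\mathit{not}$ counts as occurring both positively and negatively. ''Depends on'' is the transitive closure of direct dependency. $P$ is stratified iff there is no cyclic dependency involving a negative direct dependency. Sketched programs are assumed stratified. **Examples.** An example is a finite set of ground atoms; $P\theta\cup e$ is $P\theta$ with the atoms of $e$ added as facts. **Preferences.** A preference $f$ assigns integers to assignments $s\mapsto d$ ($s\in S$, $d$ in the domain of $s$). Substitution $\theta$ is preferred over $\theta'$ iff $f(s\mapsto\theta(s))\ge f(s\mapsto\theta'(s))$ for all $s\in S$, with at least one strict inequality. The substitutions ''preferred by $f$'' are those among the substitutions satisfying the example conditions over which no other such substitution is preferred.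
   Formalization: In the stratification condition, a rule with a sketched predicate ?q in its head also counts as a rule for each predicate in d_q; read literally, sketched heads can encode arbitrary unstratified programs, and the claim would then imply NP = coNP. *)

(* Defs.v *)
(* MathComp (boot + polynomials), with integers taken from Stdlib's Z. *)
From Stdlib Require Import ZArith Relations.
From HB Require Import structures.
From mathcomp Require Import all_boot.
From mathcomp Require Import ssralg poly.

Set Implicit Arguments.
Unset Strict Implicit.
Unset Printing Implicit Defensive.

(** * Turing machines and NP *)

Inductive move := MoveL | MoveR | Stay.

(* Two-way infinite tape: the cells left of the head (nearest first), the
   scanned cell, the cells right of the head; all other cells are blank. *)
Record tape (A : Type) := Tape { t_left : seq A; t_head : A; t_right : seq A }.

Definition tape_write A (a : A) (t : tape A) : tape A :=
  Tape (t_left t) a (t_right t).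

Definition tape_move A (blank : A) (m : move) (t : tape A) : tape A :=
  match m with
  | Stay => t
  | MoveL => Tape (behead (t_left t)) (head blank (t_left t))
                  (t_head t :: t_right t)
  | MoveR => Tape (t_head t :: t_left t) (head blank (t_right t))
                  (behead (t_right t))
  end.

(* The tape alphabet is [option (bool + tm_aux)]: [None] is the blank,
   [Some (inl b)] the input symbols, [Some (inr _)] the remaining symbols.
   There are [tm_work.+2] tapes; tape 0 holds the input and tape 1 the
   certificate.  [tm_out q = Some b] says that [q] is halting, with verdict
   [b]. *)
Record TM := MkTM {
  tm_work  : nat;
  tm_aux   : finType;
  tm_state : finType;
  tm_start : tm_state;
  tm_out   : tm_state -> option bool;
  tm_delta : tm_state ->
             {ffun 'I_tm_work.+2 -> option (bool + tm_aux)} ->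
             tm_state *
             {ffun 'I_tm_work.+2 -> option (bool + tm_aux) * move}
}.

Definition tm_sym (M : TM) : Type := option (bool + tm_aux M).

Record config (M : TM) := Config {
  c_state : tm_state M;
  c_tapes : {ffun 'I_(tm_work M).+2 -> tape (tm_sym M)}
}.

Definition input_tape (M : TM) (w : seq bool) : tape (tm_sym M) :=
  let cells := [seq Some (inl b) | b <- w] in
  Tape [::] (head None cells) (behead cells).

Definition tm_init (M : TM) (x u : seq bool) : config M :=
  Config (tm_start M)
    [ffun i : 'I_(tm_work M).+2 =>
       input_tape M (if val i == 0 then x else if val i == 1 then u else [::])].

Definition tm_step (M : TM) (c : config M) : config M :=
  if tm_out (c_state c) is Some _ then c else
  let d := tm_delta (c_state c) [ffun i => t_head (c_tapes c i)] in
  Config d.1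
    [ffun i => tape_move None (d.2 i).2 (tape_write (d.2 i).1 (c_tapes c i))].

(* The verdict of [M] on [(x, u)] if [M] halts within [t] steps. *)
Definition tm_run (M : TM) (t : nat) (x u : seq bool) : option bool :=
  tm_out (c_state (iter t (@tm_step M) (tm_init M x u))).

Definition poly_time (M : TM) : Prop :=
  exists T : {poly nat}, forall x u : seq bool,
    tm_run M T.[(size x + size u)%N]%R x u <> None.

Definition accepts (M : TM) (x u : seq bool) : Prop :=
  exists t, tm_run M t x u = Some true.

Definition in_NP (L : seq bool -> Prop) : Prop :=
  exists (M : TM) (p : {poly nat}), poly_time M /\
    forall x : seq bool,
      L x <-> exists u : seq bool, size u <= p.[size x]%R /\ accepts M x u.

(** * Syntax of ground programs *)

(* Predicate symbols, symbolic constants and sketched variables are named by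
   bit strings.  As usual in ASP, a predicate is a name together with an arity,
   and the arity is the number of arguments of the atom it occurs in. *)
Definition name := seq bool.

Inductive sign := Pos | Neg.
Inductive cmp := CEq | CNe | CLt | CGt | CGe | CLe | CTop.
Inductive arith := OAdd | OSub | OMul | ODiv | ODist.

(* [P], [N], [C], [A] are the types of what may stand in predicate, negation,
   comparison and arithmetic operator position: plain symbols in ordinary
   programs, plain symbols or sketched variables in sketched programs. *)
Section Syntax.
Variables P N C A : Type.

Inductive term :=
| TInt of Z
| TSym of name
| TOp of A & term & term.

Record atom := Atom { a_pred : P; a_args : seq term }.

Inductive literal :=
| LAtom of N & atom
| LCmp of C & term & term.

(* [r_head = None] is an integrity constraint. *)
Record rule := Rule { r_head : option atom; r_body : seq literal }.

Definition program := seq rule.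

End Syntax.

Arguments TInt {A}.
Arguments TSym {A}.
Arguments LAtom {P N C A}.
Arguments LCmp {P N C A}.

Definition oprogram := program name sign cmp arith.

Inductive slot (T : Type) := Fix of T | Sk of name.
Arguments Sk {T}.

Definition sterm := term (slot arith).
Definition satom := atom (slot name) (slot arith).
Definition sliteral := literal (slot name) (slot sign) (slot cmp) (slot arith).
Definition srule := rule (slot name) (slot sign) (slot cmp) (slot arith).
Definition sprogram := program (slot name) (slot sign) (slot cmp) (slot arith).

(** * Answer sets of ordinary programs *)

Inductive gterm := GInt of Z | GSym of name.
Record gatom := GAtom { g_pred : name; g_args : seq gterm }.

(* Division truncates towards zero; division by zero is undefined. *)
Definition arith_sem (o : arith) (a b : Z) : option Z :=
  match o with
  | OAdd => Some (a + b)%Z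
  | OSub => Some (a - b)%Z
  | OMul => Some (a * b)%Z
  | ODiv => if Z.eqb b 0 then None else Some (Z.quot a b)
  | ODist => Some (Z.abs (a - b))
  end.

Fixpoint eval (t : term arith) : option gterm :=
  match t with
  | TInt z => Some (GInt z)
  | TSym s => Some (GSym s)
  | TOp o t1 t2 =>
      match eval t1, eval t2 with
      | Some (GInt a), Some (GInt b) => omap GInt (arith_sem o a b)
      | _, _ => None
      end
  end.

Fixpoint name_compare (s t : name) : comparison :=
  match s, t with
  | [::], [::] => Eq
  | [::], _ => Lt
  | _, [::] => Gt
  | b :: s', c :: t' =>
      if b == c then name_compare s' t' else if c then Lt else Gt
  end.

(* The usual total order on ground terms: integers precede symbolic constants,
   which are ordered lexicographically. *)
Definition gterm_compare (s t : gterm) : comparison :=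
  match s, t with
  | GInt a, GInt b => Z.compare a b
  | GInt _, GSym _ => Lt
  | GSym _, GInt _ => Gt
  | GSym a, GSym b => name_compare a b
  end.

Definition cmp_sem (c : cmp) (r : comparison) : bool :=
  match c, r with
  | CEq, Eq | CNe, Lt | CNe, Gt | CLt, Lt | CGt, Gt
  | CGe, Gt | CGe, Eq | CLe, Lt | CLe, Eq | CTop, _ => true
  | _, _ => false
  end.

(* [CTop] holds even when one of its sides is undefined. *)
Definition cmp_holds (c : cmp) (s t : term arith) : bool :=
  match c, eval s, eval t with
  | CTop, _, _ => true
  | _, Some a, Some b => cmp_sem c (gterm_compare a b)
  | _, _, _ => false
  end.

Fixpoint eval_args (ts : seq (term arith)) : option (seq gterm) :=
  if ts is t :: ts' then
    if (eval t, eval_args ts') is (Some v, Some vs) then Some (v :: vs) else None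
  else Some [::].

Definition eval_atom (a : atom name arith) : option gatom :=
  omap (GAtom (a_pred a)) (eval_args (a_args a)).

Record grule :=
  GRule { g_head : option gatom; g_pos : seq gatom; g_neg : seq gatom }.

Fixpoint eval_body (b : seq (literal name sign cmp arith)) :
    option (seq gatom * seq gatom) :=
  match b with
  | [::] => Some ([::], [::])
  | LCmp c s t :: b' => if cmp_holds c s t then eval_body b' else None
  | LAtom sg a :: b' =>
      match eval_atom a, eval_body b' with
      | Some g, Some (ps, ns) =>
          Some (if sg is Pos then (g :: ps, ns) else (ps, g :: ns))
      | _, _ => None
      end
  end.

(* As in grounders, a rule with a false comparison or an undefined arithmetic
   term contributes nothing. *)
Definition eval_rule (r : rule name sign cmp arith) : option grule :=
  match eval_body (r_body r) with
  | None => None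
  | Some (ps, ns) =>
      match r_head r with
      | None => Some (GRule None ps ns)
      | Some a => omap (fun g => GRule (Some g) ps ns) (eval_atom a)
      end
  end.

Definition evaluate (p : oprogram) : seq grule := pmap eval_rule p.

Definition add_facts (e : seq gatom) (p : seq grule) : seq grule :=
  [seq GRule (Some a) [::] [::] | a <- e] ++ p.

Definition interp := gatom -> Prop.

(* The Gelfond-Lifschitz reduct; the negative bodies of its rules are to be
   disregarded. *)
Definition reduct (p : seq grule) (M : interp) (r : grule) : Prop :=
  List.In r p /\ forall a, List.In a (g_neg r) -> ~ M a.

Definition pos_model (R : grule -> Prop) (M : interp) : Prop :=
  forall r, R r -> (forall a, List.In a (g_pos r) -> M a) ->
    match g_head r with Some h => M h | None => False end.

Definition answer_set (p : seq grule) (M : interp) : Prop :=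
  pos_model (reduct p M) M /\
  forall M' : interp, pos_model (reduct p M) M' ->
    (forall a, M' a -> M a) -> forall a, M a -> M' a.

(** * Substitutions *)

(* The arity of a sketched predicate is part of its identity, as for ordinary
   predicates.  Occurrences carrying the same name are the same sketched
   variable; distinct occurrences may be given distinct names. *)
Inductive svar := SPred of name & nat | SNeg of name | SCmp of name
                | SArith of name.

Record subst := Subst {
  th_pred  : name -> nat -> name;
  th_neg   : name -> sign;
  th_cmp   : name -> cmp;
  th_arith : name -> arith
}.

(* A sketched variable mapped to an element of its domain. *)
Inductive assignment :=
| APred of name & nat & name
| ANeg of name & sign
| ACmp of name & cmp
| AArith of name & arith.

Definition assignment_dec (a b : assignment) : {a = b} + {a <> b}.
Proof. by repeat decide equality. Defined.

HB.instance Definition _ :=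
  hasDecEq.Build assignment (compareP assignment_dec).

Definition assign (th : subst) (s : svar) : assignment :=
  match s with
  | SPred q n => APred q n (th_pred th q n)
  | SNeg s => ANeg s (th_neg th s)
  | SCmp s => ACmp s (th_cmp th s)
  | SArith s => AArith s (th_arith th s)
  end.

Definition fill T (f : name -> T) (s : slot T) : T :=
  match s with Fix x => x | Sk q => f q end.

Section Apply.
Variable th : subst.

Fixpoint sub_term (t : sterm) : term arith :=
  match t with
  | TInt z => TInt z
  | TSym s => TSym s
  | TOp o t1 t2 => TOp (fill (th_arith th) o) (sub_term t1) (sub_term t2)
  end.

Definition sub_atom (a : satom) : atom name arith :=
  Atom (fill (fun q => th_pred th q (size (a_args a))) (a_pred a))
       (map sub_term (a_args a)).

Definition sub_literal (l : sliteral) : literal name sign cmp arith :=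
  match l with
  | LAtom sg a => LAtom (fill (th_neg th) sg) (sub_atom a)
  | LCmp c s t => LCmp (fill (th_cmp th) c) (sub_term s) (sub_term t)
  end.

Definition sub_program (p : sprogram) : oprogram :=
  [seq Rule (omap sub_atom (r_head r)) (map sub_literal (r_body r)) | r <- p].

End Apply.

Definition slot_vars T (f : name -> svar) (s : slot T) : seq svar :=
  if s is Sk q then [:: f q] else [::].

Fixpoint term_vars (t : sterm) : seq svar :=
  if t is TOp o t1 t2 then slot_vars SArith o ++ term_vars t1 ++ term_vars t2
  else [::].

Definition atom_vars (a : satom) : seq svar :=
  slot_vars (fun q => SPred q (size (a_args a))) (a_pred a) ++
  flatten (map term_vars (a_args a)).

Definition literal_vars (l : sliteral) : seq svar :=
  match l with
  | LAtom sg a => slot_vars SNeg sg ++ atom_vars a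
  | LCmp c s t => slot_vars SCmp c ++ term_vars s ++ term_vars t
  end.

Definition rule_vars (r : srule) : seq svar :=
  oapp atom_vars [::] (r_head r) ++ flatten (map literal_vars (r_body r)).

Definition svars (p : sprogram) : seq svar := flatten (map rule_vars p).

(** * The sketched answer set problem *)

(* [i_doms] lists the domains [d_q] of the sketched predicates [?q/n] (the other
   domains are fixed), [i_prefs] the values of the preference function. *)
Record instance := Instance {
  i_prog  : sprogram;
  i_doms  : seq (name * nat * seq name);
  i_prefs : seq (assignment * Z);
  i_pos   : seq (seq gatom);
  i_neg   : seq (seq gatom)
}.

(* Tables are read by their first matching entry; undeclared sketched
   predicates have an empty domain, unlisted assignments have preference 0. *)
Definition dom (I : instance) (q : name) (n : nat) : seq name :=
  head [::] [seq e.2 | e <- i_doms I & e.1 == (q, n)].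

Definition pref (I : instance) (a : assignment) : Z :=
  head 0%Z [seq e.2 | e <- i_prefs I & e.1 == a].

Inductive node := NOrd of name & nat | NSk of name & nat.

Definition atom_node (a : satom) : node :=
  match a_pred a with
  | Fix p => NOrd p (size (a_args a))
  | Sk q => NSk q (size (a_args a))
  end.

(* A rule headed by a sketched atom has in its head the sketched predicate and
   every predicate of its domain: it is a rule for each of them under some
   substitution, which would otherwise be free to create negative cycles. *)
Definition in_head (I : instance) (r : srule) (p : node) : Prop :=
  exists2 a, r_head r = Some a &
    p = atom_node a \/
    exists q n d, [/\ atom_node a = NSk q n, d \in dom I q n & p = NOrd d n].

Definition occurs_in_body (sg : sign) (r : srule) (q : node) : Prop :=
  exists s a, [/\ List.In (LAtom s a) (r_body r), q = atom_node a &
    match s with Fix sg' => sg' = sg | Sk _ => True end].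

Definition direct_dep (I : instance) (sg : sign) (p q : node) : Prop :=
  (exists r, [/\ List.In r (i_prog I), in_head I r p & occurs_in_body sg r q])
  \/ (sg = Pos /\
      exists q' n d, [/\ p = NSk q' n, d \in dom I q' n & q = NOrd d n]).

Definition depends_on (I : instance) : node -> node -> Prop :=
  clos_trans node (fun p q => exists sg, direct_dep I sg p q).

Definition stratified (I : instance) : Prop :=
  ~ exists p q, direct_dep I Neg p q /\ (p = q \/ depends_on I q p).

Definition in_domains (I : instance) (th : subst) : Prop :=
  forall q n, List.In (SPred q n) (svars (i_prog I)) ->
    th_pred th q n \in dom I q n.

Definition has_answer_set (I : instance) (th : subst) (e : seq gatom) : Prop :=
  exists M, answer_set (add_facts e (evaluate (sub_program th (i_prog I)))) M.

Definition satisfies (I : instance) (th : subst) : Prop :=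
  [/\ in_domains I th,
      forall e, List.In e (i_pos I) -> has_answer_set I th e &
      forall e, List.In e (i_neg I) -> ~ has_answer_set I th e].

Definition preferred_over (I : instance) (th th' : subst) : Prop :=
  (forall s, List.In s (svars (i_prog I)) ->
     (pref I (assign th' s) <= pref I (assign th s))%Z) /\
  (exists2 s, List.In s (svars (i_prog I)) &
     (pref I (assign th' s) < pref I (assign th s))%Z).

Definition preferred (I : instance) (th : subst) : Prop :=
  ~ exists th', satisfies I th' /\ preferred_over I th' th.

Definition SkASP_yes (I : instance) : Prop :=
  exists th, satisfies I th /\ preferred I th.

(** * Binary encoding of instances *)

(* A prefix code: every encoder below is self-delimiting. *)
Definition enc_seq T (f : T -> seq bool) (s : seq T) : seq bool :=
  flatten [seq true :: f x | x <- s] ++ [:: false].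

Definition enc_name (s : name) : seq bool := enc_seq (fun b => [:: b]) s.

Definition enc_nat (n : nat) : seq bool := nseq n true ++ [:: false].

(* Binary digits, least significant first. *)
Fixpoint pos_bits (p : positive) : seq bool :=
  match p with
  | xH => [:: true]
  | xO p => false :: pos_bits p
  | xI p => true :: pos_bits p
  end.

Definition enc_Z (z : Z) : seq bool :=
  match z with
  | Z0 => false :: enc_name [::]
  | Zpos p => false :: enc_name (pos_bits p)
  | Zneg p => true :: enc_name (pos_bits p)
  end.

Definition enc_sign (s : sign) : seq bool :=
  match s with Pos => [:: false] | Neg => [:: true] end.

Definition enc_cmp (c : cmp) : seq bool :=
  match c with
  | CEq  => [:: false; false; false]
  | CNe  => [:: false; false; true]
  | CLt  => [:: false; true; false]
  | CGt  => [:: false; true; true]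
  | CGe  => [:: true; false; false]
  | CLe  => [:: true; false; true]
  | CTop => [:: true; true; false]
  end.

Definition enc_arith (o : arith) : seq bool :=
  match o with
  | OAdd  => [:: false; false; false]
  | OSub  => [:: false; false; true]
  | OMul  => [:: false; true; false]
  | ODiv  => [:: false; true; true]
  | ODist => [:: true; false; false]
  end.

Definition enc_slot T (f : T -> seq bool) (s : slot T) : seq bool :=
  match s with Fix x => false :: f x | Sk q => true :: enc_name q end.

Fixpoint enc_term (t : sterm) : seq bool :=
  match t with
  | TInt z => [:: false; false] ++ enc_Z z
  | TSym s => [:: false; true] ++ enc_name s
  | TOp o t1 t2 =>
      true :: enc_slot enc_arith o ++ enc_term t1 ++ enc_term t2
  end.

Definition enc_atom (a : satom) : seq bool :=
  enc_slot enc_name (a_pred a) ++ enc_seq enc_term (a_args a).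

Definition enc_literal (l : sliteral) : seq bool :=
  match l with
  | LAtom sg a => false :: enc_slot enc_sign sg ++ enc_atom a
  | LCmp c s t => true :: enc_slot enc_cmp c ++ enc_term s ++ enc_term t
  end.

Definition enc_rule (r : srule) : seq bool :=
  (if r_head r is Some a then true :: enc_atom a else [:: false]) ++
  enc_seq enc_literal (r_body r).

Definition enc_assignment (a : assignment) : seq bool :=
  match a with
  | APred q n d => [:: false; false] ++ enc_name q ++ enc_nat n ++ enc_name d
  | ANeg s v    => [:: false; true] ++ enc_name s ++ enc_sign v
  | ACmp s v    => [:: true; false] ++ enc_name s ++ enc_cmp v
  | AArith s v  => [:: true; true] ++ enc_name s ++ enc_arith v
  end.

Definition enc_gterm (t : gterm) : seq bool :=
  match t with
  | GInt z => false :: enc_Z z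
  | GSym s => true :: enc_name s
  end.

Definition enc_gatom (a : gatom) : seq bool :=
  enc_name (g_pred a) ++ enc_seq enc_gterm (g_args a).

Definition enc_instance (I : instance) : seq bool :=
  enc_seq enc_rule (i_prog I) ++
  enc_seq (fun e => enc_name e.1.1 ++ enc_nat e.1.2 ++ enc_seq enc_name e.2)
          (i_doms I) ++
  enc_seq (fun e => enc_assignment e.1 ++ enc_Z e.2) (i_prefs I) ++
  enc_seq (enc_seq enc_gatom) (i_pos I) ++
  enc_seq (enc_seq enc_gatom) (i_neg I).

Definition SkASP : seq bool -> Prop := fun w =>
  exists I, [/\ w = enc_instance I, stratified I & SkASP_yes I].

(* Main.v *)
(* A satisfying substitution of maximal total preference is preferred, so the
   preferences can be ignored: it suffices to guess a substitution meeting the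
   example conditions.  Stratification is certified by a table of levels of the
   predicates that never increase along a dependency and decrease along a
   negative one.  For each example, the stratified part of the ground program
   has exactly one answer set, which is certified by listing its atoms in an
   order of derivation; the example is consistent iff this set violates no
   integrity constraint.

   To avoid programming a Turing machine for all this, the verifier is a set of
   Horn clauses over binary trees, of which the machine guesses a refutation of
   polynomial length on trees of polynomial size.  Soundness of the verifier
   amounts to the validity of each clause under an intended meaning of the
   predicates; completeness bounds the lengths of refutations.  A refutation is
   carried out by a nondeterministic program on stacks of bits, compiled to a
   machine every step of which consumes one bit of the certificate, so that it
   runs in linear time by construction. *)

Require Import Defs.
From Stdlib Require Import ZArith Relations Classical ClassicalEpsilon
  FunctionalExtensionality.
From HB Require Import structures.
From mathcomp Require Import all_boot.
From mathcomp Require Import ssralg poly zify.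

Set Implicit Arguments.
Unset Strict Implicit.
Unset Printing Implicit Defensive.

(** * Nondeterministic stack programs *)

(** Two certificates are delicate. A negative example asserts that no answer set exists, which is a
    universal statement; it becomes checkable because the levels make the only candidate unique, so
    that exhibiting this candidate together with one violated constraint excludes all answer sets at
    once. The values of arithmetic terms may be exponentially large, but every operator yields at
    most one digit more than its operands have together, so that in binary they stay linear in the
    size of the term. Horn clauses have no negation. Hence everything to be verified, including
    disequality, non-membership, undefinedness of a term and the dropping of a rule, has a positive
    definition of its own. The two directions are kept apart. Soundness concerns guessed trees of
    any shape, well formed or not, and ignores costs; completeness starts from genuine encodings and
    only has to bound sizes and numbers of steps. *)

Definition stacks := nat -> seq bool.

Definition upd (s : stacks) (i : nat) (w : seq bool) : stacks :=
  fun j => if j == i then w else s j.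

(** Regular programs over stacks. Tests fail instead of branching, so that a conditional is an [Alt]
    whose wrong side gets stuck, and a while loop is a [Star] followed by a test. *)
Inductive prog :=
| Skip
| Push of nat & bool
| Pop of nat & bool
| IsEmpty of nat
| Seq of prog & prog
| Alt of prog & prog
| Star of prog.

Definition prog_dec (p q : prog) : {p = q} + {p <> q}.
Proof. by repeat decide equality. Defined.

HB.instance Definition _ := hasDecEq.Build prog (compareP prog_dec).

(* Control: what remains to be done after one step of [p], the bit resolving
   the nondeterminism. *)
Definition ctl (b : bool) (p : prog) (k : seq prog) : seq prog :=
  match p with
  | Seq p q => [:: p, q & k]
  | Alt p q => (if b then p else q) :: k
  | Star p => if b then [:: p, Star p & k] else k
  | _ => k
  end.

Definition eff (p : prog) (s : stacks) : option stacks :=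
  match p with
  | Push i c => Some (upd s i (c :: s i))
  | Pop i c => if s i is c' :: w then if c' == c then Some (upd s i w) else None
               else None
  | IsEmpty i => if s i is [::] then Some s else None
  | _ => Some s
  end.

(** Control steps are counted like stack operations, because each of them is a machine step and
    costs a certificate bit. *)
Inductive run : nat -> seq prog -> stacks -> Prop :=
| run_nil s : run 0 [::] s
| run_cons b p k s s' n :
    eff p s = Some s' -> run n (ctl b p k) s' -> run n.+1 (p :: k) s.

(** A relational semantics without costs, on which soundness is based; costs enter only through
    [leads]. *)
Fixpoint den (p : prog) (s s' : stacks) : Prop :=
  match p with
  | Seq p q => exists2 s1, den p s s1 & den q s1 s'
  | Alt p q => den p s s' \/ den q s s'
  | Star p => clos_refl_trans_1n stacks (den p) s s'
  | _ => eff p s = Some s'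
  end.

Fixpoint denl (k : seq prog) (s s' : stacks) : Prop :=
  if k is p :: k then exists2 s1, den p s s1 & denl k s1 s' else s = s'.

Lemma run_den n k s : run n k s -> exists s', denl k s s'.
Proof.
elim=> [{}s | b p {}k {}s s' {}n eff_s _ [s2]]; first by exists s.
have skip q : eff q s = Some s' -> match q with Seq _ _ | Alt _ _ | Star _ => True
    | _ => den q s s' end by case: q.
case: p eff_s => [|i c|i c|i|p q|p q|p] eff_s /=.
- by exists s2, s'.
- by exists s2, s'.
- by exists s2, s'.
- by exists s2, s'.
- by case: eff_s => <- [s3 ? [s4 ? ?]]; exists s2, s4 => //; exists s3.
- case: eff_s => <-; case: b => -[s3 ? ?]; exists s2, s3 => //; by [left|right].
- case: eff_s => <-; case: b => /=.
    case=> s3 ? [s4 ? ?]; exists s2, s4 => //.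
    exact: (@Relation_Operators.rt1n_trans _ _ s s3 s4).
  by move=> ?; exists s2, s => //; constructor.
Qed.

(* [p] can lead from [s] to [s'] in [n] steps, in continuation-passing form. *)
Definition leads (p : prog) (n : nat) (s s' : stacks) : Prop :=
  forall k m, run m k s' -> run (n + m) (p :: k) s.

Lemma leads_skip s : leads Skip 1 s s.
Proof. by move=> k m Rk; rewrite add1n; apply: (@run_cons true _ _ _ s). Qed.

Lemma leads_push i c s : leads (Push i c) 1 s (upd s i (c :: s i)).
Proof. by move=> k m; apply: (@run_cons true (Push i c)). Qed.

Lemma leads_pop i c s w : s i = c :: w -> leads (Pop i c) 1 s (upd s i w).
Proof. by move=> si k m; apply: (@run_cons true (Pop i c)); rewrite /= si eqxx. Qed.

Lemma leads_empty i s : s i = [::] -> leads (IsEmpty i) 1 s s.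
Proof. by move=> si k m; apply: (@run_cons true (IsEmpty i)); rewrite /= si. Qed.

Lemma leads_seq p q n m s1 s2 s3 :
  leads p n s1 s2 -> leads q m s2 s3 -> leads (Seq p q) (n + m).+1 s1 s3.
Proof.
move=> Lp Lq k l Rk; rewrite addSn -addnA.
apply: (@run_cons true _ _ _ s1) => //.
exact/Lp/Lq.
Qed.

Lemma leads_alt b p q n s s' :
  leads (if b then p else q) n s s' -> leads (Alt p q) n.+1 s s'.
Proof. by move=> Lp k l Rk; apply: (@run_cons b _ _ _ s) => //; exact: Lp. Qed.

Lemma leads_star0 p s : leads (Star p) 1 s s.
Proof. by move=> k l Rk; rewrite add1n; apply: (@run_cons false _ _ _ s). Qed.

Lemma leads_star p n m s1 s2 s3 :
  leads p n s1 s2 -> leads (Star p) m s2 s3 -> leads (Star p) (n + m).+1 s1 s3.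
Proof.
move=> Lp Lq k l Rk; rewrite addSn -addnA.
apply: (@run_cons true _ _ _ s1) => //.
exact/Lp/Lq.
Qed.

(** * Stack programs on Turing machines *)

(** Only finitely many continuations arise from [p :: k], as with the partial derivatives of a
    regular expression; they become machine states. The exit [k] itself is left out. *)
Fixpoint conts (p : prog) (k : seq prog) : seq (seq prog) :=
  (p :: k) :: match p with
              | Seq p q => conts p (q :: k) ++ conts q k
              | Alt p q => conts p k ++ conts q k
              | Star p => conts p (Star p :: k)
              | _ => [::]
              end.

Lemma conts_head p k : p :: k \in conts p k.
Proof. by case: p => *; rewrite /= inE eqxx. Qed.

(** The set is left only through the exit [k]. For [Seq] the exit of the first component heads the
    set of the second one, and for [Star] the exit of the body is the loop itself. *)
Lemma conts_ctl b p k q l :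
  q :: l \in conts p k -> (ctl b q l == k) || (ctl b q l \in conts p k).
Proof.
elim: p k => [|i c|i c|i|p1 IH1 p2 IH2|p1 IH1 p2 IH2|p1 IH1] k;
  rewrite /= in_cons => /predU1P[[-> ->]|] //=; rewrite ?eqxx //.
- by rewrite inE mem_cat conts_head !orbT.
- rewrite mem_cat => /orP[/IH1 /orP[/eqP->|in1]|/IH2 /orP[->|in2]] //.
  + by rewrite inE mem_cat conts_head !orbT.
  + by rewrite inE mem_cat in1 !orbT.
  + by rewrite inE mem_cat in2 !orbT.
- by case: b {IH1 IH2}; rewrite inE mem_cat conts_head !orbT.
- rewrite mem_cat => /orP[/IH1 /orP[->|in1]|/IH2 /orP[->|in2]] //.
  + by rewrite inE mem_cat in1 !orbT.
  + by rewrite inE mem_cat in2 !orbT.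
- by case: b {IH1}; rewrite ?eqxx // inE conts_head !orbT.
- move=> /IH1 /orP[/eqP->|in1]; first by rewrite inE eqxx orbT.
  by rewrite inE in1 !orbT.
Qed.

Section Represents.
Variable A : Type.
Implicit Types (t : tape (option (bool + A))) (w : seq bool).

Definition cells w : seq (option (bool + A)) := [seq Some (inl b) | b <- w].

(* The stack grows to the left; whatever is left of the head is garbage. *)
Definition represents t w : Prop :=
  forall n, nth None (t_head t :: t_right t) n = nth None (cells w) n.

Lemma represents_head t w :
  represents t w -> t_head t = if w is b :: _ then Some (inl b) else None.
Proof. by move=> /(_ 0) /= ->; case: w. Qed.

Lemma represents_pop t w :
  represents t w -> represents (tape_move None MoveR t) (behead w).
Proof.
move=> tw n; have := tw n.+1; rewrite /= => {}tw.
transitivity (nth None (t_right t) n).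
  by case: t {tw} => l h [|a r] //=; case: n => //= n; rewrite nth_nil.
by rewrite tw; case: w {tw} => //=; rewrite nth_nil.
Qed.

Lemma represents_push t w b :
  represents t w ->
  represents (tape_write (Some (inl b)) (tape_move None MoveL t)) (b :: w).
Proof. by move=> tw [|n] //=; exact: tw. Qed.

End Represents.

Section Machine.
Variables (m : nat) (P : prog).

(** The empty continuation, at which the machine accepts, never occurs in [conts] and is therefore
    added. *)
Definition mconts : seq (seq prog) := [::] :: conts P [::].
Definition mcont (i : 'I_(size mconts)) : seq prog := nth [::] mconts i.
Definition mindex (k : seq prog) : 'I_(size mconts) := inord (index k mconts).

Lemma mindexK k : k \in mconts -> mcont (mindex k) = k.
Proof.
move=> kP; rewrite /mcont /mindex inordK ?nth_index //.
by move: kP; rewrite -index_mem.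
Qed.

Lemma mconts_ctl b q l : q :: l \in mconts -> ctl b q l \in mconts.
Proof.
rewrite /mconts inE => /orP[//|/(conts_ctl b) /orP[/eqP->|in_P]].
  by rewrite inE eqxx.
by rewrite inE in_P orbT.
Qed.

(* A state holds the continuation and a pending write, since a machine writes
   before it moves whereas pushing has to move first; [None] rejects. *)
Definition mstate : finType :=
  option ('I_(size mconts) * option ('I_m.+2 * bool)).

Definition msym : Type := option (bool + void).

Definition mout (q : mstate) : option bool :=
  match q with
  | None => Some false
  | Some (i, _) => if mcont i is [::] then Some true else None
  end.

Definition cert : 'I_m.+2 := inord 1.

Section Delta.
Variable hd : {ffun 'I_m.+2 -> msym}.

(** Every transition moves the certificate head to the right; this is the source of the time
    bound. *)
Definition mact (f : 'I_m.+2 -> msym * move) : {ffun 'I_m.+2 -> msym * move} :=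
  [ffun j => if j == cert then (hd j, MoveR) else f j].

Definition mstay (j : 'I_m.+2) : msym * move := (hd j, Stay).

Definition mreject : mstate * {ffun 'I_m.+2 -> msym * move} := (None, mact mstay).

(** A blank under the certificate head always rejects. Completing a pending write takes a step of
    its own, for which a certificate bit of either value serves. *)
Definition mdelta (q : mstate) : mstate * {ffun 'I_m.+2 -> msym * move} :=
  match q, hd cert with
  | Some (i, Some (j, c)), Some (inl _) =>
      (Some (i, None),
       mact (fun l => if l == j then (Some (inl c), Stay) else mstay l))
  | Some (i, None), Some (inl b) =>
      if mcont i is p :: k then
        let next := mindex (ctl b p k) in
        match p with
        | Push j c =>
            (Some (next, Some (inord j, c)),
             mact (fun l => if l == inord j then (hd l, MoveL) else mstay l))
        | Pop j c =>
            if hd (inord j) is Some (inl c') then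
              if c' == c then
                (Some (next, None),
                 mact (fun l => if l == inord j then (hd l, MoveR) else mstay l))
              else mreject
            else mreject
        | IsEmpty j =>
            if hd (inord j) is None then (Some (next, None), mact mstay)
            else mreject
        | _ => (Some (next, None), mact mstay)
        end
      else mreject
  | _, _ => mreject
  end.

End Delta.

Definition machine : TM :=
  @MkTM m void mstate (Some (mindex [:: P], None)) mout
        (fun q hd => mdelta hd q).

Implicit Types c : config machine.

Notation step := (@tm_step machine).
Notation verdict c := (mout (c_state c)).

Lemma iter_halted c b t : verdict c = Some b -> iter t step c = c.
Proof. by move=> out_c; elim: t => //= t ->; rewrite /tm_step /= out_c. Qed.

Lemma iter_verdict_le c t t' :
  t <= t' -> verdict (iter t step c) <> None -> verdict (iter t' step c) <> None.
Proof.
move=> /subnKC <-; rewrite addnC iterD; set c' := iter t step c.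
by case out_c: (mout _) => [b|] // _; rewrite (iter_halted _ out_c) out_c.
Qed.

Definition heads c : {ffun 'I_m.+2 -> msym} := [ffun i => t_head (c_tapes c i)].

Lemma headsE c l : heads c l = t_head (c_tapes c l).
Proof. exact: ffunE. Qed.

Lemma tape_write_head (A : Type) (t : tape A) : tape_write (t_head t) t = t.
Proof. by case: t. Qed.

Lemma step_delta c q f : verdict c = None ->
  mdelta (heads c) (c_state c) = (q, mact (heads c) f) ->
  [/\ c_state (step c) = q,
      c_tapes (step c) cert = tape_move None MoveR (c_tapes c cert) &
      forall l, l != cert -> c_tapes (step c) l =
        tape_move None (f l).2 (tape_write (f l).1 (c_tapes c l))].
Proof.
move=> out_c; rewrite /tm_step /= out_c -/(heads c) => ->; split=> //=.
  by rewrite !ffunE eqxx.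
by move=> l lc; rewrite !ffunE (negPf lc).
Qed.

Lemma mdelta_mact hd q : exists q' f, mdelta hd q = (q', mact hd f) /\
  (hd cert = None -> q' = None).
Proof.
have rej : exists q' f, mreject hd = (q', mact hd f) /\
  (hd cert = None -> q' = None) by exists None, (mstay hd).
rewrite /mdelta; case: q => [[i [[j d]|]]|] //.
  by case: (hd cert) => [[b|[]]|] //; do 2 eexists.
case: (hd cert) rej => [[b|[]]|] // rej.
case: (mcont i) => [|[|j d|j d|j|p q|p q|p] k] //; try by do 2 eexists.
  case: (hd _) => [[d'|[]]|] //; case: ifP => _ //; by do 2 eexists.
by case: (hd _) => [d'|] //; do 2 eexists.
Qed.

Lemma step_halts c u : represents (c_tapes c cert) u ->
  verdict (step c) <> None \/
  represents (c_tapes (step c) cert) (behead u) /\ u <> [::].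
Proof.
move=> cu; case out_c: (verdict c) => [b|].
  by left; rewrite /tm_step /= out_c out_c.
have [q [f [dE q0]]] := mdelta_mact (heads c) (c_state c).
have [st_c tp_c _] := step_delta out_c dE.
rewrite tp_c; case: u cu => [|b u] cu; last by right; split=> //; exact: represents_pop cu.
by left; rewrite st_c q0 // headsE (represents_head cu).
Qed.

(** Each step uses up one bit unless the machine has halted; the additional step meets the blank
    behind the certificate and rejects. *)
Lemma machine_halts c u : represents (c_tapes c cert) u ->
  verdict (iter (size u).+1 step c) <> None.
Proof.
elim: u c => [|b u IH] c cu; case: (step_halts cu) => [v|[cu' u0]] //.
- exact: (iter_verdict_le (t := 1) _ v).
- by rewrite iterSr; apply: IH.
Qed.

Lemma cert_tape x u : represents (c_tapes (tm_init machine x u) cert) u.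
Proof.
move=> n; rewrite ffunE /= /cert inordK //= /input_tape /cells.
by case: u n => [|b u] [|n] //=; rewrite nth_nil.
Qed.

Lemma machine_poly_time : poly_time machine.
Proof.
exists ('X + 1)%R => x u; rewrite /tm_run.
apply: (iter_verdict_le (t := (size u).+1)).
  rewrite hornerD hornerX hornerC.
  change ((size u).+1 <= (size x + size u) + 1)%N; lia.
exact/machine_halts/cert_tape.
Qed.

(** Stack [i] lives on tape [i], so index 1 is reserved for the certificate. *)
Fixpoint well_indexed (p : prog) : bool :=
  match p with
  | Skip => true
  | Push i _ | Pop i _ | IsEmpty i => (i < m.+2) && (i != 1)
  | Seq p q | Alt p q => well_indexed p && well_indexed q
  | Star p => well_indexed p
  end.

Lemma conts_well_indexed p k : well_indexed p -> all well_indexed k ->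
  all (all well_indexed) (conts p k).
Proof.
elim: p k => [|i d|i d|i|p1 IH1 p2 IH2|p1 IH1 p2 IH2|p1 IH1] k /=;
  try by move=> wi wk; rewrite ?wi ?wk.
- by move=> /andP[w1 w2] wk; rewrite all_cat w1 w2 wk IH1 ?IH2 //= w2 wk.
- by move=> /andP[w1 w2] wk; rewrite all_cat w1 w2 wk IH1 ?IH2 //= w2 wk.
- by move=> w1 wk; rewrite w1 wk IH1 //= w1 wk.
Qed.

(** Between the two machine steps of a push, the simulated stack already contains the new bit while
    the tape does not; simulation is stated for the tape as it will be after the write. *)
Definition settled c (pend : option ('I_m.+2 * bool)) (l : 'I_m.+2) :
    tape msym :=
  if pend is Some (j, d) then
    if l == j then tape_write (Some (inl d)) (c_tapes c l) else c_tapes c l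
  else c_tapes c l.

Definition simulates c (pend : option ('I_m.+2 * bool)) (k : seq prog)
    (s : stacks) : Prop :=
  [/\ k \in mconts, c_state c = Some (mindex k, pend) &
      forall l : 'I_m.+2, l != cert -> represents (settled c pend l) (s l)].

Hypothesis P_ok : well_indexed P.

Lemma cont_well_indexed p k : p :: k \in mconts -> well_indexed p.
Proof.
rewrite inE /= => kP.
by have /allP/(_ _ kP)/andP[] := conts_well_indexed P_ok (isT : all well_indexed [::]).
Qed.

Lemma inord_index i : (i < m.+2) && (i != 1) -> inord i != cert :> 'I_m.+2 /\
  (inord i : 'I_m.+2) = i :> nat.
Proof.
move=> /andP[im i1]; split; last exact: inordK.
by apply/eqP => /(congr1 val) /=; rewrite !inordK // => /eqP; rewrite (negPf i1).
Qed.

Definition pending (p : prog) : option ('I_m.+2 * bool) :=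
  if p is Push j d then Some (inord j, d) else None.

Lemma verdict_sim c pend k s : simulates c pend k s ->
  verdict c = if k is [::] then Some true else None.
Proof. by case=> kP -> _ /=; rewrite mindexK. Qed.

Lemma step_sim c k p s b u :
  simulates c None (p :: k) s -> represents (c_tapes c cert) (b :: u) ->
  represents (c_tapes (step c) cert) u /\
  match eff p s with
  | None => c_state (step c) = None
  | Some s' => simulates (step c) (pending p) (ctl b p k) s'
  end.
Proof.
case=> kP st_c reps cu; have wp := cont_well_indexed kP.
have kP' := mconts_ctl b kP.
have hdE l : l != cert ->
    t_head (c_tapes c l) = if s l is b :: _ then Some (inl b) else None.
  by move=> lc; apply/represents_head/reps.
have out_c : verdict c = None by rewrite st_c /= mindexK.
have hdE' l : l != cert ->
    heads c l = if s l is b :: _ then Some (inl b) else None.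
  by move=> lc; rewrite headsE hdE.
(* A trivial equation of which only the right-hand side gets evaluated, which brings it into the
   shape required by [step_delta]. *)
have dE : mdelta (heads c) (c_state c) = mdelta (heads c) (c_state c) by [].
move: dE; rewrite {2}st_c {2}/mdelta mindexK // headsE (represents_head cu).
have cert_ok q f : mdelta (heads c) (c_state c) = (q, mact (heads c) f) ->
    represents (c_tapes (step c) cert) u.
  move=> /(step_delta out_c)[_ -> _]; exact: represents_pop cu.
have stay q : mdelta (heads c) (c_state c) = (q, mact (heads c) (mstay (heads c))) ->
    forall l, l != cert -> represents (c_tapes (step c) l) (s l).
  move=> /(step_delta out_c)[_ _ tpE] l lc; rewrite tpE //= headsE tape_write_head.
  exact: reps.
have rej : mdelta (heads c) (c_state c) = mreject (heads c) ->
    c_state (step c) = None by move=> /(step_delta out_c)[].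
have nop : mdelta (heads c) (c_state c) =
    (Some (mindex (ctl b p k), None), mact (heads c) (mstay (heads c))) ->
    simulates (step c) None (ctl b p k) s.
  by move=> dE; split=> //; [have [] := step_delta out_c dE | apply: stay dE].
case: p st_c kP kP' wp nop => [|j d|j d|j|p q|p q|p] st_c kP kP' wp nop dE;
  try by split; [exact: cert_ok dE | exact: nop dE].
- have [jc jE] := inord_index wp; split; first exact: cert_ok dE.
  have [stE _ tpE] := step_delta out_c dE.
  split=> //= l lc; rewrite tpE // /upd.
  case: eqP => [->|lj].
    rewrite jE eqxx /= headsE; have := reps (inord j) jc; rewrite jE.
    exact: represents_push.
  case: eqP => [/= lj'|_ /=]; first by case: lj; apply: val_inj; rewrite /= jE.
  by rewrite headsE tape_write_head; exact: reps.
- have [jc jE] := inord_index wp; move: dE; rewrite (hdE' _ jc) jE /=.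
  case sj: (s j) => [|d' w] dE; first by split; [exact: cert_ok dE | exact: rej].
  case: ifP dE => dd dE; last by split; [exact: cert_ok dE | exact: rej].
  split; first exact: cert_ok dE.
  have [stE _ tpE] := step_delta out_c dE.
  split=> //= l lc; rewrite tpE // /upd.
  case: eqP => [->|lj].
    rewrite jE eqxx /= headsE.
    by have := reps (inord j) jc; rewrite jE sj => /represents_pop.
  case: eqP => [/= lj'|_ /=]; first by case: lj; apply: val_inj; rewrite /= jE.
  by rewrite headsE tape_write_head; exact: reps.
- have [jc jE] := inord_index wp; move: dE; rewrite (hdE' _ jc) jE /=.
  case sj: (s j) => [|d' w] dE; last by split; [exact: cert_ok dE | exact: rej].
  by split; [exact: cert_ok dE | exact: nop dE].
Qed.

Lemma step_pending c k s j d b u :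
  simulates c (Some (j, d)) k s -> k <> [::] ->
  represents (c_tapes c cert) (b :: u) ->
  simulates (step c) None k s /\ represents (c_tapes (step c) cert) u.
Proof.
case=> kP st_c reps k0 cu.
have out_c : verdict c = None by rewrite st_c /= mindexK //; case: k k0 {kP st_c}.
have dE : mdelta (heads c) (c_state c) = (Some (mindex k, None), mact (heads c)
    (fun l => if l == j then (Some (inl d), Stay) else mstay (heads c) l)).
  by rewrite st_c /mdelta headsE (represents_head cu).
have [stE tp1 tpE] := step_delta out_c dE.
split; last by rewrite tp1; exact: represents_pop cu.
split=> //= l lc; rewrite tpE //; move: (reps l lc) => /=.
by case: ifP => _ //=; rewrite headsE tape_write_head.
Qed.

Lemma no_cert_rejects c : represents (c_tapes c cert) [::] ->
  verdict c = None -> c_state (step c) = None.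
Proof.
move=> cu out_c; have [q [f [dE q0]]] := mdelta_mact (heads c) (c_state c).
by have [-> _ _] := step_delta out_c dE; rewrite q0 // headsE (represents_head cu).
Qed.

Lemma rejected c t : c_state c = None -> verdict (iter t step c) = Some false.
Proof.
move=> st_c; have v : verdict c = Some false by rewrite st_c.
by rewrite (iter_halted _ v).
Qed.

(** A rejecting state is never left. Hence an accepting run has met neither a failed test nor the
    end of the certificate, and its steps spell out a run of the program. *)
Lemma sim_accept_run t c pend k s u :
  simulates c pend k s -> represents (c_tapes c cert) u ->
  verdict (iter t step c) = Some true -> exists n, run n k s.
Proof.
elim: t c pend k s u => [|t IH] c pend k s u sim cu.
  rewrite (verdict_sim sim); case: k sim => // _ _; exists 0; constructor.
case: k sim => [|p k] sim; first by exists 0; constructor.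
rewrite iterSr; case: u cu => [|b u] cu.
  by rewrite rejected // no_cert_rejects // (verdict_sim sim).
case: pend sim => [[j d]|] sim.
  have [//|sim' cu'] := step_pending sim _ cu.
  exact: (IH _ _ _ _ u sim' cu').
have [cu'] := step_sim sim cu; case eff_s: (eff p s) => [s'|]; last first.
  by move=> st; rewrite rejected.
move=> sim' /(IH _ _ _ _ u sim' cu') [n Rn].
by exists n.+1; apply: run_cons Rn.
Qed.

(** The factor two is due to pushes, which take two machine steps. *)
Lemma run_sim_accept n k s : run n k s -> exists2 u, size u <= n.*2 &
  forall c, simulates c None k s -> represents (c_tapes c cert) u ->
  exists t, verdict (iter t step c) = Some true.
Proof.
elim=> [{}s|b p {}k {}s s' {}n eff_s _ [u sz_u IH]].
  by exists [::] => // c sim _; exists 0; rewrite (verdict_sim sim).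
(* The bit that resolves the choice and, after a push, one dummy bit consumed by the pending
   write. *)
exists (b :: nseq (pending p) true ++ u).
  by rewrite /= size_cat size_nseq doubleS; case: (pending p) => /= [_|]; lia.
move=> c sim cu; have [cu'] := step_sim sim cu; rewrite eff_s => sim'.
case: (pending p) sim' cu' => [[j d]|] sim' /= cu'; last first.
  by have [t acc] := IH _ sim' cu'; exists t.+1; rewrite iterSr.
(* If the push was the last operation, the machine accepts with the write still pending. *)
case: (ctl b p k) sim' IH => [|q l] sim' IH; first by exists 1; rewrite (verdict_sim sim').
have [//|sim2 cu2] := step_pending sim' _ cu'.
by have [t acc] := IH _ sim2 cu2; exists t.+2; rewrite !iterSr.
Qed.

Definition init (x : seq bool) : stacks := fun i => if i == 0 then x else [::].

Lemma init_sim x u : simulates (tm_init machine x u) None [:: P] (init x).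
Proof.
split=> //; first by rewrite inE /= conts_head.
move=> l lc; rewrite /= ffunE /init; case: eqP => l0 n.
  by rewrite /input_tape; case: x n => [|b x] [|n] //=; rewrite nth_nil.
case: eqP => [l1|_] /=; last by case: n => [|n] //=; rewrite nth_nil.
by case/eqP: lc; apply: val_inj; rewrite /= l1 /cert inordK.
Qed.

Theorem stack_in_NP (L : seq bool -> Prop) (p : {poly nat}) :
  (forall n x, run n [:: P] (init x) -> L x) ->
  (forall x, L x -> exists2 n, n <= p.[size x]%R & run n [:: P] (init x)) ->
  in_NP L.
Proof.
move=> sound complete; exists machine, (p + p)%R.
split=> [|x]; first exact: machine_poly_time.
split=> [/complete[n le_n Rn]|[u [_ [t acc]]]].
  have [u sz_u acc] := run_sim_accept Rn; exists u; split.
    apply: (leq_trans sz_u); rewrite hornerD -addnn.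
    exact: (leq_add le_n le_n).
  have [t acc_t] := acc _ (init_sim x u) (cert_tape x u).
  by exists t.
have [n Rn] := sim_accept_run (init_sim x u) (cert_tape x u) acc.
exact: sound Rn.
Qed.

End Machine.

(** * Loops over stacks and their cost *)

Definition within (p : prog) (n : nat) (s s' : stacks) : Prop :=
  exists2 m, m <= n & leads p m s s'.

Lemma within_le p n m s s' : n <= m -> within p n s s' -> within p m s s'.
Proof. by move=> le_nm [l le_ln Lp]; exists l => //; exact: leq_trans le_nm. Qed.

Lemma within_seq p q n m s1 s2 s3 :
  within p n s1 s2 -> within q m s2 s3 -> within (Seq p q) (n + m).+1 s1 s3.
Proof.
move=> [n' le_n Lp] [m' le_m Lq]; exists (n' + m').+1; first lia.
exact: leads_seq Lp Lq.
Qed.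

Lemma within_alt b p q n s s' :
  within (if b then p else q) n s s' -> within (Alt p q) n.+1 s s'.
Proof. by move=> [m le_m Lp]; exists m.+1 => //; exact: leads_alt Lp. Qed.

Lemma within_star p n m s1 s2 s3 :
  within p n s1 s2 -> within (Star p) m s2 s3 ->
  within (Star p) (n + m).+1 s1 s3.
Proof.
move=> [n' le_n Lp] [m' le_m Lq]; exists (n' + m').+1; first lia.
exact: leads_star Lp Lq.
Qed.

Lemma within_leads p n s s' : leads p n s s' -> within p n s s'.
Proof. by exists n. Qed.

Lemma updE s i w : upd s i w i = w.
Proof. by rewrite /upd eqxx. Qed.

Lemma updN s i j w : j != i -> upd s i w j = s j.
Proof. by rewrite /upd => /negPf->. Qed.

Ltac stacks_eq :=
  apply: functional_extensionality => ?; rewrite /upd;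
  repeat (case: eqP => // ?); subst => //=; try congruence; try lia.

Definition popcase (i : nat) (f : bool -> prog) : prog :=
  Alt (Seq (Pop i true) (f true)) (Seq (Pop i false) (f false)).

(** A star may be left at any time; the final test excludes the runs that leave it early. *)
Definition drain (i : nat) (f : bool -> prog) : prog :=
  Seq (Star (popcase i f)) (IsEmpty i).

Lemma den_popcase i f s s' : den (popcase i f) s s' ->
  exists b w, s i = b :: w /\ den (f b) (upd s i w) s'.
Proof.
by case=> [[s1 /=]|[s1 /=]]; case: (s i) => // b w; case: eqP => // -> [<-];
  [exists true, w | exists false, w].
Qed.

Lemma within_popcase b i f n s s' w : s i = b :: w ->
  within (f b) n (upd s i w) s' -> within (popcase i f) n.+3 s s'.
Proof.
move=> si Wf; apply: (within_alt (b := b)).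
have := within_seq (within_leads (leads_pop si)) Wf; rewrite add1n.
by case: b {si} Wf.
Qed.

(* [g b] is the effect of the loop body, [E w] that of the whole loop on a
   stack [i] containing [w]; [ok w] states that the loop can be completed. *)
Section Drain.
Variables (i : nat) (f : bool -> prog) (g : bool -> stacks -> stacks).
Variables (E : seq bool -> stacks -> stacks) (ok : seq bool -> stacks -> Prop).
Hypothesis E_nil : forall s, s i = [::] -> E [::] s = s.
Hypothesis E_cons : forall b w s, s i = b :: w ->
  E w (g b (upd s i w)) = E (b :: w) s.
Hypothesis g_i : forall b s, g b s i = s i.

Lemma den_drain s s' :
  (forall s, s i = [::] -> ok [::] s) ->
  (forall b w s, s i = b :: w -> ok w (g b (upd s i w)) ->
     forall s1, den (f b) (upd s i w) s1 -> ok (b :: w) s) ->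
  (forall b s s', den (f b) s s' -> s' = g b s) ->
  den (drain i f) s s' -> ok (s i) s /\ s' = E (s i) s.
Proof.
move=> ok0 okS den_f [s1 st /=]; case s1i: (s1 i) => // -[<-] {s'}.
elim: st s1i => {s s1} [s|s s1 s2 /den_popcase[b [w [si fb]]] _ IH] s2i.
  by rewrite s2i E_nil //; split=> //; exact: ok0.
have s1E := den_f _ _ _ fb; have [okw ->] := IH s2i.
move: okw; rewrite s1E !g_i updE si E_cons // => okw; split=> //.
exact: okS okw _ fb.
Qed.

(** Per bit, [c] steps for the body, three for [popcase] and one for the iteration. The final three
    leave the star, perform the test and sequence the two. *)
Lemma within_drain c w s : s i = w -> ok w s ->
  (forall b w s, ok (b :: w) s -> s i = b :: w -> ok w (g b (upd s i w))) ->
  (forall b w s, ok (b :: w) s -> s i = b :: w ->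
     within (f b) c (upd s i w) (g b (upd s i w))) ->
  within (drain i f) ((c + 4) * size w + 3) s (E w s).
Proof.
move=> + + okS Wf.
have st : s i = w -> ok w s ->
    within (Star (popcase i f)) ((c + 4) * size w + 1) s (E w s) /\
    E w s i = [::].
  elim: w s => [|b w IH] s si okw.
    by rewrite E_nil // muln0; split=> //; exact/within_leads/leads_star0.
  have [|//|] := IH (g b (upd s i w)); first by rewrite g_i updE.
    exact: okS.
  rewrite E_cons // => Ww Ei; split=> //.
  have := within_star (within_popcase si (Wf _ _ _ okw si)) Ww.
  by apply: within_le => /=; lia.
move=> si okw; have [Ws Ei] := st si okw.
have := within_seq Ws (within_leads (leads_empty Ei)).
by apply: within_le; lia.
Qed.

End Drain.

Section Loops.
Variables i j : nat.
Hypothesis ij : i != j.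

(** Moving a stack bit by bit reverses it, hence [catrev]. A second transfer restores the order,
    which is how registers are read without being lost. *)
Lemma den_transfer s s' : den (drain i (fun b => Push j b)) s s' ->
  s' = upd (upd s i [::]) j (catrev (s i) (s j)).
Proof.
pose g b s := upd s j (b :: s j).
pose E w s := upd (upd s i [::]) j (catrev w (s j)).
case/(@den_drain i _ g E (fun _ _ => True)) => //.
- by move=> {}s si; rewrite /E; stacks_eq.
- by move=> b w {}s si; rewrite /E /g; stacks_eq.
- by move=> b {}s; rewrite /g updN.
- by move=> b {}s {}s' [<-].
Qed.

Lemma within_transfer s :
  within (drain i (fun b => Push j b)) (5 * size (s i) + 3) s
    (upd (upd s i [::]) j (catrev (s i) (s j))).
Proof.
pose g b s := upd s j (b :: s j).
pose E w s := upd (upd s i [::]) j (catrev w (s j)).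
apply: (@within_drain i _ g E (fun _ _ => True) _ _ _ 1) => //.
- by move=> {}s si; rewrite /E; stacks_eq.
- by move=> b w {}s si; rewrite /E /g; stacks_eq.
- by move=> b {}s; rewrite /g updN.
- by move=> *; exact/within_leads/leads_push.
Qed.

Lemma den_clear s s' : den (drain i (fun=> Skip)) s s' -> s' = upd s i [::].
Proof.
case/(@den_drain i _ (fun _ s => s) (fun _ s => upd s i [::]) (fun _ _ => True)) => //.
- by move=> {}s si; stacks_eq.
- by move=> b w {}s si; stacks_eq.
- by move=> b {}s {}s' [].
Qed.

Lemma within_clear s :
  within (drain i (fun=> Skip)) (5 * size (s i) + 3) s (upd s i [::]).
Proof.
apply: (@within_drain i _ (fun _ s => s) (fun _ s => upd s i [::]) (fun _ _ => True) _ _ _ 1) => //.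
- by move=> {}s si; stacks_eq.
- by move=> b w {}s si; stacks_eq.
- by move=> *; exact/within_leads/leads_skip.
Qed.

Fixpoint pushw (w : seq bool) : prog :=
  if w is b :: w' then Seq (pushw w') (Push j b) else Skip.

Lemma den_pushw w s s' : den (pushw w) s s' -> s' = upd s j (w ++ s j).
Proof.
elim: w s' => [|b w IH] s' /=; first by case=> <-; stacks_eq.
by case=> s1 /IH -> [<-]; stacks_eq.
Qed.

Lemma within_pushw w s : within (pushw w) (2 * size w + 1) s (upd s j (w ++ s j)).
Proof.
elim: w => [|b w IH] /=.
  have -> : upd s j (s j) = s by stacks_eq.
  exact/within_leads/leads_skip.
have := within_seq IH (within_leads (@leads_push j b _)); rewrite updE.
have -> : upd (upd s j (w ++ s j)) j (b :: w ++ s j) = upd s j (b :: w ++ s j).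
  by stacks_eq.
by apply: within_le; lia.
Qed.

Variable h : bool -> seq bool.

Lemma den_expand s s' : den (drain i (fun b => pushw (h b))) s s' ->
  s' = upd (upd s i [::]) j (foldl (fun w b => h b ++ w) (s j) (s i)).
Proof.
pose g b s := upd s j (h b ++ s j).
pose E w s := upd (upd s i [::]) j (foldl (fun w b => h b ++ w) (s j) w).
case/(@den_drain i _ g E (fun _ _ => True)) => //.
- by move=> {}s si; rewrite /E; stacks_eq.
- by move=> b w {}s si; rewrite /E /g; stacks_eq.
- by move=> b {}s; rewrite /g updN.
- by move=> b {}s {}s' /den_pushw.
Qed.

Lemma within_expand c s : (forall b, size (h b) <= c) ->
  within (drain i (fun b => pushw (h b))) ((2 * c + 5) * size (s i) + 3) s
    (upd (upd s i [::]) j (foldl (fun w b => h b ++ w) (s j) (s i))).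
Proof.
pose g b s := upd s j (h b ++ s j).
pose E w s := upd (upd s i [::]) j (foldl (fun w b => h b ++ w) (s j) w).
move=> hc; have -> : 2 * c + 5 = 2 * c + 1 + 4 by lia.
apply: (@within_drain i _ g E (fun _ _ => True) _ _ _ (2 * c + 1)) => //.
- by move=> {}s si; rewrite /E; stacks_eq.
- by move=> b w {}s si; rewrite /E /g; stacks_eq.
- by move=> b {}s; rewrite /g updN.
- move=> b *; apply: within_le (within_pushw _ _); have := hc b; lia.
Qed.

Variable k : nat.
Hypotheses (ik : i != k) (jk : j != k).

Lemma den_transfer2 s s' :
  den (drain i (fun b => Seq (Push j b) (Push k b))) s s' ->
  s' = upd (upd (upd s i [::]) j (catrev (s i) (s j))) k (catrev (s i) (s k)).
Proof.
pose g b s := upd (upd s j (b :: s j)) k (b :: s k).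
pose E w s := upd (upd (upd s i [::]) j (catrev w (s j))) k (catrev w (s k)).
case/(@den_drain i _ g E (fun _ _ => True)) => //.
- by move=> {}s si; rewrite /E; stacks_eq.
- by move=> b w {}s si; rewrite /E /g; stacks_eq.
- by move=> b {}s; rewrite /g !updN.
- by move=> b {}s {}s' [s1 [<-] [<-]]; rewrite /g updN // eq_sym.
Qed.

Lemma within_transfer2 s :
  within (drain i (fun b => Seq (Push j b) (Push k b))) (7 * size (s i) + 3) s
    (upd (upd (upd s i [::]) j (catrev (s i) (s j))) k (catrev (s i) (s k))).
Proof.
pose g b s := upd (upd s j (b :: s j)) k (b :: s k).
pose E w s := upd (upd (upd s i [::]) j (catrev w (s j))) k (catrev w (s k)).
apply: (@within_drain i _ g E (fun _ _ => True) _ _ _ 3) => //.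
- by move=> {}s si; rewrite /E; stacks_eq.
- by move=> b w {}s si; rewrite /E /g; stacks_eq.
- by move=> b {}s; rewrite /g !updN.
- move=> b w {}s _ _.
  have := within_seq (within_leads (@leads_push j b (upd s i w)))
                     (within_leads (@leads_push k b _)).
  by rewrite /g [upd (upd s i w) j _ k]updN // eq_sym.
Qed.

(** Popping from [k] whatever comes out of [i] tests whether [i] is a prefix of [k]; the copy left
    on [j] allows [i] to be restored. *)
Lemma den_match s s' :
  den (drain i (fun b => Seq (Pop k b) (Push j b))) s s' ->
  exists2 v, s k = s i ++ v &
    s' = upd (upd (upd s i [::]) k v) j (catrev (s i) (s j)).
Proof.
pose g b s := upd (upd s k (behead (s k))) j (b :: s j).
pose E w s :=
  upd (upd (upd s i [::]) k (drop (size w) (s k))) j (catrev w (s j)).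
case/(@den_drain i _ g E (fun w s => exists v, s k = w ++ v)) => //.
- by move=> {}s si; rewrite /E /= drop0; stacks_eq.
- move=> b w {}s si; rewrite /E /g; stacks_eq.
  by case: (s _) => //; rewrite drop_nil.
- by move=> b {}s; rewrite /g !updN.
- by move=> {}s si; exists (s k).
- move=> b w {}s si [v]; rewrite /g updN 1?eq_sym // updE updN 1?eq_sym // => sk s1 /=.
  case=> s2; rewrite /= updN 1?eq_sym //; case skE: (s k) sk => [|b' u] //= uE.
  by case: eqP => // bb _ _; exists v; rewrite ?skE ?bb uE.
- move=> b {}s {}s' [s1 /=]; case sk: (s k) => [|b' u] //; case: eqP => // _ [<-] [<-].
  by rewrite /g sk /= updN.
- move=> [v skE] ->; exists v => //; rewrite /E skE drop_size_cat //.
Qed.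

Lemma within_match s v : s k = s i ++ v ->
  within (drain i (fun b => Seq (Pop k b) (Push j b))) (7 * size (s i) + 3) s
    (upd (upd (upd s i [::]) k v) j (catrev (s i) (s j))).
Proof.
pose g b s := upd (upd s k (behead (s k))) j (b :: s j).
pose E w s :=
  upd (upd (upd s i [::]) k (drop (size w) (s k))) j (catrev w (s j)).
move=> skE; have -> : upd (upd (upd s i [::]) k v) j (catrev (s i) (s j)) = E (s i) s.
  by rewrite /E skE drop_size_cat.
apply: (@within_drain i _ g E (fun w s => exists v, s k = w ++ v) _ _ _ 3) => //.
- by move=> {skE}s si; rewrite /E /= drop0; stacks_eq.
- move=> b w {skE}s si; rewrite /E /g; stacks_eq.
  by case: (s _) => //; rewrite drop_nil.
- by move=> b {skE}s; rewrite /g !updN.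
- by exists v.
- move=> b w {skE}s [u sk] si; exists u.
  by rewrite /g updN 1?eq_sym // updE updN 1?eq_sym // sk.
- move=> b w {skE}s [u sk] si.
  have sk' : upd s i w k = b :: (w ++ u) by rewrite updN 1?eq_sym.
  have := within_seq (within_leads (leads_pop sk')) (within_leads (@leads_push j b _)).
  by rewrite /g sk' /= [upd (upd s i w) k _ j]updN.
Qed.

End Loops.

Lemma all_In (T : Type) (p : pred T) s x : all p s -> List.In x s -> p x.
Proof. by elim: s => //= y s IH /andP[py /IH{}IH] [<-|/IH]. Qed.

(** * Horn clauses over binary trees *)

Inductive tree := Lf | Nd of tree & tree.

Definition tree_dec (t u : tree) : {t = u} + {t <> u}.
Proof. by decide equality. Defined.

HB.instance Definition _ := hasDecEq.Build tree (compareP tree_dec).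

Fixpoint tsize (t : tree) : nat :=
  if t is Nd t1 t2 then (tsize t1 + tsize t2).+1 else 1.

Fixpoint code (t : tree) : seq bool :=
  if t is Nd t1 t2 then true :: code t1 ++ code t2 else [:: false].

Lemma size_code t : size (code t) = tsize t.
Proof. by elim: t => //= t1 IH1 t2 IH2; rewrite size_cat IH1 IH2. Qed.

Lemma code_inj t u w w' : code t ++ w = code u ++ w' -> t = u /\ w = w'.
Proof.
elim: t u w w' => [|t1 IH1 t2 IH2] [|u1 u2] w w' //=; first by case.
by case; rewrite -!catA => /IH1[-> /IH2[-> ->]].
Qed.

Definition codes (ts : seq tree) : seq bool := flatten (map code ts).

Lemma codes_split ts t w : codes ts = code t ++ w ->
  exists2 ts', ts = t :: ts' & w = codes ts'.
Proof.
by case: ts => [|u ts]; [case: t | move/code_inj=> [<- <-]; exists ts].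
Qed.

Definition bit (b : bool) : tree := if b then Nd Lf Lf else Lf.

(** A word as a right comb with an open end [t], which plays the role of the unread input, as in
    difference lists. *)
Definition tcat (w : seq bool) (t : tree) : tree :=
  foldr (fun b t => Nd (bit b) t) t w.

Inductive pat := PV of nat | PL | PN of pat & pat.

Fixpoint inst (s : nat -> tree) (p : pat) : tree :=
  match p with
  | PV x => s x
  | PL => Lf
  | PN p q => Nd (inst s p) (inst s q)
  end.

Fixpoint pat_below (V : nat) (p : pat) : bool :=
  match p with
  | PV x => x < V
  | PL => true
  | PN p q => pat_below V p && pat_below V q
  end.

Fixpoint psize (p : pat) : nat :=
  if p is PN p q then (psize p + psize q).+1 else 1.

Definition clause : Type := (pat * seq pat)%type.

(* Refutations of a list of goals with [n] resolution steps, in which all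
   variables are instantiated by trees of size at most [B]. *)
Inductive ders (H : seq clause) (B : nat) : nat -> seq tree -> Prop :=
| ders_nil : ders H B 0 [::]
| ders_cons c s n gs :
    List.In c H -> (forall x, tsize (s x) <= B) ->
    ders H B n (map (inst s) c.2 ++ gs) -> ders H B n.+1 (inst s c.1 :: gs).

(* Stack 0 holds the input, 2 the codes of the pending goals, 3 a counter, 4
   serves for copying, and [x.+1.+4] is the register of variable [x]. *)
Notation goals := 2.
Notation counter := 3.
Notation tmp := 4.
Notation reg x := x.+1.+4.

(** The normal form of the stacks between two operations: the input has been consumed, and counter
    and scratch stack are empty. *)
Definition st (r : nat -> seq bool) (w : seq bool) : stacks :=
  fun i => match i with
           | goals => w
           | reg x => r x
           | _ => [::]
           end.

Lemma st_upd_goals r w v : upd (st r w) goals v = st r v.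
Proof. by apply: functional_extensionality => -[|[|[|]]]. Qed.

Lemma st_upd_reg r w x v : upd (st r w) (reg x) v = st (upd r x v) w.
Proof. by apply: functional_extensionality => -[|[|[|[|[|]]]]]. Qed.

(** The register is emptied into [tmp], in reverse, and refilled from there, so that a variable may
    occur several times in a clause. *)
Definition match_var (x : nat) : prog :=
  Seq (drain (reg x) (fun b => Seq (Pop goals b) (Push tmp b)))
      (drain tmp (fun b => Push (reg x) b)).

Definition push_var (x : nat) : prog :=
  Seq (drain (reg x) (fun b => Push tmp b))
      (drain tmp (fun b => Seq (Push (reg x) b) (Push goals b))).

Lemma catrev2 (u v : seq bool) : catrev (catrev u [::]) v = u ++ v.
Proof. by rewrite [catrev u _]catrevE cats0 catrevE revK. Qed.

Lemma den_match_var x r w s' : den (match_var x) (st r w) s' ->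
  exists2 v, w = r x ++ v & s' = st r v.
Proof.
case=> s1 /(@den_match (reg x) tmp isT goals isT isT)[v /= -> ->].
move=> /(@den_transfer tmp (reg x) isT) ->; exists v => //.
rewrite /upd; apply: functional_extensionality => -[|[|[|[|[|y]]]]] //=.
by rewrite eqxx; case: eqP => // -[->] /=; rewrite catrev2 cats0.
Qed.

Lemma within_match_var x r v :
  within (match_var x) (12 * size (r x) + 7) (st r (r x ++ v)) (st r v).
Proof.
have W1 := @within_match (reg x) tmp isT goals isT isT (st r (r x ++ v)) v erefl.
have := within_seq W1 (@within_transfer tmp (reg x) isT _).
rewrite !updE [st _ _ _]/= [st _ _ _]/= catrevE cats0 size_rev.
rewrite (_ : upd _ _ _ = st r v); first by apply: within_le; lia.
rewrite /upd; apply: functional_extensionality => -[|[|[|[|[|y]]]]] //=.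
by rewrite eqxx; case: eqP => // -[->] /=; rewrite catrev2 cats0.
Qed.

Lemma den_push_var x r w s' : den (push_var x) (st r w) s' ->
  s' = st r (r x ++ w).
Proof.
case=> s1 /(@den_transfer (reg x) tmp isT) ->.
move=> /(@den_transfer2 tmp (reg x) isT goals isT isT) ->.
rewrite /upd; apply: functional_extensionality => -[|[|[|[|[|y]]]]] //=.
  by rewrite catrev2.
by rewrite eqxx; case: eqP => // -[->] /=; rewrite catrev2 cats0.
Qed.

Lemma within_push_var x r w :
  within (push_var x) (12 * size (r x) + 7) (st r w) (st r (r x ++ w)).
Proof.
have W1 := @within_transfer (reg x) tmp isT (st r w).
have := within_seq W1 (@within_transfer2 tmp (reg x) isT goals isT isT _).
rewrite !updE [st _ _ _]/= [st _ _ _]/= catrevE cats0 size_rev.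
rewrite (_ : upd _ _ _ = st r (r x ++ w)); first by apply: within_le; lia.
rewrite /upd; apply: functional_extensionality => -[|[|[|[|[|y]]]]] //=.
  by rewrite catrev2.
by rewrite eqxx; case: eqP => // -[->] /=; rewrite catrev2 cats0.
Qed.

Fixpoint match_pat (p : pat) : prog :=
  match p with
  | PV x => match_var x
  | PL => Pop goals false
  | PN p q => Seq (Pop goals true) (Seq (match_pat p) (match_pat q))
  end.

(** Right to left, since the top of a stack is the left end of the word that it holds. *)
Fixpoint push_pat (p : pat) : prog :=
  match p with
  | PV x => push_var x
  | PL => Push goals false
  | PN p q => Seq (push_pat q) (Seq (push_pat p) (Push goals true))
  end.

Section Patterns.
Variables (V : nat) (r : nat -> seq bool) (s : nat -> tree).
Hypothesis r_s : forall x, x < V -> r x = code (s x).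

Lemma den_match_pat p w s' : pat_below V p -> den (match_pat p) (st r w) s' ->
  exists2 v, w = code (inst s p) ++ v & s' = st r v.
Proof.
elim: p w s' => [x|//|p IHp q IHq] w s' /=.
- by move=> xV /den_match_var[v -> ->]; exists v => //; rewrite r_s.
- by move=> _; case: w => [|[] w] // [<-]; exists w => //; rewrite st_upd_goals.
- move=> /andP[pV qV] [s1]; case: w => [|[] w] // [<-]; rewrite st_upd_goals.
  by move=> [s2 /(IHp _ _ pV)[v -> ->] /(IHq _ _ qV)[u -> ->]]; exists u; rewrite -?catA.
Qed.

Lemma den_push_pat p w s' : pat_below V p -> den (push_pat p) (st r w) s' ->
  s' = st r (code (inst s p) ++ w).
Proof.
elim: p w s' => [x|//|p IHp q IHq] w s' /=.
- by move=> xV /den_push_var ->; rewrite r_s.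
- by move=> _ [<-]; rewrite st_upd_goals.
- move=> /andP[pV qV] [s1 /(IHq _ _ qV)-> [s2 /(IHp _ _ pV)->] [<-]].
  by rewrite st_upd_goals /= -catA.
Qed.

Variable B : nat.
Hypothesis s_B : forall x, tsize (s x) <= B.

(* All costs are multiples of that of handling one variable. *)
Definition unit_cost := 12 * B + 20.

Lemma within_match_pat p v : pat_below V p ->
  within (match_pat p) (psize p * unit_cost) (st r (code (inst s p) ++ v)) (st r v).
Proof.
elim: p v => [x|//|p IHp q IHq] v /=.
- move=> xV; rewrite -r_s //; apply: within_le (within_match_var _ _ _).
  rewrite r_s // size_code mul1n /unit_cost; have := s_B x; lia.
- move=> _; have := @leads_pop goals false (st r (false :: v)) v erefl.
  by rewrite st_upd_goals => /within_leads; apply: within_le; rewrite /unit_cost; lia.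
- move=> /andP[pV qV].
  set u := (X in st r (true :: X)).
  have uE : u = code (inst s p) ++ code (inst s q) ++ v by rewrite /u catA.
  have := @leads_pop goals true (st r (true :: u)) u erefl.
  rewrite st_upd_goals {2}uE => /within_leads W1.
  have := within_seq W1 (within_seq (IHp _ pV) (IHq v qV)).
  by apply: within_le; rewrite mulSn mulnDl /unit_cost; lia.
Qed.

Lemma within_push_pat p w : pat_below V p ->
  within (push_pat p) (psize p * unit_cost) (st r w) (st r (code (inst s p) ++ w)).
Proof.
elim: p w => [x|//|p IHp q IHq] w /=.
- move=> xV; rewrite -r_s //; apply: within_le (within_push_var _ _ _).
  rewrite r_s // size_code mul1n /unit_cost; have := s_B x; lia.
- move=> _; have := @leads_push goals false (st r w).
  by rewrite st_upd_goals => /within_leads; apply: within_le; rewrite /unit_cost; lia.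
- move=> /andP[pV qV].
  have := within_seq (IHq w qV) (within_seq (IHp _ pV)
    (within_leads (@leads_push goals true _))).
  rewrite st_upd_goals /= -catA; apply: within_le.
  by rewrite mulSn mulnDl /unit_cost; lia.
Qed.

Fixpoint push_pats (ps : seq pat) : prog :=
  if ps is p :: ps then Seq (push_pats ps) (push_pat p) else Skip.

Lemma den_push_pats ps w s' : all (pat_below V) ps ->
  den (push_pats ps) (st r w) s' -> s' = st r (codes (map (inst s) ps) ++ w).
Proof.
elim: ps s' => [|p ps IH] s' /=; first by move=> _ [<-].
move=> /andP[pV psV] [s1 /(IH _ psV)-> /(den_push_pat pV)->].
by rewrite catA.
Qed.

Lemma within_push_pats ps w : all (pat_below V) ps ->
  within (push_pats ps) ((sumn (map psize ps) + size ps).+1 * unit_cost)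
    (st r w) (st r (codes (map (inst s) ps) ++ w)).
Proof.
elim: ps => [|p ps IH] /= => [_|/andP[pV psV]].
  by apply: within_le (within_leads (@leads_skip _)); rewrite /unit_cost; lia.
have := within_seq (IH psV) (within_push_pat _ pV); rewrite catA.
by apply: within_le; rewrite addnS !mulSn !mulnDl /unit_cost; lia.
Qed.

End Patterns.

(* Trees are generated bottom-up: the register holds the codes of a forest
   whose size is the counter. *)
Definition gen_step (x : nat) : prog :=
  Alt (Seq (Push (reg x) false) (Push counter true))
      (Seq (Pop counter true) (Seq (Pop counter true)
        (Seq (Push counter true) (Push (reg x) true)))).

Definition gen (x : nat) : prog :=
  Seq (Star (gen_step x)) (Seq (Pop counter true) (IsEmpty counter)).

Definition forest_st (r : nat -> seq bool) w x (ts : seq tree) : stacks :=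
  upd (st (upd r x (codes ts)) w) counter (nseq (size ts) true).

Lemma forest_st_upd r w x ts v n :
  upd (upd (forest_st r w x ts) (reg x) v) counter n =
  upd (st (upd r x v) w) counter n.
Proof.
rewrite /forest_st /upd; apply: functional_extensionality => -[|[|[|[|[|y]]]]] //=.
by rewrite !eqSS; case: eqP.
Qed.

Lemma forest_st_reg r w x ts : forest_st r w x ts (reg x) = codes ts.
Proof. by rewrite /forest_st updN //= updE. Qed.

Lemma forest_st_counter r w x ts : forest_st r w x ts counter = nseq (size ts) true.
Proof. exact: updE. Qed.

Lemma den_pop i b s s' : den (Pop i b) s s' ->
  exists2 w, s i = b :: w & s' = upd s i w.
Proof. by rewrite /=; case: (s i) => // c w; case: eqP => // -> [<-]; exists w. Qed.

Lemma forest_st0 r w x : r x = [::] -> st r w = forest_st r w x [::].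
Proof.
move=> rx; rewrite /forest_st /upd; apply: functional_extensionality.
by case=> [|[|[|[|[|y]]]]] //=; case: eqP => // ->.
Qed.

Lemma forest_st1 r w x t :
  upd (forest_st r w x [:: t]) counter [::] = st (upd r x (code t)) w.
Proof.
rewrite /forest_st /upd; apply: functional_extensionality.
by case=> [|[|[|[|[|y]]]]] //=; rewrite /codes /= cats0.
Qed.

Lemma upd_swap s i j v w : i != j -> upd (upd s i v) j w = upd (upd s j w) i v.
Proof. by move=> ij; stacks_eq; move: ij; rewrite eqxx. Qed.

Lemma upd_twice s i v w : upd (upd s i v) i w = upd s i w.
Proof. by stacks_eq. Qed.

Lemma den_gen_step x r w ts s' : den (gen_step x) (forest_st r w x ts) s' ->
  exists ts', s' = forest_st r w x ts'.
Proof.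
case=> [[s1 [<-] [<-]]|].
  exists (Lf :: ts); rewrite (@updN _ (reg x) counter) // forest_st_reg.
  by rewrite forest_st_upd /forest_st updE.
case=> s1 /den_pop[v1]; rewrite forest_st_counter => cv ->.
case=> s2 /den_pop[v2]; rewrite updE => cv' -> [s3 [<-] [<-]].
case: ts cv => [|t [|u ts]] //= -[v1E]; rewrite -v1E in cv' * => //.
case: cv' => <-.
exists (Nd t u :: ts); rewrite !updE !upd_twice (@updN _ counter (reg x)) //.
rewrite [st _ _ _]/= updE upd_swap // st_upd_reg upd_twice.
by rewrite /forest_st /codes /= -?catA.
Qed.

Lemma within_gen_leaf x r w ts :
  within (gen_step x) 4 (forest_st r w x ts) (forest_st r w x (Lf :: ts)).
Proof.
have W1 := within_leads (@leads_push (reg x) false (forest_st r w x ts)).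
have := within_seq W1 (within_leads (@leads_push counter true _)).
rewrite (@updN _ (reg x) counter) // forest_st_reg forest_st_counter forest_st_upd.
exact: (@within_alt true).
Qed.

Lemma within_gen_node x r w ts t u :
  within (gen_step x) 8 (forest_st r w x [:: t, u & ts])
    (forest_st r w x (Nd t u :: ts)).
Proof.
set s := forest_st r w x [:: t, u & ts].
have W1 := within_leads (@leads_pop counter true s _ (forest_st_counter _ _ _ _)).
have W2 := within_leads (@leads_pop counter true _ _ (updE s counter _)).
have := within_seq W1 (within_seq (W2 _) (within_seq
  (within_leads (@leads_push counter true _))
  (within_leads (@leads_push (reg x) true _)))).
rewrite !updE !upd_twice (@updN _ counter (reg x)) //.
rewrite [st _ _ _]/= updE upd_swap // st_upd_reg upd_twice.
rewrite /forest_st /codes /= -?catA; exact: (@within_alt false).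
Qed.

Lemma within_gen_star x r w t ts n s' :
  within (Star (gen_step x)) n (forest_st r w x (t :: ts)) s' ->
  within (Star (gen_step x)) (10 * tsize t + n) (forest_st r w x ts) s'.
Proof.
elim: t ts n => [|t IHt u IHu] ts n W.
  by apply: within_le (within_star (within_gen_leaf _ _ _ _) W); rewrite /=; lia.
have := within_star (within_gen_node _ _ _ _ _ _) W.
by move=> /IHt /IHu; apply: within_le; rewrite /=; lia.
Qed.

(** The counter has one mark per tree of the forest, so a counter that is empty after one more pop
    means that there was a single tree. *)
Lemma den_gen x r w s' : r x = [::] -> den (gen x) (st r w) s' ->
  exists t, s' = st (upd r x (code t)) w.
Proof.
move=> /forest_st0-> [s1 st1 [s2]].
have {st1} [ts ->] : exists ts, s1 = forest_st r w x ts.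
  move: (Nil tree) st1 => ts st1; move s0E : (forest_st r w x ts) st1 => s0 st1.
  elim: st1 ts s0E => [s ts <-|s s3 s4 step _ IH ts sE]; first by exists ts.
  by move: step; rewrite -sE => /den_gen_step[ts' /esym/IH].
move=> /den_pop[v]; rewrite forest_st_counter => vE -> /=; rewrite updE.
case: ts vE => [|t [|u ts]] //= -[<-] // [<-]; exists t.
exact: forest_st1.
Qed.

Lemma within_gen x r w t : r x = [::] ->
  within (gen x) (10 * tsize t + 6) (st r w) (st (upd r x (code t)) w).
Proof.
move=> /(forest_st0 w)->.
have W1 := within_gen_star (within_leads (@leads_star0 (gen_step x) (forest_st r w x [:: t]))).
have W2 := within_leads (@leads_pop counter true _ _ (forest_st_counter r w x [:: t])).
have := within_seq W1 (within_seq W2 (within_leads (leads_empty (updE _ _ _)))).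
by rewrite forest_st1; apply: within_le; lia.
Qed.

Definition regs (s : nat -> tree) (k : nat) : nat -> seq bool :=
  fun x => if x < k then code (s x) else [::].

Lemma regsS s k : upd (regs s k) k (code (s k)) = regs s k.+1.
Proof.
apply: functional_extensionality => x; rewrite /upd /regs ltnS [in RHS]leq_eqVlt.
by case: eqP => // ->.
Qed.

Fixpoint gens (k : nat) : prog :=
  if k is j.+1 then Seq (gens j) (gen j) else Skip.

Fixpoint clears (k : nat) : prog :=
  if k is j.+1 then Seq (drain (reg j) (fun=> Skip)) (clears j) else Skip.

Lemma den_gens k w s' : den (gens k) (st (fun=> [::]) w) s' ->
  exists s, s' = st (regs s k) w.
Proof.
elim: k s' => [|k IH] s' /=; first by case=> <-; exists (fun=> Lf).
case=> s1 /IH[s ->] /den_gen[|t ->]; first by rewrite /regs ltnn.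
exists (fun x => if x == k then t else s x); congr st.
apply: functional_extensionality => x; rewrite /upd /regs ltnS [in RHS]leq_eqVlt.
by case: eqP.
Qed.

Lemma within_gens s B k w : (forall x, tsize (s x) <= B) ->
  within (gens k) (k.+1 * unit_cost B) (st (fun=> [::]) w) (st (regs s k) w).
Proof.
move=> s_B; elim: k => [|k IH] /=.
  by apply: within_le (within_leads (@leads_skip _)); rewrite /unit_cost; lia.
have rk : regs s k k = [::] by rewrite /regs ltnn.
have := within_seq IH (within_gen w (s k) rk); rewrite regsS.
by apply: within_le; rewrite [in leqRHS]mulSn /unit_cost; have := s_B k; lia.
Qed.

Lemma den_clears s k w s' : den (clears k) (st (regs s k) w) s' ->
  s' = st (fun=> [::]) w.
Proof.
elim: k s' => [|k IH] s' /=; first by case=> <-.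
case=> s1 /den_clear ->; rewrite st_upd_reg.
suff -> : upd (regs s k.+1) k [::] = regs s k by exact: IH.
apply: functional_extensionality => x; rewrite /upd /regs ltnS [_ <= k]leq_eqVlt.
by case: eqP => // ->; rewrite ltnn.
Qed.

Lemma within_clears s B k w : (forall x, tsize (s x) <= B) ->
  within (clears k) (k.+1 * unit_cost B) (st (regs s k) w) (st (fun=> [::]) w).
Proof.
move=> s_B; elim: k => [|k IH] /=.
  by apply: within_le (within_leads (@leads_skip _)); rewrite /unit_cost; lia.
have W := within_clear (reg k) (st (regs s k.+1) w).
have rE : upd (regs s k.+1) k [::] = regs s k.
  apply: functional_extensionality => x; rewrite /upd /regs ltnS [_ <= k]leq_eqVlt.
  by case: eqP => // ->; rewrite ltnn.
have := within_seq W; rewrite st_upd_reg rE => /(_ _ _ _ IH).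
apply: within_le; rewrite [st _ _ _]/= /regs ltnSn size_code [in leqRHS]mulSn.
by rewrite /unit_cost; have := s_B k; lia.
Qed.

Section Clauses.
Variable V : nat.

(** No unification takes place: the values of all variables are guessed before the head is compared
    with the top goal. *)
Definition resolve (c : clause) : prog :=
  Seq (gens V) (Seq (match_pat c.1) (Seq (push_pats c.2) (clears V))).

Definition clause_below (c : clause) : bool :=
  pat_below V c.1 && all (pat_below V) c.2.

Definition csize (c : clause) : nat :=
  psize c.1 + sumn (map psize c.2) + size c.2.

Lemma regs_code s x : x < V -> regs s V x = code (s x).
Proof. by rewrite /regs => ->. Qed.

Lemma den_resolve c w s' : clause_below c ->
  den (resolve c) (st (fun=> [::]) w) s' -> exists s v,
  w = code (inst s c.1) ++ v /\
  s' = st (fun=> [::]) (codes (map (inst s) c.2) ++ v).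
Proof.
move=> /andP[c1 c2] [s1 /den_gens[s ->]] [s2].
move=> /(den_match_pat (@regs_code s) c1)[v -> ->].
move=> [s3 /(den_push_pats (@regs_code s) c2)-> /den_clears ->].
by exists s, v.
Qed.

Lemma within_resolve c s B v : clause_below c -> (forall x, tsize (s x) <= B) ->
  within (resolve c) ((csize c + V.*2 + 6) * unit_cost B)
    (st (fun=> [::]) (code (inst s c.1) ++ v))
    (st (fun=> [::]) (codes (map (inst s) c.2) ++ v)).
Proof.
move=> /andP[c1 c2] sB.
have := within_seq (within_gens _ _ sB)
  (within_seq (within_match_pat (@regs_code s) sB v c1)
    (within_seq (within_push_pats (@regs_code s) sB v c2) (within_clears _ _ sB))).
apply: within_le; rewrite /csize -addnn /unit_cost; nia.
Qed.

(** The base case [Skip] leaves the goals as they are, which endangers neither soundness nor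
    completeness. *)
Definition resolve_any (H : seq clause) : prog :=
  foldr (fun c => Alt (resolve c)) Skip H.

Definition hsize (H : seq clause) : nat :=
  sumn (map csize H) + size H + V.*2 + 7.

Lemma within_resolve_any H c s B v : List.In c H -> clause_below c ->
  (forall x, tsize (s x) <= B) ->
  within (resolve_any H) (hsize H * unit_cost B)
    (st (fun=> [::]) (code (inst s c.1) ++ v))
    (st (fun=> [::]) (codes (map (inst s) c.2) ++ v)).
Proof.
move=> cH c_ok sB; elim: H cH => //= c' H IH [->|/IH W].
  apply: within_le (@within_alt true _ _ _ _ _ (within_resolve v c_ok sB)).
  by rewrite /hsize /= /unit_cost -!addnn; nia.
apply: within_le (@within_alt false _ _ _ _ _ W).
by rewrite /hsize /= /unit_cost; nia.
Qed.

Lemma den_resolve_any H w s' : all clause_below H ->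
  den (resolve_any H) (st (fun=> [::]) w) s' ->
  s' = st (fun=> [::]) w \/
  exists c s v, [/\ List.In c H, w = code (inst s c.1) ++ v &
    s' = st (fun=> [::]) (codes (map (inst s) c.2) ++ v)].
Proof.
elim: H => [|c H IH] /= => [_ [<-]|/andP[c_ok H_ok]]; first by left.
case=> [/(den_resolve c_ok)[s [v [-> ->]]]|/(IH H_ok)[->|[c' [s [v [cH -> ->]]]]]].
- by right; exists c, s, v; split=> //; left.
- by left.
- by right; exists c', s, v; split=> //; right.
Qed.

Definition bits_code (b : bool) : seq bool := true :: code (bit b).

Lemma code_tcat w t : code (tcat w t) = flatten (map bits_code w) ++ code t.
Proof. by elim: w => //= b w ->; rewrite -catA. Qed.

Lemma foldl_bits_code w v :
  foldl (fun v b => bits_code b ++ v) v w = flatten (map bits_code (rev w)) ++ v.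
Proof.
elim: w v => [|b w IH] v //; rewrite rev_cons map_rcons flatten_rcons /= IH.
by rewrite -catA.
Qed.

(** The input is reversed onto [tmp], so that its letters come back from last to first; the bit
    pushed in between is the code of the final leaf, in front of which they are put. *)
Definition load : prog :=
  Seq (drain 0 (fun b => Push tmp b))
      (Seq (Push (reg 0) false)
           (drain tmp (fun b => pushw (reg 0) (bits_code b)))).

Definition input_reg (x : seq bool) : nat -> seq bool :=
  regs (fun=> tcat x Lf) 1.

Lemma loadE x :
  upd (upd (upd (upd (upd (init x) 0 [::]) tmp (catrev x [::]))
     (reg 0) [:: false]) tmp [::]) (reg 0)
    (foldl (fun v b => bits_code b ++ v) [:: false] (catrev x [::])) =
  st (input_reg x) [::].
Proof.
rewrite foldl_bits_code -/(rev x) revK.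
rewrite /upd; apply: functional_extensionality => -[|[|[|[|[|[|y]]]]]] //=.
by rewrite /input_reg /regs /= code_tcat.
Qed.

Lemma den_load x s' : den load (init x) s' -> s' = st (input_reg x) [::].
Proof.
case=> s1 /(@den_transfer 0 tmp isT) -> [s2 [<-]].
by move=> /(@den_expand tmp (reg 0) isT bits_code) ->; exact: loadE.
Qed.

Lemma within_load x : within load (30 * size x + 20) (init x) (st (input_reg x) [::]).
Proof.
have W1 := @within_transfer 0 tmp isT (init x).
have := within_seq W1 (within_seq (within_leads (@leads_push (reg 0) false _))
  (@within_expand tmp (reg 0) isT bits_code 4 _ _)).
rewrite -loadE => W; apply: within_le (W _); last by case.
rewrite [init x 0]/= !(@updN _ (reg 0)) // updE.
by rewrite catrevE cats0 size_rev; change (init x 0) with x; lia.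
Qed.

Variables (H : seq clause) (G : pat).

Definition horn_prog : prog :=
  Seq load (Seq (push_pat G) (Seq (clears 1)
    (Seq (Star (resolve_any H)) (IsEmpty goals)))).

Hypotheses (H_ok : all clause_below H) (G_ok : pat_below 1 G).

Lemma input_reg_code x y : y < 1 -> input_reg x y = code (tcat x Lf).
Proof. by rewrite /input_reg /regs => ->. Qed.

Definition closed_under (P : tree -> Prop) : Prop :=
  forall c s, List.In c H ->
    (forall b, List.In b c.2 -> P (inst s b)) -> P (inst s c.1).

(** Read backwards from the empty list of goals: if the body instances left by a resolution step
    satisfy [P], then so does the goal that they replaced. *)
Lemma den_resolve_star P gs s' : closed_under P ->
  den (Star (resolve_any H)) (st (fun=> [::]) (codes gs)) s' ->
  s' goals = [::] -> forall g, List.In g gs -> P g.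
Proof.
move=> clP; move sE : (st _ _) => s den_s; elim: den_s gs sE => {s s'}.
  move=> s gs <- /=; case: gs => [//|g gs] /(congr1 size); rewrite size_cat size_code.
  by case: g.
move=> s1 s2 s3 step _ IH gs s1E s3nil; move: step; rewrite -s1E.
case/(den_resolve_any H_ok) => [/esym s2E|[c [s [v [cH]]]]]; first exact: IH s2E s3nil.
case/codes_split=> gs' -> -> s2E.
have {}IH := IH (map (inst s) c.2 ++ gs') _ s3nil.
have {}IH : forall g, List.In g (map (inst s) c.2 ++ gs') -> P g.
  by apply: IH; rewrite s2E /codes map_cat flatten_cat.
move=> g [<-|g_in]; last by apply: IH; apply/List.in_or_app; right.
apply: clP => // b b_in; apply: IH; apply/List.in_or_app; left.
exact: List.in_map.
Qed.

Lemma den_horn_prog P x s' : closed_under P -> den horn_prog (init x) s' ->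
  P (inst (fun=> tcat x Lf) G).
Proof.
move=> clP [s1 /den_load ->] [s2 /(den_push_pat (@input_reg_code x) G_ok) ->].
move=> [s3 /(@den_clears (fun=> tcat x Lf) 1) ->] [s4 st4 /=]; case s4nil: (s4 goals) => // _.
by apply: (@den_resolve_star P [:: inst (fun=> tcat x Lf) G] _ clP st4 s4nil); left.
Qed.

Lemma within_resolve_star B n gs : ders H B n gs ->
  within (Star (resolve_any H)) (n * (hsize H * unit_cost B).+1 + 1)
    (st (fun=> [::]) (codes gs)) (st (fun=> [::]) [::]).
Proof.
elim=> [|c s {}n {}gs cH sB _ IH].
  exact/within_leads/leads_star0.
have c_ok := all_In H_ok cH.
have W := @within_resolve_any H c s B (codes gs) cH c_ok sB.
have := within_star W; rewrite /codes map_cat flatten_cat in IH * => /(_ _ _ IH).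
by apply: within_le; rewrite mulSn; lia.
Qed.

Lemma run_horn_prog B n x : ders H B n [:: inst (fun=> tcat x Lf) G] ->
  exists2 m, m <= 30 * size x + psize G * unit_cost (4 * size x + 1) +
      2 * unit_cost (4 * size x + 1) + n * (hsize H * unit_cost B).+1 + 30 &
    run m [:: horn_prog] (init x).
Proof.
(* Each letter adds an inner node and a bit of at most three nodes. *)
move=> /within_resolve_star W; have xB : forall y : nat, tsize (tcat x Lf) <= 4 * size x + 1.
  by move=> _; elim: x {W} => //= b x; case: b => /=; lia.
have W2 := within_push_pat (@input_reg_code x) xB [::] G_ok.
have W3 := within_clears 1 (code (inst (fun=> tcat x Lf) G) ++ [::]) xB.
have := within_seq (within_load x) (within_seq W2 (within_seq W3
  (within_seq W (within_leads (@leads_empty goals (st (fun=> [::]) [::]) erefl))))).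
case=> m le_m Lm; exists (m + 0).
  by apply: leq_trans (leq_trans le_m _); rewrite ?addn0 //; lia.
exact/Lm/run_nil.
Qed.

Lemma well_indexed_match_pat p : pat_below V p -> well_indexed (V + 3) (match_pat p).
Proof. by elim: p => [x|_|p IHp q IHq] /=; lia. Qed.

Lemma well_indexed_push_pat W p : pat_below W p -> W <= V ->
  well_indexed (V + 3) (push_pat p).
Proof.
by move=> + WV; elim: p => [x|_|p IHp q IHq] /=; lia.
Qed.

Lemma well_indexed_gens k : k <= V -> well_indexed (V + 3) (gens k).
Proof. by elim: k => //= k IH kV; rewrite IH /=; lia. Qed.

Lemma well_indexed_clears k : k <= V -> well_indexed (V + 3) (clears k).
Proof. by elim: k => //= k IH kV; rewrite IH /=; lia. Qed.

Lemma well_indexed_resolve c : clause_below c -> well_indexed (V + 3) (resolve c).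
Proof.
case: c => h b /andP[h_ok b_ok] /=.
rewrite well_indexed_gens // well_indexed_match_pat // well_indexed_clears // andbT /=.
elim: b b_ok {h_ok} => //= p b IH /andP[p_ok b_ok].
by rewrite IH // (well_indexed_push_pat p_ok).
Qed.

Lemma well_indexed_horn_prog : 0 < V -> well_indexed (V + 3) horn_prog.
Proof.
move=> V0; have W : well_indexed (V + 3) (resolve_any H).
  elim: H H_ok => // c H' IH /andP[c_ok H'_ok].
  by apply/andP; split; [exact: well_indexed_resolve | exact: IH].
by rewrite /= W (well_indexed_push_pat G_ok) //; lia.
Qed.

End Clauses.

(** Any predicate closed under the clauses contains all that can be refuted, so soundness can be
    argued clause by clause, without mentioning derivations. *)
Theorem horn_in_NP (V : nat) (H : seq clause) (G : pat) (P : tree -> Prop)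
    (L : seq bool -> Prop) (p q : {poly nat}) :
  0 < V -> all (clause_below V) H -> pat_below 1 G -> closed_under H P ->
  (forall x, P (inst (fun=> tcat x Lf) G) -> L x) ->
  (forall x, L x -> exists n, n <= p.[size x]%R /\
     ders H q.[size x]%R n [:: inst (fun=> tcat x Lf) G]) ->
  in_NP L.
Proof.
move=> V0 H_ok G_ok clP sound complete.
pose u : {poly nat} := (12%:P * (4%:P * 'X + 1) + 20%:P)%R.
pose b : {poly nat} := (30%:P * 'X + (psize G)%:P * u + 2%:P * u
  + p * ((hsize V H)%:P * (12%:P * q + 20%:P) + 1) + 30%:P)%R.
(* There are [V + 5] tapes, five fixed ones and a register for each variable; the parameter counts
   two tapes less. *)
apply: (@stack_in_NP (V + 3) (horn_prog V H G) _ L b).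
- exact: well_indexed_horn_prog.
- move=> n x /run_den[s' [s1 d _]]; apply: sound.
  exact: den_horn_prog clP d.
- move=> x /complete[n [le_n /(run_horn_prog H_ok G_ok)[m le_m Rm]]].
  exists m => //; apply: leq_trans le_m _.
  rewrite /b /u !(hornerD, hornerM, hornerC, hornerX).
  change (30 * size x + psize G * unit_cost (4 * size x + 1) +
    2 * unit_cost (4 * size x + 1) + n * (hsize V H * unit_cost q.[size x]%R).+1 + 30
    <= 30 * size x + psize G * (12 * (4 * size x + 1) + 20) +
    2 * (12 * (4 * size x + 1) + 20) +
    p.[size x]%R * (hsize V H * (12 * q.[size x]%R + 20) + 1) + 30)%N.
  by rewrite !leq_add // addn1 leq_mul.
Qed.

(** * Preferences *)

Section Preferences.
Variable I : instance.

Definition score (th : subst) : Z :=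
  foldr (fun s z => (pref I (assign th s) + z)%Z) 0%Z (svars (i_prog I)).

(** A crude bound on a single preference; the absolute values make it cover the default preference 0
    too. *)
Definition pref_bound : Z :=
  foldr (fun e z => (Z.abs (snd e) + z)%Z) 0%Z (i_prefs I).

Lemma pref_le_bound a : (pref I a <= pref_bound)%Z.
Proof.
have bound_ge0 l : (0 <= foldr (fun (e : assignment * Z) z => (Z.abs e.2 + z)%Z) 0%Z l)%Z.
  by elim: l => //= e l; lia.
rewrite /pref /pref_bound; elim: (i_prefs I) => [|e l IH] //=.
case: ifP => _ /=; have := bound_ge0 l; first lia.
by move: (head _ _) (foldr _ _ _) IH => x y; lia.
Qed.

Lemma score_le_bound th :
  (score th <= pref_bound * Z.of_nat (size (svars (i_prog I))))%Z.
Proof.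
rewrite /score; elim: svars => [|s l IH] /=; first lia.
by have := @pref_le_bound (assign th s); lia.
Qed.

(** As [svars] may repeat variables, the score weighs them by their occurrences; all weights being
    positive, it still increases strictly. *)
Lemma preferred_over_score th th' :
  preferred_over I th' th -> (score th < score th')%Z.
Proof.
case=> le_all [s s_in lt_s]; rewrite /score.
elim: svars s_in le_all => //= s' l IH s_in le_all.
have le_l : (foldr (fun s z => (pref I (assign th s) + z)%Z) 0%Z l <=
             foldr (fun s z => (pref I (assign th' s) + z)%Z) 0%Z l)%Z.
  have {}le_all s2 : List.In s2 l ->
      (pref I (assign th s2) <= pref I (assign th' s2))%Z.
    by move=> s2_in; apply: le_all; right.
  elim: l le_all {IH s_in} => [|s2 l IH] le_all /=; first lia.
  have {}IH := IH (fun s3 s3_in => le_all s3 (or_intror s3_in)).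
  have := le_all s2 (or_introl erefl).
  by move: (foldr _ _ _) (foldr _ _ _) IH => x y; lia.
have := le_all _ (or_introl erefl).
case: s_in => [sE|s_in].
  by subst s'; move: (foldr _ _ _) (foldr _ _ _) le_l => x y; lia.
have := IH s_in (fun s2 s2_in => le_all s2 (or_intror s2_in)).
by move: (foldr _ _ _) (foldr _ _ _) => x y; lia.
Qed.

(** Substitutions are total functions on names, so there are infinitely many and a maximum cannot be
    taken over a finite set. Instead one climbs from a substitution to a preferred one; the score
    grows at each step and is bounded. *)
Lemma satisfiable_yes : (exists th, satisfies I th) -> SkASP_yes I.
Proof.
case=> th; pose top := (pref_bound * Z.of_nat (size (svars (i_prog I))))%Z.
move nE : (Z.to_nat (top - score th)) => n.
elim/ltn_ind: n th nE => n IH th nE sat_th.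
have [[th' [sat_th' /preferred_over_score lt_th]]|no] := classic
    (exists th', satisfies I th' /\ preferred_over I th' th); last by exists th.
apply: IH sat_th'; last by [].
have := @score_le_bound th; have := @score_le_bound th'; rewrite -/top -nE; lia.
Qed.

End Preferences.

(** * Stratifications *)

Definition strict (sg : sign) : nat := if sg is Neg then 1 else 0.

Lemma level_stratified I (lev : node -> nat) :
  (forall sg p q, direct_dep I sg p q -> lev q + strict sg <= lev p) ->
  stratified I.
Proof.
move=> levP [p [q [dep_pq back]]].
have lt_qp : lev q < lev p by have := levP _ _ _ dep_pq; rewrite /= addn1.
suff : lev p <= lev q by rewrite leqNgt lt_qp.
case: back => [->//|]; elim=> [x y [sg /levP]|x y z _ xy _ yz]; first lia.
exact: leq_trans yz xy.
Qed.

(** Excluded middle makes reachability boolean so that it can be counted; it need not be computed,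
    since the levels are part of the certificate. *)
Definition holds (P : Prop) : bool :=
  if excluded_middle_informative P then true else false.

Lemma holdsP (P : Prop) : reflect P (holds P).
Proof. by rewrite /holds; case: excluded_middle_informative => h; constructor. Qed.

Section Levels.
Variable I : instance.

Definition body_nodes : seq node :=
  flatten [seq pmap (fun l => if l is LAtom _ a then Some (atom_node a) else None)
             (r_body r) | r <- i_prog I].

Definition reaches : node -> node -> Prop :=
  clos_refl_trans_1n node (fun p q => exists sg, direct_dep I sg p q).

Definition neg_reaches (p q : node) : Prop :=
  exists p' q', [/\ reaches p p', direct_dep I Neg p' q' & reaches q' q].

Lemma reaches_trans p q r : reaches p q -> reaches q r -> reaches p r.
Proof.
by elim=> // x y z xy _ IH /IH; exact: Relation_Operators.rt1n_trans xy.
Qed.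

Lemma stratified_acyclic q : stratified I -> ~ neg_reaches q q.
Proof.
move=> strat [p' [q' [qp' dep q'q]]]; apply: strat; exists p', q'; split=> //.
have := reaches_trans q'q qp'; rewrite /depends_on.
elim=> [x|x y z xy _ [->|yz]]; first by left.
  by right; constructor.
by right; apply: t_trans yz; constructor.
Qed.

(** Counting within the list of body predicates bounds the levels by the number of body atoms, so
    that they can be written in unary. The list suffices because every negative dependency ends in a
    body. *)
Definition level (p : node) : nat :=
  count (fun q => holds (neg_reaches p q)) body_nodes.

Lemma level_le_size p : level p <= size body_nodes.
Proof. exact: count_size. Qed.

Lemma direct_dep_neg_body p q : direct_dep I Neg p q -> List.In q body_nodes.
Proof.
case=> [[r [r_in _ [s [a [l_in -> _]]]]]|[]] //; rewrite /body_nodes.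
elim: (i_prog I) r_in => //= r' P IH [->|/IH r_in]; apply/List.in_or_app; last by right.
left; elim: (r_body r) l_in => //= l b IHb [->|/IHb a_in] /=; first by left.
by case: l => //= *; right.
Qed.

(** Whatever [q] reaches through a negation, [p] reaches too. If the dependency is negative, then
    [q] itself is counted for [p] but not for [q], as that would be a negative cycle. *)
Lemma direct_dep_level sg p q : stratified I -> direct_dep I sg p q ->
  level q + strict sg <= level p.
Proof.
move=> strat dep_pq; rewrite /level.
have sub r : holds (neg_reaches q r) -> holds (neg_reaches p r).
  move=> /holdsP[p' [q' [qp' dep q'r]]]; apply/holdsP; exists p', q'; split=> //.
  by apply: Relation_Operators.rt1n_trans qp'; exists sg.
case: sg dep_pq => dep_pq; first by rewrite addn0; exact: sub_count.
have pq : holds (neg_reaches p q).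
  by apply/holdsP; exists p, q; split=> //; constructor.
have qq : holds (neg_reaches q q) = false.
  by apply/holdsP; exact: stratified_acyclic.
have := direct_dep_neg_body dep_pq; rewrite addn1.
elim: body_nodes => //= r l IH [->|/IH lt_l].
  by rewrite pq qq add0n add1n ltnS; exact: sub_count.
by case: (holds (neg_reaches q r)) (sub r) => [->|_] //; lia.
Qed.

End Levels.

Definition gatom_dec (a b : gatom) : {a = b} + {a <> b}.
Proof. by repeat decide equality. Defined.

HB.instance Definition _ := hasDecEq.Build gatom (compareP gatom_dec).

Lemma InP (T : eqType) (x : T) (s : seq T) : reflect (List.In x s) (x \in s).
Proof.
elim: s => [|y s IH] /=; first by constructor.
by rewrite inE eq_sym; apply: (iffP predU1P) => -[->|/IH]; tauto.
Qed.

(** * Answer sets of stratified ground programs *)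

Section AnswerSets.
Variable p : seq grule.
Implicit Types (F : seq gatom) (r : grule).

Definition in_list F : interp := fun a => a \in F.

Definition blocked F r : bool :=
  has (fun a => a \notin F) (g_pos r) || has (fun a => a \in F) (g_neg r).

Lemma blockedPn F r : reflect
  ((forall a, List.In a (g_pos r) -> a \in F) /\
   (forall a, List.In a (g_neg r) -> a \notin F)) (~~ blocked F r).
Proof.
rewrite negb_or -!all_predC; apply: (iffP andP) => -[h1 h2]; split.
- by move=> a /InP a_in; move/allP: h1 => /(_ a a_in) /=; rewrite negbK.
- by move=> a /InP a_in; move/allP: h2 => /(_ a a_in).
- by apply/allP => a /InP /h1 /=; rewrite negbK.
- by apply/allP => a /InP /h2.
Qed.

(* [F'] lists atoms in the reverse of an order of derivation, negation being
   evaluated in [F]. *)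
Fixpoint derived F F' : Prop :=
  if F' is a :: F' then
    (exists r, [/\ List.In r p, g_head r = Some a,
       all (mem F') (g_pos r) & all (fun b => b \notin F) (g_neg r)]) /\
    derived F F'
  else True.

Definition closed F : Prop :=
  forall r h, List.In r p -> g_head r = Some h -> h \in F \/ blocked F r.

(** Along the order of derivation each atom is forced by its rule, which survives in the reduct
    because its negative body was evaluated in [F]. *)
Lemma derived_minimal F M : derived F F -> pos_model (reduct p (in_list F)) M ->
  forall a, a \in F -> M a.
Proof.
move=> der_F M_model; have: derived F F by []. 
move: {2 3}F; elim=> //= a F' IH [[r [r_in rE pos_r neg_r]] /IH{}IH] b.
rewrite inE => /predU1P[->|/IH //].
have := M_model r; rewrite rE; apply.
  split=> // c /InP c_in; have /allP/(_ c c_in) := neg_r; exact/negP.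
by move=> c /InP c_in; apply: IH; have /allP/(_ c c_in) := pos_r.
Qed.

Lemma derived_answer_set F : derived F F -> closed F ->
  (forall r, List.In r p -> g_head r = None -> blocked F r) ->
  answer_set p (in_list F).
Proof.
move=> der_F cl_F ok_F; split=> [r [r_in neg_r] pos_r|M' M'_model _ a].
  have nb : ~~ blocked F r.
    by apply/blockedPn; split=> // a /neg_r /negP.
  case rE: (g_head r) => [h|].
    by case: (cl_F _ _ r_in rE) => // b; rewrite b in nb.
  by move: nb; rewrite ok_F.
exact: derived_minimal.
Qed.

Variable lev : gatom -> nat.
Hypothesis strat : forall r h, List.In r p -> g_head r = Some h ->
  (forall a, List.In a (g_pos r) -> lev a <= lev h) /\
  (forall a, List.In a (g_neg r) -> lev a < lev h).

(** Uniqueness, by induction on levels. At level [n], [F] is included in [M] along its order of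
    derivation. Conversely, removing from [M] its atoms of level [n] outside [F] leaves a model of
    the reduct, so by minimality of [M] there are none. *)
Lemma answer_set_derived F M : derived F F -> closed F -> answer_set p M ->
  forall a, a \in F <-> M a.
Proof.
move=> der_F cl_F [M_model M_min] a.
move: {2}(lev a).+1 (ltnSn (lev a)) => n; elim: n a => // n IH.
have F_sub a : lev a < n.+1 -> a \in F -> M a.
  have: derived F F by [].
  move: {2 3}F a; elim=> //= b F' IHF a [[r [r_in rE pos_r neg_r]] /IHF{}IHF] lev_a.
  rewrite inE => /predU1P[ab|/IHF]; last exact; subst b.
  have [le_pos lt_neg] := strat r_in rE; have := M_model r; rewrite rE; apply.
    split=> // c c_in Mc; have /allP/(_ c (introT (InP _ _) c_in)) := neg_r.
    by move/negP; apply; apply/IH => //; have := lt_neg c c_in; lia.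
  move=> c c_in; have /allP/(_ c (introT (InP _ _) c_in)) c_F := pos_r.
  by apply: IHF => //; have := le_pos c c_in; lia.
move=> a lev_a; split; first exact: F_sub.
move=> Ma; suff: M a /\ (lev a = n -> a \in F).
  case: (ltngtP (lev a) n) => [lt_a _|gt_a|-> [_]]; [exact/IH|lia|exact].
pose M' b := M b /\ (lev b = n -> b \in F).
apply: (M_min M') => // [r red_r pos_r|b []] //.
case: (red_r) => r_in neg_r.
have := M_model r red_r (fun b b_in => proj1 (pos_r b b_in)).
case rE: (g_head r) => [h|] // Mh; split=> // lev_h.
have [le_pos lt_neg] := strat r_in rE.
(* Closedness puts the head into [F] unless the rule is blocked. It is not: body atoms below level
   [n] are settled by induction, and positive ones of level [n] lie in [F] by the choice of [M']. *)
case: (cl_F _ _ r_in rE) => //; apply: contraLR => hF; apply/blockedPn; split=> b b_in.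
  have := le_pos b b_in; have [Mb] := pos_r b b_in; rewrite lev_h leq_eqVlt.
  by move=> bF /predU1P[/bF //|lt_b]; apply/IH.
apply/negP => bF; apply: (neg_r b b_in); apply/IH => //.
by rewrite -lev_h lt_neg.
Qed.

(** An answer set would have to coincide with [F], which violates the constraint [r]. *)
Lemma derived_no_answer_set F r : derived F F -> closed F ->
  List.In r p -> g_head r = None -> ~~ blocked F r -> ~ exists M, answer_set p M.
Proof.
move=> der_F cl_F r_in rE /blockedPn[pos_r neg_r] [M M_as].
have FM := answer_set_derived der_F cl_F M_as; case: M_as => M_model _.
have := M_model r; rewrite rE; apply.
  by split=> // a /neg_r /negP aF /FM.
by move=> a /pos_r /FM.
Qed.

Definition rule_heads : seq gatom := pmap g_head p.

Lemma rule_headsP r h : List.In r p -> g_head r = Some h -> h \in rule_heads.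
Proof.
rewrite /rule_heads; elim: p => //= r' q IH [->|/IH{}IH] rE; first by rewrite rE inE eqxx.
by case: (g_head r') => [h'|] /=; rewrite ?inE IH ?orbT.
Qed.

(* The perfect model is computed level by level: [F] is closed below level
   [n], and [G] extends it by atoms of level [n]. *)
Definition step (F G : seq gatom) n a : Prop := exists r,
  [/\ List.In r p, g_head r = Some a, lev a = n,
      all (mem G) (g_pos r) & all (fun b => b \notin F) (g_neg r)].

Lemma derived_congr F F' G : (forall a b r, a \in G -> List.In r p ->
    g_head r = Some a -> List.In b (g_neg r) -> b \notin F -> b \notin F') ->
  derived F G -> derived F' G.
Proof.
elim: G => //= a G IH FF' [[r [r_in rE pos_r neg_r]] der_G]; split.
  exists r; split=> //; apply/allP => b b_in; have /allP/(_ b b_in) := neg_r.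
  apply: (FF' a b r) => //; first by rewrite inE eqxx.
  by apply/InP.
by apply: IH der_G => c b r' cG; apply: FF'; rewrite inE cG orbT.
Qed.

(** Atoms are added one at a time, which ends because a list of rule heads without repetitions has
    bounded length. *)
Lemma saturate F n G :
  (forall a, a \in G -> lev a <= n /\ (lev a < n -> a \in F)) -> uniq G ->
  {subset G <= rule_heads} -> {subset F <= G} -> derived F G ->
  exists2 G', [/\ uniq G', {subset G' <= rule_heads}, {subset F <= G'},
    forall a, a \in G' -> lev a <= n /\ (lev a < n -> a \in F) & derived F G'] &
    forall a, step F G' n a -> a \in G'.
Proof.
move kE : (size rule_heads - size G) => k.
elim/ltn_ind: k G kE => k IH G kE low uG subG FG der_G.
have [[a [step_a aG]]|no] := classic (exists a, step F G n a /\ a \notin G); last first.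
  by exists G => // a step_a; case: (boolP (a \in G)) => // aG; case: no; exists a.
have [r [r_in rE lev_a pos_r neg_r]] := step_a.
have uG' : uniq (a :: G) by rewrite /= aG.
have subG' : {subset a :: G <= rule_heads}.
  by move=> b; rewrite inE => /predU1P[->|/subG //]; exact: rule_headsP rE.
have := uniq_leq_size uG' subG'; rewrite /= => sz.
apply: (IH (size rule_heads - (size G).+1) _ (a :: G)) => //.
- by rewrite -kE; rewrite ltn_sub2l.
- by move=> b; rewrite inE => /predU1P[->|/low //]; rewrite lev_a ltnn.
- by move=> b /FG bG; rewrite inE bG orbT.
- by split=> //; exists r.
Qed.

Lemma exists_perfect_below n : exists F, [/\ uniq F, {subset F <= rule_heads},
  forall a, a \in F -> lev a < n, derived F F &
  forall r h, List.In r p -> g_head r = Some h -> lev h < n ->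
    h \in F \/ blocked F r].
Proof.
elim: n => [|n [F [uF subF lt_F der_F cl_F]]]; first by exists [::].
have [||G [uG subG FG low der_G] sat] := @saturate F n F _ uF subF _ der_F => //.
  by move=> a aF; split=> // ; exact/ltnW/lt_F.
(* Negative body atoms lie strictly below the head, where [G] adds nothing to [F]; negation may thus
   be evaluated in either. *)
have negG r h b : List.In r p -> g_head r = Some h -> lev h <= n ->
    List.In b (g_neg r) -> (b \in G) = (b \in F).
  move=> r_in rE lev_h b_in; apply/idP/idP => [/low[_]|/FG //]; apply.
  by have [_ /(_ b b_in)] := strat r_in rE; lia.
exists G; split=> //.
- by move=> a /low[].
- apply: (@derived_congr F G G _ der_G) => a b r aG r_in rE b_in.
  by rewrite (negG r a b) //; have [] := low a aG.
- move=> r h r_in rE; rewrite ltnS => lev_h; apply/orP; rewrite -implyNb.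
  apply/implyP => hG; apply/negPn/negP => /blockedPn[pos_r neg_r].
  have neg_r' : all (fun b => b \notin F) (g_neg r).
    by apply/allP => b /InP b_in; rewrite -(negG r h) // neg_r.
  move: lev_h; rewrite leq_eqVlt => /predU1P[lev_h|lev_h].
    case/negP: hG; apply: sat; exists r; split=> //.
    by apply/allP => b /InP; exact: pos_r.
  have [hF|] := cl_F r h r_in rE lev_h; first by rewrite FG in hG.
  apply/negP/blockedPn; split=> b b_in; last by have /allP := neg_r'; apply; exact/InP.
  by apply: (proj2 (low b (pos_r b b_in))); have [/(_ b b_in)] := strat r_in rE; lia.
Qed.

Lemma exists_perfect : exists F,
  [/\ uniq F, {subset F <= rule_heads}, derived F F & closed F].
Proof.
have [F [uF subF _ der_F cl_F]] := exists_perfect_below (\max_(a <- rule_heads) lev a).+1.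
exists F; split=> // r h r_in rE; apply: (cl_F r h r_in rE).
by rewrite ltnS; apply: leq_bigmax_seq => //; exact: rule_headsP rE.
Qed.

End AnswerSets.

Lemma In_flatten (T : Type) (x : T) ss :
  List.In x (flatten ss) <-> exists2 s, List.In s ss & List.In x s.
Proof.
elim: ss => [|s ss IH] /=; first by split=> // -[].
rewrite List.in_app_iff IH; split=> [[xs|[s' s'_in xs']]|[s' [<-|s'_in] xs']].
- by exists s; [left|].
- by exists s'; [right|].
- by left.
- by right; exists s'.
Qed.

Lemma In_pmap (S T : Type) (f : S -> option T) y s :
  List.In y (pmap f s) <-> exists2 x, List.In x s & f x = Some y.
Proof.
elim: s => [|x s IH] /=; first by split=> // -[].
case fx: (f x) => [z|] /=; rewrite IH; split.
- by case=> [<-|[x' x'_in fx']]; [exists x; [left|] | exists x'; [right|]].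
- case=> x' [<-|x'_in] fx'; last by right; exists x'.
  by left; rewrite fx in fx'; case: fx'.
- by case=> x' x'_in fx'; exists x'; [right|].
- by case=> x' [<-|x'_in] fx'; [rewrite fx in fx' | exists x'].
Qed.

(** * From the sketched program to the levels of its ground rules *)

Definition in_rule (a : satom) (r : srule) : Prop :=
  r_head r = Some a \/ exists s, List.In (LAtom s a) (r_body r).

Definition atom_ok (dm : name -> nat -> seq name) (th : subst) (a : satom) : Prop :=
  forall q, a_pred a = Sk q ->
    th_pred th q (size (a_args a)) \in dm q (size (a_args a)).

Lemma term_vars_no_pred q n t : ~ List.In (SPred q n) (term_vars t).
Proof.
elim: t => [z []|s []|o t1 IH1 t2 IH2] /=; rewrite !List.in_app_iff => -[|[]] //.
by case: o => [o []|s []].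

Qed.

Lemma atom_vars_pred q n a : List.In (SPred q n) (atom_vars a) <->
  a_pred a = Sk q /\ n = size (a_args a).
Proof.
rewrite /atom_vars List.in_app_iff In_flatten; split.
  case=> [|[s]]; first by case: (a_pred a) => //= q' [] // [-> ->].
  by move=> /List.in_map_iff[t [<- _]] /term_vars_no_pred.
by case=> -> ->; left; left.
Qed.

Lemma svars_pred q n p : List.In (SPred q n) (svars p) <->
  exists r a, [/\ List.In r p, in_rule a r, a_pred a = Sk q & n = size (a_args a)].
Proof.
rewrite /svars In_flatten; split.
  case=> s /List.in_map_iff[r [<- r_in]]; rewrite /rule_vars List.in_app_iff In_flatten.
  case=> [|[s' /List.in_map_iff[l [<- l_in]]]].
    case rE: (r_head r) => [a|] //= /atom_vars_pred[aE nE].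
    by exists r, a; split=> //; left.
  case: l l_in => [sg a|c t1 t2] /= l_in; rewrite List.in_app_iff.
    case=> [|/atom_vars_pred[aE nE]]; first by case: sg {l_in} => //= ? [].
    by exists r, a; split=> //; right; exists sg.
  by rewrite List.in_app_iff => -[|[]/term_vars_no_pred] //; case: c {l_in} => //= ? [].
case=> r [a [r_in a_in aE nE]]; exists (rule_vars r).
  by apply/List.in_map_iff; exists r.
rewrite /rule_vars List.in_app_iff In_flatten.
case: a_in => [->|[sg l_in]]; first by left; apply/atom_vars_pred.
right; exists (literal_vars (LAtom sg a)); first by apply/List.in_map_iff; exists (LAtom sg a).
by rewrite /= List.in_app_iff; right; apply/atom_vars_pred.
Qed.

Lemma in_domainsP I th : in_domains I th <->
  forall r a, List.In r (i_prog I) -> in_rule a r -> atom_ok (dom I) th a.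
Proof.
split=> [h r a r_in a_in q aE|h q n /svars_pred[r [a [r_in a_in aE ->]]]].
  by apply: h; apply/svars_pred; exists r, a.
exact: (h r a r_in a_in q aE).
Qed.

Definition gnode (g : gatom) : node := NOrd (g_pred g) (size (g_args g)).

Lemma eval_args_size ts vs : eval_args ts = Some vs -> size vs = size ts.
Proof.
elim: ts vs => [|t ts IH] vs /=; first by case=> <-.
by case: (eval t) (eval_args ts) IH => // v [vs'|] // IH [<-] /=; rewrite (IH vs').
Qed.

(** For a body atom the dependency of a sketched predicate on its domain is what counts, for a head
    atom the membership in the domain; hence both are recorded. *)
Lemma eval_atom_node I th a g : atom_ok (dom I) th a ->
  eval_atom (sub_atom th a) = Some g ->
  gnode g = atom_node a \/ direct_dep I Pos (atom_node a) (gnode g) /\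
    exists q n d, [/\ atom_node a = NSk q n, d \in dom I q n & gnode g = NOrd d n].
Proof.
rewrite /eval_atom; case vsE: (eval_args _) => [vs|] // ok [<-].
have sz : size vs = size (a_args a) by rewrite (eval_args_size vsE) size_map.
rewrite /gnode /= sz /atom_node; case aE: (a_pred a) => [p|q] /=; first by left.
right; split; last by do 3 eexists; split=> //; exact: ok.
by right; split=> //; do 3 eexists; split=> //; exact: ok.
Qed.

Lemma eval_bodyP th b ps ns : eval_body (map (sub_literal th) b) = Some (ps, ns) ->
  (forall g, List.In g ps -> exists s a, [/\ List.In (LAtom s a) b,
     fill (th_neg th) s = Pos & eval_atom (sub_atom th a) = Some g]) /\
  (forall g, List.In g ns -> exists s a, [/\ List.In (LAtom s a) b,
     fill (th_neg th) s = Neg & eval_atom (sub_atom th a) = Some g]).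
Proof.
elim: b ps ns => [|l b IH] ps ns /=; first by case=> <- <-.
case: l => [s a|c t1 t2] /=; last first.
  by case: ifP => // _ /IH[h1 h2]; split=> g => [/h1|/h2] [s [a [? ? ?]]];
    exists s, a; split=> //; right.
case gE: (eval_atom _) => [g|] //; case: (eval_body _) IH => [[ps' ns']|] // IH.
have {}IH := IH _ _ erefl.
have [IHp IHn] := IH.
case sE: (fill _ s) => -[<- <-]; split=> g'.
- case=> [<-|/IHp]; first by exists s, a; split=> //; left.
  by case=> s' [a' [? ? ?]]; exists s', a'; split=> //; right.
- by move=> /IHn[s' [a' [? ? ?]]]; exists s', a'; split=> //; right.
- by move=> /IHp[s' [a' [? ? ?]]]; exists s', a'; split=> //; right.
- case=> [<-|/IHn]; first by exists s, a; split=> //; left.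
  by case=> s' [a' [? ? ?]]; exists s', a'; split=> //; right.
Qed.

(** Ground atoms inherit the levels of their predicates. A head chosen from a domain is covered
    because [in_head] makes the rule one for each predicate of the domain; facts have empty
    bodies. *)
Lemma evaluate_level I th (lev : node -> nat) e : in_domains I th ->
  (forall sg p q, direct_dep I sg p q -> lev q + strict sg <= lev p) ->
  forall r h, List.In r (add_facts e (evaluate (sub_program th (i_prog I)))) ->
    g_head r = Some h ->
    (forall a, List.In a (g_pos r) -> lev (gnode a) <= lev (gnode h)) /\
    (forall a, List.In a (g_neg r) -> lev (gnode a) < lev (gnode h)).
Proof.
move=> /in_domainsP ok levP r h; rewrite /add_facts List.in_app_iff.
case=> [/List.in_map_iff[a [<- _]] _ //|].
move=> /In_pmap[r' /List.in_map_iff[sr [<- sr_in]]] rE hE.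
move: rE; rewrite /eval_rule /=.
case bE: (eval_body _) => [[ps ns]|] //; have [posP negP] := eval_bodyP bE.
case sh: (r_head sr) => [a|] /=; last by case=> rE; move: hE; rewrite -rE.
case gE: (eval_atom _) => [g|] //= -[rE]; subst r; case: hE => /= gh; subst g.
have head_in : in_head I sr (gnode h).
  exists a => //; have [|[_ [q [n [d [h1 h2 h3]]]]]] :=
    eval_atom_node (ok _ _ sr_in (or_introl sh)) gE; first by left.
  by right; exists q, n, d.
have body sg b s c : List.In (LAtom s c) (r_body sr) -> fill (th_neg th) s = sg ->
    eval_atom (sub_atom th c) = Some b -> lev (gnode b) + strict sg <= lev (gnode h).
  move=> c_in sE bE'; apply: (@leq_trans (lev (atom_node c) + strict sg)).
    rewrite leq_add2r; have [->//|[dep _]] :=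
      eval_atom_node (ok _ _ sr_in (or_intror (ex_intro _ s c_in))) bE'.
    by have := levP _ _ _ dep; rewrite addn0.
  apply: levP; left; exists sr; split=> //; exists s, c; split=> //.
  by case: s sE {c_in}.
split=> b => [/posP|/negP] [s [c [c_in sE bE']]].
  by have := body Pos b s c c_in sE bE'; rewrite addn0.
by have := body Neg b s c c_in sE bE'; rewrite addn1.
Qed.

(** * Instances as trees *)

Notation b0 := Lf.
Notation b1 := (Nd Lf Lf).

Definition t_list (ts : seq tree) : tree := foldr Nd Lf ts.

Definition t_seq T (f : T -> tree) (s : seq T) : tree := t_list (map f s).

Definition t_opt T (f : T -> tree) (o : option T) : tree :=
  if o is Some x then Nd Lf (f x) else Lf.

Definition t_name : name -> tree := t_seq (fun b => Nd (bit b) Lf).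

Definition t_nat (n : nat) : tree := t_list (nseq n Lf).

(** Digits alternate with the continuation marks of [enc_name]. The mark before the first digit
    belongs to [t_Z], where it separates zero from the other numbers. *)
Fixpoint t_pos (p : positive) : tree :=
  match p with
  | xH => Nd b1 (Nd b0 Lf)
  | xO p => Nd b0 (Nd b1 (t_pos p))
  | xI p => Nd b1 (Nd b1 (t_pos p))
  end.

Definition t_Z (z : Z) : tree :=
  match z with
  | Z0 => Nd b0 (Nd b0 Lf)
  | Zpos p => Nd b0 (Nd b1 (t_pos p))
  | Zneg p => Nd b1 (Nd b1 (t_pos p))
  end.

Definition t_sign (s : sign) : tree :=
  match s with Pos => Nd b0 Lf | Neg => Nd b1 Lf end.

Definition t_cmp (c : cmp) : tree :=
  match c with
  | CEq  => Nd b0 (Nd b0 (Nd b0 Lf))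
  | CNe  => Nd b0 (Nd b0 (Nd b1 Lf))
  | CLt  => Nd b0 (Nd b1 (Nd b0 Lf))
  | CGt  => Nd b0 (Nd b1 (Nd b1 Lf))
  | CGe  => Nd b1 (Nd b0 (Nd b0 Lf))
  | CLe  => Nd b1 (Nd b0 (Nd b1 Lf))
  | CTop => Nd b1 (Nd b1 (Nd b0 Lf))
  end.

Definition t_arith (o : arith) : tree :=
  match o with
  | OAdd  => Nd b0 (Nd b0 (Nd b0 Lf))
  | OSub  => Nd b0 (Nd b0 (Nd b1 Lf))
  | OMul  => Nd b0 (Nd b1 (Nd b0 Lf))
  | ODiv  => Nd b0 (Nd b1 (Nd b1 Lf))
  | ODist => Nd b1 (Nd b0 (Nd b0 Lf))
  end.

Definition t_slot T (f : T -> tree) (s : slot T) : tree :=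
  match s with Fix x => Nd b0 (f x) | Sk q => Nd b1 (t_name q) end.

Fixpoint t_term (t : sterm) : tree :=
  match t with
  | TInt z => Nd b0 (Nd b0 (t_Z z))
  | TSym s => Nd b0 (Nd b1 (t_name s))
  | TOp o t1 t2 => Nd b1 (Nd (t_slot t_arith o) (Nd (t_term t1) (t_term t2)))
  end.

Definition t_atom (a : satom) : tree :=
  Nd (t_slot t_name (a_pred a)) (t_seq t_term (a_args a)).

Definition t_literal (l : sliteral) : tree :=
  match l with
  | LAtom sg a => Nd b0 (Nd (t_slot t_sign sg) (t_atom a))
  | LCmp c s t => Nd b1 (Nd (t_slot t_cmp c) (Nd (t_term s) (t_term t)))
  end.

Definition t_rhead (h : option satom) : tree :=
  if h is Some a then Nd b1 (t_atom a) else Nd b0 Lf.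

Definition t_rule (r : srule) : tree :=
  Nd (t_rhead (r_head r)) (t_seq t_literal (r_body r)).

Definition t_dom (e : name * nat * seq name) : tree :=
  Nd (Nd (t_name e.1.1) (t_nat e.1.2)) (t_seq t_name e.2).

Definition t_assignment (a : assignment) : tree :=
  match a with
  | APred q n d => Nd b0 (Nd b0 (Nd (t_name q) (Nd (t_nat n) (t_name d))))
  | ANeg s v    => Nd b0 (Nd b1 (Nd (t_name s) (t_sign v)))
  | ACmp s v    => Nd b1 (Nd b0 (Nd (t_name s) (t_cmp v)))
  | AArith s v  => Nd b1 (Nd b1 (Nd (t_name s) (t_arith v)))
  end.

Definition t_pref (e : assignment * Z) : tree := Nd (t_assignment e.1) (t_Z e.2).

Definition t_gterm (t : gterm) : tree :=
  match t with GInt z => Nd b0 (t_Z z) | GSym s => Nd b1 (t_name s) end.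

Definition t_gatom (g : gatom) : tree :=
  Nd (t_name (g_pred g)) (t_seq t_gterm (g_args g)).

Definition t_instance (I : instance) : tree :=
  Nd (t_seq t_rule (i_prog I)) (Nd (t_seq t_dom (i_doms I))
    (Nd (t_seq t_pref (i_prefs I)) (Nd (t_seq (t_seq t_gatom) (i_pos I))
      (t_seq (t_seq t_gatom) (i_neg I))))).

Lemma t_seq_inj T (f : T -> tree) : injective f -> injective (t_seq f).
Proof.
by move=> f_inj; rewrite /t_seq; elim=> [|x s IH] [|y t] //= [/f_inj-> /IH->].
Qed.

Lemma t_name_inj : injective t_name.
Proof. by apply: t_seq_inj => -[] []. Qed.

Lemma t_nat_inj : injective t_nat.
Proof. by rewrite /t_nat; elim=> [|n IH] [|m] //= [/IH->]. Qed.

Lemma t_pos_inj : injective t_pos.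
Proof. by elim=> [p IH|p IH|] [q|q|] //= [] // /IH->. Qed.

Lemma t_Z_inj : injective t_Z.
Proof. by case=> [|p|p] [|q|q] //= [] // /t_pos_inj->. Qed.

Lemma t_gterm_inj : injective t_gterm.
Proof. by case=> [z|s] [z'|s'] //= [] => [/t_Z_inj->|/t_name_inj->]. Qed.

Lemma t_gatom_inj : injective t_gatom.
Proof.
by case=> [p a] [q b] [/t_name_inj-> /(t_seq_inj t_gterm_inj)->].
Qed.

(** * Grammars *)

Inductive gram :=
| GEps
| GFail
| GAlt of gram & gram
| GPair of gram & gram
| GSeq of gram
| GNT of bool.

Definition gr_bit := GAlt GEps GEps.
Definition gr_name := GSeq gr_bit.
Definition gr_nat := GSeq GEps.
Definition gr_pos := GNT false.
Definition gr_Z := GAlt (GAlt GEps gr_pos) (GAlt GFail gr_pos).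
Definition gr_sign := gr_bit.
Definition gr_cmp := GAlt (GAlt gr_bit gr_bit) (GAlt gr_bit (GAlt GEps GFail)).
Definition gr_arith := GAlt (GAlt gr_bit gr_bit) (GAlt (GAlt GEps GFail) GFail).
Definition gr_slot g := GAlt g gr_name.
Definition gr_term := GNT true.
Definition gr_atom := GPair (gr_slot gr_name) (GSeq gr_term).
Definition gr_literal := GAlt (GPair (gr_slot gr_sign) gr_atom)
  (GPair (gr_slot gr_cmp) (GPair gr_term gr_term)).
Definition gr_rule := GPair (GAlt GEps gr_atom) (GSeq gr_literal).
Definition gr_dom := GPair (GPair gr_name gr_nat) (GSeq gr_name).
Definition gr_assignment :=
  GAlt (GAlt (GPair gr_name (GPair gr_nat gr_name)) (GPair gr_name gr_sign))
       (GAlt (GPair gr_name gr_cmp) (GPair gr_name gr_arith)).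
Definition gr_pref := GPair gr_assignment gr_Z.
Definition gr_gterm := GAlt gr_Z gr_name.
Definition gr_gatom := GPair gr_name (GSeq gr_gterm).
Definition gr_instance := GPair (GSeq gr_rule) (GPair (GSeq gr_dom)
  (GPair (GSeq gr_pref) (GPair (GSeq (GSeq gr_gatom)) (GSeq (GSeq gr_gatom))))).

(* The nonterminal [true] generates terms, [false] the code of a positive
   number without its leading bit. *)
Definition prod_of (nt : bool) : gram :=
  if nt then GAlt (GAlt gr_Z gr_name)
               (GPair (gr_slot gr_arith) (GPair (GNT true) (GNT true)))
  else GAlt (GAlt GFail gr_pos) (GAlt GEps gr_pos).

Inductive parses : gram -> tree -> seq bool -> Prop :=
| parses_eps : parses GEps Lf [::]
| parses_alt g h b t w :
    parses (if b then h else g) t w -> parses (GAlt g h) (Nd (bit b) t) (b :: w)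
| parses_pair g h t u v w :
    parses g t v -> parses h u w -> parses (GPair g h) (Nd t u) (v ++ w)
| parses_nil g : parses (GSeq g) Lf [:: false]
| parses_cons g t u v w :
    parses g t v -> parses (GSeq g) u w ->
    parses (GSeq g) (Nd t u) (true :: v ++ w)
| parses_nt nt t w : parses (prod_of nt) t w -> parses (GNT nt) t w.

(** Soundness needs that a parsed word encodes an object with that very tree, completeness that
    every encoding can be parsed; hence an equivalence. *)
Definition generates T (g : gram) (f : T -> tree) (e : T -> seq bool) : Prop :=
  forall t w, parses g t w <-> exists2 x, t = f x & w = e x.

Lemma parses_epsE t w : parses GEps t w <-> t = Lf /\ w = [::].
Proof. by split=> [h|[-> ->]]; [inversion h | constructor]. Qed.

Lemma parses_failE t w : parses GFail t w <-> False.
Proof. by split=> // h; inversion h. Qed.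

Lemma parses_altE g h t w : parses (GAlt g h) t w <->
  exists b u v, [/\ t = Nd (bit b) u, w = b :: v & parses (if b then h else g) u v].
Proof.
split=> [p|[b [u [v [-> -> p]]]]]; last by constructor.
by inversion p; subst; do 3 eexists.
Qed.

Lemma parses_pairE g h t w : parses (GPair g h) t w <->
  exists t1 t2 v1 v2, [/\ t = Nd t1 t2, w = v1 ++ v2, parses g t1 v1 & parses h t2 v2].
Proof.
split=> [p|[t1 [t2 [v1 [v2 [-> -> p1 p2]]]]]]; last by constructor.
by inversion p; subst; do 4 eexists.
Qed.

Lemma parses_ntE nt t w : parses (GNT nt) t w <-> parses (prod_of nt) t w.
Proof. by split=> [h|]; [inversion h | constructor]. Qed.

Lemma generates_seq T g (f : T -> tree) e :
  generates g f e -> generates (GSeq g) (t_seq f) (enc_seq e).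
Proof.
move=> gen t w; split=> [|[s -> ->]].
  move hE : (GSeq g) => h p; elim: p hE => // [h' _|h' t1 u v w1 p1 _ _ IH [gE]].
    by exists [::].
  subst h'; have [s -> ->] := IH erefl; have [x -> ->] := (gen _ _).1 p1.
  by exists (x :: s) => //; rewrite /enc_seq /= catA.
elim: s => [|x s IH]; first by constructor.
have -> : enc_seq e (x :: s) = true :: e x ++ enc_seq e s by rewrite /enc_seq /= catA.
by constructor => //; apply/gen; exists x.
Qed.

Ltac gen_cases :=
  repeat match goal with
  | |- parses GEps _ _ -> _ => move/parses_epsE=> [-> ->]
  | |- parses GFail _ _ -> _ => by move/parses_failE
  | |- parses (GAlt _ _) _ _ -> _ =>
      let b := fresh "b" in
      move/parses_altE=> [b [? [? [-> ->]]]]; case: b => /=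
  | |- parses (GPair _ _) _ _ -> _ =>
      move/parses_pairE=> [? [? [? [? [-> ->]]]]]
  end.

Lemma gen_bit : generates gr_bit (fun b => Nd (bit b) Lf) (fun b => [:: b]).
Proof.
move=> t w; split=> [|[b -> ->]]; last by constructor; case: b; constructor.
by rewrite /gr_bit; gen_cases; [exists true | exists false].
Qed.

Lemma gen_name : generates gr_name t_name enc_name.
Proof. exact: generates_seq gen_bit. Qed.

Lemma gen_nat : generates gr_nat t_nat enc_nat.
Proof.
have gen1 : generates GEps (fun _ : unit => Lf) (fun=> [::]).
  by move=> t w; rewrite parses_epsE; split=> [[-> ->]|[_ -> ->]] //; exists tt.
move=> t w; rewrite /gr_nat (generates_seq gen1); split.
  case=> s -> ->; exists (size s); first by rewrite /t_nat /t_seq; elim: s => //= _ s ->.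
  by rewrite /enc_nat /enc_seq; elim: s => //= _ s ->.
case=> n -> ->; exists (nseq n tt); first by rewrite /t_nat /t_seq; elim: n => //= n ->.
by rewrite /enc_nat /enc_seq; elim: n => //= n ->.
Qed.

Definition enc_pos (p : positive) : seq bool := behead (enc_name (pos_bits p)).

Lemma enc_posE p : enc_name (pos_bits p) = true :: enc_pos p.
Proof. by case: p. Qed.

Lemma enc_posI p : enc_pos (xI p) = [:: true, true & enc_pos p].
Proof. by rewrite -enc_posE /enc_pos /enc_name /enc_seq. Qed.

Lemma enc_posO p : enc_pos (xO p) = [:: false, true & enc_pos p].
Proof. by rewrite -enc_posE /enc_pos /enc_name /enc_seq. Qed.

(** One direction is by induction on the size of the tree, since the recursion passes through a
    nonterminal and not through a subgrammar. *)
Lemma gen_pos : generates gr_pos t_pos enc_pos.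
Proof.
move=> t w; split=> [|[p -> ->]].
  move: {2}(tsize t) (leqnn (tsize t)) => n; elim: n t w => [|n IH] t w; first by case: t.
  move=> t_n /parses_ntE; move: t_n => /[swap]; rewrite /=; gen_cases.
  - move=> h t_n; have [|p -> ->] := IH _ _ _ h; first by move: t_n => /=; lia.
    by exists (xI p); rewrite ?enc_posI.
  - by exists xH.
  - move=> h t_n; have [|p -> ->] := IH _ _ _ h; first by move: t_n => /=; lia.
    by exists (xO p); rewrite ?enc_posO.
elim: p => [p IH|p IH|]; rewrite ?enc_posI ?enc_posO /=; constructor.
- by apply: (parses_alt (b := true)); apply: (parses_alt (b := true)).
- by apply: (parses_alt (b := false)); apply: (parses_alt (b := true)).
- by apply: (parses_alt (b := true)); apply: (parses_alt (b := false)); constructor.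
Qed.

Lemma gen_Z : generates gr_Z t_Z enc_Z.
Proof.
move=> t w; split=> [|[z -> ->]].
  rewrite /gr_Z; gen_cases => //.
  - by move=> /gen_pos[p -> ->]; exists (Zneg p); rewrite /= ?enc_posE.
  - by move=> /gen_pos[p -> ->]; exists (Zpos p); rewrite /= ?enc_posE.
  - by exists Z0.
case: z => [|p|p] /=; rewrite ?enc_posE.
- by apply: (parses_alt (b := false)); apply: (parses_alt (b := false)); constructor.
- by apply: (parses_alt (b := false)); apply: (parses_alt (b := true)); apply/gen_pos; exists p.
- by apply: (parses_alt (b := true)); apply: (parses_alt (b := true)); apply/gen_pos; exists p.
Qed.

Ltac gen_build :=
  rewrite /=;
  repeat first
    [ exact: parses_eps
    | match goal with
      | |- parses _ (Nd b1 _) (true :: _) => apply: (@parses_alt _ _ true)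
      | |- parses _ (Nd b0 _) (false :: _) => apply: (@parses_alt _ _ false)
      end].

Lemma gen_sign : generates gr_sign t_sign enc_sign.
Proof.
move=> t w; split=> [|[[] -> ->]]; [|by gen_build..].
by rewrite /gr_sign /gr_bit; gen_cases; [exists Neg | exists Pos].
Qed.

Lemma gen_cmp : generates gr_cmp t_cmp enc_cmp.
Proof.
move=> t w; split=> [|[[] -> ->]]; [|by gen_build..].
rewrite /gr_cmp /gr_bit; gen_cases;
  [by exists CTop | by exists CLe | by exists CGe | by exists CGt
  | by exists CLt | by exists CNe | by exists CEq].
Qed.

Lemma gen_arith : generates gr_arith t_arith enc_arith.
Proof.
move=> t w; split=> [|[[] -> ->]]; [|by gen_build..].
rewrite /gr_arith /gr_bit; gen_cases; [by exists ODist | by exists ODiv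
  | by exists OMul | by exists OSub | by exists OAdd].
Qed.

Lemma gen_slot T g (f : T -> tree) e :
  generates g f e -> generates (gr_slot g) (t_slot f) (enc_slot e).
Proof.
move=> gen t w; split=> [|[[x|q] -> ->]].
- rewrite /gr_slot; gen_cases => [/gen_name|/gen] [x -> ->]; first by exists (Sk x).
  by exists (Fix x).
- by gen_build; apply/gen; exists x.
- by gen_build; apply/gen_name; exists q.
Qed.

Lemma generates_in T g (f : T -> tree) e x : generates g f e -> parses g (f x) (e x).
Proof. by move=> gen; apply/gen; exists x. Qed.

Lemma gen_term : generates gr_term t_term enc_term.
Proof.
move=> t w; split=> [|[x -> ->]].
  move: {2}(tsize t) (leqnn (tsize t)) => n; elim: n t w => [|n IH] t w; first by case: t.
  move=> t_n /parses_ntE; move: t_n => /[swap]; rewrite /= -/gr_term; gen_cases.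
  - move=> /(gen_slot gen_arith)[o -> ->] /parses_pairE[? [? [? [? [-> ->]]]]] h1 h2 /= t_n.
    have [|u1 -> ->] := IH _ _ _ h1; first lia.
    have [|u2 -> ->] := IH _ _ _ h2; first lia.
    by exists (TOp o u1 u2).
  - by move=> /gen_name[s -> ->]; exists (TSym s).
  - by move=> /gen_Z[z -> ->]; exists (TInt z).
elim: x => [z|s|o t1 IH1 t2 IH2]; constructor; gen_build.
- exact: generates_in gen_Z.
- exact: generates_in gen_name.
- by constructor; [exact: generates_in (gen_slot gen_arith) | constructor].
Qed.

Lemma gen_atom : generates gr_atom t_atom enc_atom.
Proof.
move=> t w; split=> [|[[p ts] -> ->]].
  rewrite /gr_atom; gen_cases => /(gen_slot gen_name)[p -> ->].
  by move=> /(generates_seq gen_term)[ts -> ->]; exists (Atom p ts).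
by constructor; [exact: generates_in (gen_slot gen_name)
  | exact: generates_in (generates_seq gen_term)].
Qed.

Lemma gen_literal : generates gr_literal t_literal enc_literal.
Proof.
move=> t w; split=> [|[[sg a|c t1 t2] -> ->]].
- rewrite /gr_literal; gen_cases => [/(gen_slot gen_cmp)[c -> ->]|/(gen_slot gen_sign)[sg -> ->]].
    move=> /parses_pairE[? [? [? [? [-> -> /gen_term[t1 -> ->] /gen_term[t2 -> ->]]]]]].
    by exists (LCmp c t1 t2).
  by move=> /gen_atom[a -> ->]; exists (LAtom sg a).
- gen_build; constructor; first exact: generates_in (gen_slot gen_sign).
  exact: generates_in gen_atom.
- gen_build; constructor; first exact: generates_in (gen_slot gen_cmp).
  by constructor; exact: generates_in gen_term.
Qed.

Lemma gen_rule : generates gr_rule t_rule enc_rule.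
Proof.
move=> t w; split=> [|[[[a|] b] -> ->]].
- rewrite /gr_rule; gen_cases => [/gen_atom[a -> ->]|];
    move=> /(generates_seq gen_literal)[b -> ->].
  + by exists (Rule (Some a) b).
  + by exists (Rule None b).
- constructor; last exact: generates_in (generates_seq gen_literal).
  by gen_build; exact: generates_in gen_atom.
- constructor; last exact: generates_in (generates_seq gen_literal).
  by gen_build.
Qed.

Definition enc_dom (e : name * nat * seq name) : seq bool :=
  enc_name e.1.1 ++ enc_nat e.1.2 ++ enc_seq enc_name e.2.

Lemma gen_dom : generates gr_dom t_dom enc_dom.
Proof.
move=> t w; split=> [|[[[q n] ds] -> ->]].
  rewrite /gr_dom; gen_cases.
  move=> /gen_name[q -> ->] /gen_nat[n -> ->] /(generates_seq gen_name)[ds -> ->].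
  by exists (q, n, ds); rewrite // /enc_dom -catA.
rewrite /enc_dom catA; constructor; last exact: generates_in (generates_seq gen_name).
by constructor; [exact: generates_in gen_name | exact: generates_in gen_nat].
Qed.

Lemma gen_assignment : generates gr_assignment t_assignment enc_assignment.
Proof.
move=> t w; split=> [|[[q n d|s v|s v|s v] -> ->]].
- rewrite /gr_assignment; gen_cases; move=> /gen_name[q -> ->].
  + by move=> /gen_arith[v -> ->]; exists (AArith q v).
  + by move=> /gen_cmp[v -> ->]; exists (ACmp q v).
  + by move=> /gen_sign[v -> ->]; exists (ANeg q v).
  + move=> /parses_pairE[? [? [? [? [-> -> /gen_nat[n -> ->] /gen_name[d -> ->]]]]]].
    by exists (APred q n d).
- gen_build; constructor; first exact: generates_in gen_name.
  by constructor; [exact: generates_in gen_nat | exact: generates_in gen_name].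
- by gen_build; constructor; [exact: generates_in gen_name | exact: generates_in gen_sign].
- by gen_build; constructor; [exact: generates_in gen_name | exact: generates_in gen_cmp].
- by gen_build; constructor; [exact: generates_in gen_name | exact: generates_in gen_arith].
Qed.

Definition enc_pref (e : assignment * Z) : seq bool := enc_assignment e.1 ++ enc_Z e.2.

Lemma gen_pref : generates gr_pref t_pref enc_pref.
Proof.
move=> t w; split=> [|[[a z] -> ->]].
  rewrite /gr_pref; gen_cases => /gen_assignment[a -> ->] /gen_Z[z -> ->].
  by exists (a, z).
by constructor; [exact: generates_in gen_assignment | exact: generates_in gen_Z].
Qed.

Lemma gen_gterm : generates gr_gterm t_gterm enc_gterm.
Proof.
move=> t w; split=> [|[[z|s] -> ->]].
- rewrite /gr_gterm; move=> /parses_altE[b [? [? [-> ->]]]].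
  by case: b => /= [/gen_name[s -> ->]|/gen_Z[z -> ->]]; [exists (GSym s) | exists (GInt z)].
- by apply: (@parses_alt _ _ false); exact: generates_in gen_Z.
- by apply: (@parses_alt _ _ true); exact: generates_in gen_name.
Qed.

Lemma gen_gatom : generates gr_gatom t_gatom enc_gatom.
Proof.
move=> t w; split=> [|[[p a] -> ->]].
  rewrite /gr_gatom; gen_cases => /gen_name[p -> ->].
  by move=> /(generates_seq gen_gterm)[a -> ->]; exists (GAtom p a).
by constructor; [exact: generates_in gen_name
  | exact: generates_in (generates_seq gen_gterm)].
Qed.

Lemma gen_instance : generates gr_instance t_instance enc_instance.
Proof.
have gen_examples := generates_seq (generates_seq gen_gatom).
move=> t w; split=> [|[[p d f ep en] -> ->]].
  rewrite /gr_instance; gen_cases => /(generates_seq gen_rule)[p -> ->].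
  move=> /parses_pairE[? [? [? [? [-> -> /(generates_seq gen_dom)[d -> ->]]]]]].
  move=> /parses_pairE[? [? [? [? [-> -> /(generates_seq gen_pref)[f -> ->]]]]]].
  move=> /parses_pairE[? [? [? [? [-> -> /gen_examples[ep -> ->] /gen_examples[en -> ->]]]]]].
  by exists (Instance p d f ep en).
constructor; first exact: generates_in (generates_seq gen_rule).
constructor; first exact: generates_in (generates_seq gen_dom).
constructor; first exact: generates_in (generates_seq gen_pref).
by constructor; exact: generates_in gen_examples.
Qed.

(* Slack used to bound parse trees by the length of the word: only [GAlt] and
   [GSeq] consume letters. *)
Fixpoint gram_slack (g : gram) : nat :=
  match g with
  | GEps => 1
  | GFail => 0
  | GAlt g h => maxn (gram_slack g) (gram_slack h) - 40
  | GPair g h => (gram_slack g + gram_slack h).+1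
  | GSeq _ => 1
  | GNT _ => 0
  end.

Fixpoint gram_small (g : gram) : bool :=
  match g with
  | GAlt g h | GPair g h => gram_small g && gram_small h
  | GSeq g => gram_small g && (gram_slack g <= 40)
  | _ => true
  end.

(** Of the 44 nodes granted per letter, at most four are built on the spot, and forty pay for the
    slack of what follows. Nonterminals come for free because their productions start with [GAlt]
    and have slack zero. *)
Lemma parses_size g t w : parses g t w -> gram_small g ->
  tsize t <= 44 * size w + gram_slack g.
Proof.
elim=> {g t w} [|g h b t w _ IH|g h t u v w _ IH1 _ IH2|g|g t u v w _ IH1 _ IH2|nt t w _ IH] //=.
- move=> /andP[sg sh]; have := IH; case: b {IH} => /=;
    [move=> /(_ sh) | move=> /(_ sg)]; lia.
- by move=> /andP[/IH1 h1 /IH2 h2]; rewrite size_cat; lia.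
- by move=> /andP[sg kg]; have := IH1 sg; have := IH2; rewrite /= sg kg size_cat => /(_ isT); lia.
- by move=> _; have := IH; case: nt {IH} => /= /(_ isT); lia.
Qed.

Lemma t_instance_size I : tsize (t_instance I) <= 44 * size (enc_instance I) + 10.
Proof.
have p : parses gr_instance (t_instance I) (enc_instance I) by apply/gen_instance; exists I.
by have := parses_size p isT; rewrite /=; lia.
Qed.

(** * The verifier as a Horn program *)

Fixpoint const (t : tree) : pat :=
  if t is Nd t u then PN (const t) (const u) else PL.
Arguments const : simpl never.
Coercion const : tree >-> pat.

Lemma inst_const s t : inst s (const t) = t.
Proof. by elim: t => //= t IHt u IHu; rewrite /const /= -!/(const _) IHt IHu. Qed.

Definition goal (q : nat) (ts : seq tree) : tree := Nd (t_nat q) (t_list ts).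

Definition goal_pat (q : nat) (ps : seq pat) : pat :=
  PN (t_nat q) (foldr PN PL ps).

Arguments goal_pat : simpl never.

Lemma inst_goal s q ps : inst s (goal_pat q ps) = goal q (map (inst s) ps).
Proof.
by rewrite /goal /goal_pat /= inst_const; congr Nd; elim: ps => //= p ps ->.
Qed.

Lemma t_list_inj : injective t_list.
Proof. by elim=> [|x s IH] [|y t] //= [-> /IH->]. Qed.

Lemma goal_inj q ts q' ts' : goal q ts = goal q' ts' -> q = q' /\ ts = ts'.
Proof. by case=> /t_nat_inj-> /t_list_inj->. Qed.

(* The clauses for the [q]-th predicate form the [q]-th group; a clause is
   given by the arguments in its head and the calls in its body. *)
Definition rules : Type := seq (seq pat * seq (nat * seq pat)).

Definition mk_clause (q : nat) (c : seq pat * seq (nat * seq pat)) : clause :=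
  (goal_pat q c.1, [seq goal_pat b.1 b.2 | b <- c.2]).

Fixpoint mk_clauses (q : nat) (gs : seq rules) : seq clause :=
  if gs is g :: gs then map (mk_clause q) g ++ mk_clauses q.+1 gs else [::].

Lemma mk_clausesP q0 gs c : List.In c (mk_clauses q0 gs) <->
  exists q r, [/\ q < size gs, List.In r (nth [::] gs q) & c = mk_clause (q0 + q) r].
Proof.
elim: gs q0 => [|g gs IH] q0 /=; first by split=> // -[q [r []]].
rewrite List.in_app_iff IH List.in_map_iff; split.
  case=> [[r [<- r_in]]|[q [r [q_lt r_in ->]]]]; first by exists 0, r; rewrite addn0.
  by exists q.+1, r; rewrite addnS.
case=> [[|q] [r [q_lt r_in ->]]]; first by left; exists r; rewrite addn0.
by right; exists q, r; rewrite addnS.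
Qed.

Notation MAIN := 0 (only parsing).
Notation PARSE := 1 (only parsing).
Notation NEQ := 2 (only parsing).
Notation LOOK := 3 (only parsing).
Notation MEM := 4 (only parsing).
Notation NMEM := 5 (only parsing).
Notation ISPOS := 6 (only parsing).
Notation ISZ := 7 (only parsing).
Notation SUCC := 8 (only parsing).
Notation PADD := 9 (only parsing).
Notation PMUL := 10 (only parsing).
Notation ZADD := 11 (only parsing).
Notation ZMUL := 12 (only parsing).
Notation QUOT := 13 (only parsing).
Notation ZCMP := 14 (only parsing).
Notation NCMP := 15 (only parsing).
Notation GCMP := 16 (only parsing).
Notation APPLY := 17 (only parsing).
Notation FILL := 18 (only parsing).
Notation TERM := 19 (only parsing).
Notation BOTH := 20 (only parsing).
Notation ARGS := 21 (only parsing).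
Notation LEN := 22 (only parsing).
Notation PRED := 23 (only parsing).
Notation ATOM := 24 (only parsing).
Notation CSEM := 25 (only parsing).
Notation NONTOP := 26 (only parsing).
Notation CMP := 27 (only parsing).
Notation GUARD := 28 (only parsing).
Notation ADDLIT := 29 (only parsing).
Notation BODY := 30 (only parsing).
Notation HEAD := 31 (only parsing).
Notation RULE := 32 (only parsing).
Notation PROG := 33 (only parsing).
Notation FACTS := 34 (only parsing).
Notation ALLIN := 35 (only parsing).
Notation NONEIN := 36 (only parsing).
Notation BLOCK := 37 (only parsing).
Notation DERIV := 38 (only parsing).
Notation CLOSED := 39 (only parsing).
Notation CONSOK := 40 (only parsing).
Notation POSEX := 41 (only parsing).
Notation NEGEX := 42 (only parsing).
Notation LE := 43 (only parsing).
Notation ORDS := 44 (only parsing).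
Notation HNODES := 45 (only parsing).
Notation ALLGE := 46 (only parsing).
Notation SBODY := 47 (only parsing).
Notation SRULES := 48 (only parsing).
Notation ALLLE := 49 (only parsing).
Notation SDOMS := 50 (only parsing).

(** Grammars are data interpreted by [PARSE], so that one group of clauses reads every syntactic
    category. No clause handles the tag 5 of [GFail]. *)
Fixpoint t_gram (g : gram) : tree :=
  match g with
  | GEps => Nd (t_nat 0) Lf
  | GFail => Nd (t_nat 5) Lf
  | GAlt g h => Nd (t_nat 1) (Nd (t_gram g) (t_gram h))
  | GPair g h => Nd (t_nat 2) (Nd (t_gram g) (t_gram h))
  | GSeq g => Nd (t_nat 3) (t_gram g)
  | GNT nt => Nd (t_nat 4) (bit nt)
  end.
Arguments t_gram : simpl never.

Definition t_comparison (c : comparison) : tree :=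
  match c with Eq => Lf | Lt => Nd Lf Lf | Gt => Nd Lf (Nd Lf Lf) end.

Definition all_cmp := [:: CEq; CNe; CLt; CGt; CGe; CLe; CTop].
Definition all_comparison := [:: Eq; Lt; Gt].

(* Keys of the table of a substitution: arithmetic, negations, comparisons;
   a sketched predicate also has its arity in its key. *)
Definition k_arith := t_nat 0.
Definition k_neg := t_nat 1.
Definition k_cmp := t_nat 2.
Definition k_pred (n : tree) := Nd (t_nat 3) n.

Section Clauses.

Local Notation "p ** q" := (PN p q) (at level 35, right associativity).
Local Notation x0 := (PV 0).
Local Notation x1 := (PV 1).
Local Notation x2 := (PV 2).
Local Notation x3 := (PV 3).
Local Notation x4 := (PV 4).
Local Notation x5 := (PV 5).
Local Notation x6 := (PV 6).
Local Notation x7 := (PV 7).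
Local Notation x8 := (PV 8).
Local Notation x9 := (PV 9).
Local Notation x10 := (PV 10).
Local Notation x11 := (PV 11).
Local Notation "p <== b" := (p, b) (at level 70, only parsing).

(** [x1] to [x5] are the parse trees of the components of the instance. Guessed besides them are the
    substitution [x6] and the level table [x7]; [x8] is the resulting ground program. *)
Definition c_main : rules := [::
  [:: x0] <== [:: (PARSE, [:: const (t_gram gr_instance); x0; x1 ** x2 ** x3 ** x4 ** x5; PL]);
                  (SRULES, [:: x2; x7; x1]); (SDOMS, [:: x2; x7; x2]);
                  (PROG, [:: x2; x6; x1; x8]); (POSEX, [:: x4; x8]);
                  (NEGEX, [:: x5; x8])]].

(* [PARSE g v x w]: [v] is [w] preceded by a word of [g] with parse tree [x]. *)
Definition c_parse : rules := [::
  [:: const (t_gram GEps); x0; PL; x0] <== [::];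
  [:: t_nat 1 ** x0 ** x1; b0 ** x2; b0 ** x3; x4] <==
    [:: (PARSE, [:: x0; x2; x3; x4])];
  [:: t_nat 1 ** x0 ** x1; b1 ** x2; b1 ** x3; x4] <==
    [:: (PARSE, [:: x1; x2; x3; x4])];
  [:: t_nat 2 ** x0 ** x1; x2; x3 ** x4; x5] <==
    [:: (PARSE, [:: x0; x2; x3; x6]); (PARSE, [:: x1; x6; x4; x5])];
  [:: t_nat 3 ** x0; b0 ** x1; PL; x1] <== [::];
  [:: t_nat 3 ** x0; b1 ** x1; x2 ** x3; x4] <==
    [:: (PARSE, [:: x0; x1; x2; x5]); (PARSE, [:: t_nat 3 ** x0; x5; x3; x4])];
  [:: const (t_gram (GNT true)); x0; x1; x2] <==
    [:: (PARSE, [:: const (t_gram (prod_of true)); x0; x1; x2])];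
  [:: const (t_gram (GNT false)); x0; x1; x2] <==
    [:: (PARSE, [:: const (t_gram (prod_of false)); x0; x1; x2])]].

(** Disequality in positive form: descend to a place where one tree has a leaf and the other a
    node. *)
Definition c_neq : rules := [::
  [:: PL; x0 ** x1] <== [::];
  [:: x0 ** x1; PL] <== [::];
  [:: x0 ** x1; x2 ** x3] <== [:: (NEQ, [:: x0; x2])];
  [:: x0 ** x1; x2 ** x3] <== [:: (NEQ, [:: x1; x3])]].

(** An entry may be skipped only on proof that its key differs, so that the first matching entry is
    the only one found, as in [dom]. *)
Definition c_look : rules := [::
  [:: x0; (x0 ** x1) ** x2; x1] <== [::];
  [:: x0; (x1 ** x2) ** x3; x4] <== [:: (NEQ, [:: x1; x0]); (LOOK, [:: x0; x3; x4])]].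

Definition c_mem : rules := [::
  [:: x0; x0 ** x1] <== [::];
  [:: x0; x1 ** x2] <== [:: (MEM, [:: x0; x2])]].

Definition c_nmem : rules := [::
  [:: x0; PL] <== [::];
  [:: x0; x1 ** x2] <== [:: (NEQ, [:: x1; x0]); (NMEM, [:: x0; x2])]].

Local Notation pH := (b1 ** b0 ** PL).
Local Notation "'pO' p" := (b0 ** b1 ** p) (at level 9).
Local Notation "'pI' p" := (b1 ** b1 ** p) (at level 9).
Local Notation z0 := (b0 ** b0 ** PL).
Local Notation "'zp' p" := (b0 ** b1 ** p) (at level 9).
Local Notation "'zn' p" := (b1 ** b1 ** p) (at level 9).

Definition c_ispos : rules := [::
  [:: pH] <== [::];
  [:: pO x0] <== [:: (ISPOS, [:: x0])];
  [:: pI x0] <== [:: (ISPOS, [:: x0])]].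

Definition c_isz : rules := [::
  [:: z0] <== [::];
  [:: zp x0] <== [:: (ISPOS, [:: x0])];
  [:: zn x0] <== [:: (ISPOS, [:: x0])]].

Definition c_succ : rules := [::
  [:: pH; pO pH] <== [::];
  [:: pO x0; pI x0] <== [:: (ISPOS, [:: x0])];
  [:: pI x0; pO x1] <== [:: (SUCC, [:: x0; x1])]].

(** Schoolbook addition with the least significant digit first; a carry is added to the sum of the
    remaining digits by [SUCC]. *)
Definition c_padd : rules := [::
  [:: pH; x0; x1] <== [:: (SUCC, [:: x0; x1])];
  [:: pO x0; pH; pI x0] <== [:: (ISPOS, [:: x0])];
  [:: pI x0; pH; pO x1] <== [:: (SUCC, [:: x0; x1])];
  [:: pO x0; pO x1; pO x2] <== [:: (PADD, [:: x0; x1; x2])];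
  [:: pO x0; pI x1; pI x2] <== [:: (PADD, [:: x0; x1; x2])];
  [:: pI x0; pO x1; pI x2] <== [:: (PADD, [:: x0; x1; x2])];
  [:: pI x0; pI x1; pO x3] <== [:: (PADD, [:: x0; x1; x2]); (SUCC, [:: x2; x3])]].

Definition c_pmul : rules := [::
  [:: pH; x0; x0] <== [:: (ISPOS, [:: x0])];
  [:: pO x0; x1; pO x2] <== [:: (PMUL, [:: x0; x1; x2])];
  [:: pI x0; x1; x2] <== [:: (PMUL, [:: x0; x1; x3]); (PADD, [:: x1; pO x3; x2])]].

(** A difference of positive numbers is guessed and verified by an addition, so subtraction needs no
    clauses of its own. *)
Definition c_zadd : rules := [::
  [:: z0; x0; x0] <== [:: (ISZ, [:: x0])];
  [:: x0; z0; x0] <== [:: (ISZ, [:: x0])];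
  [:: zp x0; zp x1; zp x2] <== [:: (PADD, [:: x0; x1; x2])];
  [:: zn x0; zn x1; zn x2] <== [:: (PADD, [:: x0; x1; x2])];
  [:: zp x0; zn x0; z0] <== [:: (ISPOS, [:: x0])];
  [:: zp x0; zn x1; zp x2] <== [:: (PADD, [:: x1; x2; x0])];
  [:: zp x0; zn x1; zn x2] <== [:: (PADD, [:: x0; x2; x1])];
  [:: zn x0; zp x1; x2] <== [:: (ZADD, [:: zp x1; zn x0; x2])]].

Definition c_zmul : rules := [::
  [:: z0; x0; z0] <== [:: (ISZ, [:: x0])];
  [:: x0; z0; z0] <== [:: (ISZ, [:: x0])];
  [:: zp x0; zp x1; zp x2] <== [:: (PMUL, [:: x0; x1; x2])];
  [:: zp x0; zn x1; zn x2] <== [:: (PMUL, [:: x0; x1; x2])];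
  [:: zn x0; zp x1; zn x2] <== [:: (PMUL, [:: x0; x1; x2])];
  [:: zn x0; zn x1; zp x2] <== [:: (PMUL, [:: x0; x1; x2])]].

(* The remainder is zero, or has the sign of the dividend and a smaller
   absolute value than the divisor. *)
Definition c_quot : rules := [::
  [:: x0; x1 ** b1 ** x2; x3] <== [:: (ZMUL, [:: x1 ** b1 ** x2; x3; x0])];
  [:: x0 ** b1 ** x1; x2 ** b1 ** x3; x4] <==
    [:: (ZMUL, [:: x2 ** b1 ** x3; x4; x5]);
        (ZADD, [:: x5; x0 ** b1 ** x6; x0 ** b1 ** x1]);
        (PADD, [:: x6; x7; x3])]].

(** Strict inequality is certified by a guessed positive difference. *)
Definition c_zcmp : rules := [::
  [:: x0; x0; const (t_comparison Eq)] <== [:: (ISZ, [:: x0])];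
  [:: x0; x1; const (t_comparison Lt)] <== [:: (ZADD, [:: x0; zp x2; x1])];
  [:: x0; x1; const (t_comparison Gt)] <== [:: (ZADD, [:: x1; zp x2; x0])]].

Definition c_ncmp : rules := [::
  [:: PL; PL; const (t_comparison Eq)] <== [::];
  [:: PL; x0 ** x1; const (t_comparison Lt)] <== [::];
  [:: x0 ** x1; PL; const (t_comparison Gt)] <== [::];
  [:: x0 ** x1; x0 ** x2; x3] <== [:: (NCMP, [:: x1; x2; x3])];
  [:: (b0 ** PL) ** x0; (b1 ** PL) ** x1; const (t_comparison Lt)] <== [::];
  [:: (b1 ** PL) ** x0; (b0 ** PL) ** x1; const (t_comparison Gt)] <== [::]].

Definition c_gcmp : rules := [::
  [:: b0 ** x0; b0 ** x1; x2] <== [:: (ZCMP, [:: x0; x1; x2])];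
  [:: b0 ** x0; b1 ** x1; const (t_comparison Lt)] <== [::];
  [:: b1 ** x0; b0 ** x1; const (t_comparison Gt)] <== [::];
  [:: b1 ** x0; b1 ** x1; x2] <== [:: (NCMP, [:: x0; x1; x2])]].

Local Notation "'int' z" := (PL ** b0 ** z) (at level 9).
Local Notation "'sym' s" := (PL ** b1 ** s) (at level 9).

(** Undefinedness is a value, the leaf [PL], because a rule may be dropped only on proof that it is
    undefined. Subtraction and distance are verified by additions; the sign [b0] makes the distance
    nonnegative. *)
Definition c_apply : rules := [::
  [:: const (t_arith OAdd); int x0; int x1; int x2] <== [:: (ZADD, [:: x0; x1; x2])];
  [:: const (t_arith OSub); int x0; int x1; int x2] <== [:: (ZADD, [:: x2; x1; x0])];
  [:: const (t_arith OMul); int x0; int x1; int x2] <== [:: (ZMUL, [:: x0; x1; x2])];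
  [:: const (t_arith ODiv); int x0; int x1; int x2] <== [:: (QUOT, [:: x0; x1; x2])];
  [:: const (t_arith ODiv); int x0; int z0; PL] <== [::];
  [:: const (t_arith ODist); int x0; int x1; int (b0 ** x2)] <==
    [:: (ZADD, [:: x1; b0 ** x2; x0])];
  [:: const (t_arith ODist); int x0; int x1; int (b0 ** x2)] <==
    [:: (ZADD, [:: x0; b0 ** x2; x1])];
  [:: x0; PL; x1; PL] <== [::];
  [:: x0; sym x1; x2; PL] <== [::];
  [:: x0; x1; PL; PL] <== [::];
  [:: x0; x1; sym x2; PL] <== [::]].

Definition c_fill : rules := [::
  [:: x0; x1; b0 ** x2; x2] <== [::];
  [:: x0; x1; b1 ** x2; x3] <== [:: (LOOK, [:: x1 ** x2; x0; x3])]].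

Definition c_term : rules := [::
  [:: x0; b0 ** b0 ** x1; int x1] <== [::];
  [:: x0; b0 ** b1 ** x1; sym x1] <== [::];
  [:: x0; b1 ** x1 ** x2 ** x3; x4] <==
    [:: (FILL, [:: x0; const k_arith; x1; x5]); (TERM, [:: x0; x2; x6]);
        (TERM, [:: x0; x3; x7]); (APPLY, [:: x5; x6; x7; x4])]].

Definition c_both : rules := [::
  [:: PL; x0; PL] <== [::];
  [:: PL ** x0; PL; PL] <== [::];
  [:: PL ** x0; PL ** x1; PL ** x0 ** x1] <== [::]].

Definition c_args : rules := [::
  [:: x0; PL; PL ** PL] <== [::];
  [:: x0; x1 ** x2; x3] <==
    [:: (TERM, [:: x0; x1; x4]); (ARGS, [:: x0; x2; x5]); (BOTH, [:: x4; x5; x3])]].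

Definition c_len : rules := [::
  [:: PL; PL] <== [::];
  [:: x0 ** x1; PL ** x2] <== [:: (LEN, [:: x1; x2])]].

(** This is where the guessed substitution is compared with the domains. *)
Definition c_pred : rules := [::
  [:: x0; x1; b0 ** x2; x3; x2] <== [::];
  [:: x0; x1; b1 ** x2; x3; x4] <==
    [:: (LOOK, [:: (t_nat 3 ** x3) ** x2; x1; x4]); (LOOK, [:: x2 ** x3; x0; x5]);
        (MEM, [:: x4; x5])]].

Definition c_atom : rules := [::
  [:: x0; x1; x2 ** x3; x4] <==
    [:: (LEN, [:: x3; x5]); (PRED, [:: x0; x1; x2; x5; x6]);
        (ARGS, [:: x1; x3; x7]); (BOTH, [:: PL ** x6; x7; x4])]].

Definition c_csem : rules :=
  [seq ([:: const (t_cmp c); const (t_comparison r); const (bit (cmp_sem c r))], [::])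
     | c <- all_cmp, r <- all_comparison].

Definition c_nontop : rules :=
  [seq ([:: const (t_cmp c)], [::]) | c <- [:: CEq; CNe; CLt; CGt; CGe; CLe]].

Definition c_cmp : rules := [::
  [:: const (t_cmp CTop); x0; x1; const b1] <== [::];
  [:: x0; PL; x1; const b0] <== [:: (NONTOP, [:: x0])];
  [:: x0; x1; PL; const b0] <== [:: (NONTOP, [:: x0])];
  [:: x0; PL ** x1; PL ** x2; x3] <==
    [:: (GCMP, [:: x1; x2; x4]); (CSEM, [:: x0; x4; x3])]].

Definition c_guard : rules := [::
  [:: const b0; x0; PL] <== [::];
  [:: const b1; x0; x0] <== [::]].

Definition c_addlit : rules := [::
  [:: x0; PL; x1; PL] <== [::];
  [:: x0; PL ** x1; PL; PL] <== [::];
  [:: const (t_sign Pos); PL ** x0; PL ** x1 ** x2; PL ** (x0 ** x1) ** x2] <== [::];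
  [:: const (t_sign Neg); PL ** x0; PL ** x1 ** x2; PL ** x1 ** x0 ** x2] <== [::]].

(** The rest of a body is evaluated even if a literal already voids the rule, and [GUARD] or
    [ADDLIT] discards the outcome afterwards: all sketched predicates of the program have to be
    checked against their domains. *)
Definition c_body : rules := [::
  [:: x0; x1; PL; PL ** PL ** PL] <== [::];
  [:: x0; x1; (b0 ** x2 ** x3) ** x4; x5] <==
    [:: (FILL, [:: x1; const k_neg; x2; x6]); (ATOM, [:: x0; x1; x3; x7]);
        (BODY, [:: x0; x1; x4; x8]); (ADDLIT, [:: x6; x7; x8; x5])];
  [:: x0; x1; (b1 ** x2 ** x3 ** x4) ** x5; x6] <==
    [:: (FILL, [:: x1; const k_cmp; x2; x7]); (TERM, [:: x1; x3; x8]);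
        (TERM, [:: x1; x4; x9]); (CMP, [:: x7; x8; x9; x10]);
        (BODY, [:: x0; x1; x5; x11]); (GUARD, [:: x10; x11; x6])]].

Definition c_head : rules := [::
  [:: x0; x1; b0 ** PL; PL ** PL] <== [::];
  [:: x0; x1; b1 ** x2; PL] <== [:: (ATOM, [:: x0; x1; x2; PL])];
  [:: x0; x1; b1 ** x2; PL ** PL ** x3] <== [:: (ATOM, [:: x0; x1; x2; PL ** x3])]].

Definition c_rule : rules := [::
  [:: x0; x1; x2 ** x3; x4] <==
    [:: (HEAD, [:: x0; x1; x2; x5]); (BODY, [:: x0; x1; x3; x6]);
        (BOTH, [:: x5; x6; x4])]].

Definition c_prog : rules := [::
  [:: x0; x1; PL; PL] <== [::];
  [:: x0; x1; x2 ** x3; x4] <==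
    [:: (RULE, [:: x0; x1; x2; PL]); (PROG, [:: x0; x1; x3; x4])];
  [:: x0; x1; x2 ** x3; x4 ** x5] <==
    [:: (RULE, [:: x0; x1; x2; PL ** x4]); (PROG, [:: x0; x1; x3; x5])]].

Definition c_facts : rules := [::
  [:: PL; x0; x0] <== [::];
  [:: x0 ** x1; x2; ((PL ** x0) ** PL ** PL) ** x3] <== [:: (FACTS, [:: x1; x2; x3])]].

Definition c_allin : rules := [::
  [:: PL; x0] <== [::];
  [:: x0 ** x1; x2] <== [:: (MEM, [:: x0; x2]); (ALLIN, [:: x1; x2])]].

Definition c_nonein : rules := [::
  [:: PL; x0] <== [::];
  [:: x0 ** x1; x2] <== [:: (NMEM, [:: x0; x2]); (NONEIN, [:: x1; x2])]].

Definition c_block : rules := [::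
  [:: x0 ** x1; x2; x3] <== [:: (NMEM, [:: x0; x3])];
  [:: x0 ** x1; x2; x3] <== [:: (BLOCK, [:: x1; x2; x3])];
  [:: x0; x1 ** x2; x3] <== [:: (MEM, [:: x1; x3])];
  [:: x0; x1 ** x2; x3] <== [:: (BLOCK, [:: x0; x2; x3])]].

Definition c_deriv : rules := [::
  [:: x0; PL; x1] <== [::];
  [:: x0; x1 ** x2; x3] <==
    [:: (MEM, [:: (PL ** x1) ** x4 ** x5; x0]); (ALLIN, [:: x4; x2]);
        (NONEIN, [:: x5; x3]); (DERIV, [:: x0; x2; x3])]].

Definition c_closed : rules := [::
  [:: PL; x0] <== [::];
  [:: (PL ** x0) ** x1; x2] <== [:: (CLOSED, [:: x1; x2])];
  [:: ((PL ** x0) ** x1) ** x2; x3] <== [:: (MEM, [:: x0; x3]); (CLOSED, [:: x2; x3])];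
  [:: (x0 ** x1 ** x2) ** x3; x4] <==
    [:: (BLOCK, [:: x1; x2; x4]); (CLOSED, [:: x3; x4])]].

Definition c_consok : rules := [::
  [:: PL; x0] <== [::];
  [:: ((x0 ** x1) ** x2) ** x3; x4] <== [:: (CONSOK, [:: x3; x4])];
  [:: (x0 ** x1 ** x2) ** x3; x4] <==
    [:: (BLOCK, [:: x1; x2; x4]); (CONSOK, [:: x3; x4])]].

Definition c_posex : rules := [::
  [:: PL; x0] <== [::];
  [:: x0 ** x1; x2] <==
    [:: (FACTS, [:: x0; x2; x3]); (DERIV, [:: x3; x4; x4]); (CLOSED, [:: x3; x4]);
        (CONSOK, [:: x3; x4]); (POSEX, [:: x1; x2])]].

Definition c_negex : rules := [::
  [:: PL; x0] <== [::];
  [:: x0 ** x1; x2] <==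
    [:: (FACTS, [:: x0; x2; x3]); (DERIV, [:: x3; x4; x4]); (CLOSED, [:: x3; x4]);
        (MEM, [:: PL ** x5 ** x6; x3]); (ALLIN, [:: x5; x4]);
        (NONEIN, [:: x6; x4]); (NEGEX, [:: x1; x2])]].

Definition c_le : rules := [::
  [:: PL; x0] <== [::];
  [:: x0 ** x1; x2 ** x3] <== [:: (LE, [:: x1; x3])]].

Definition c_ords : rules := [::
  [:: PL; x0; PL] <== [::];
  [:: x0 ** x1; x2; ((b0 ** x0) ** x2) ** x3] <== [:: (ORDS, [:: x1; x2; x3])]].

Definition c_hnodes : rules := [::
  [:: x0; (b0 ** x1) ** x2; ((b0 ** x1) ** x2) ** PL] <== [::];
  [:: x0; (b1 ** x1) ** x2; ((b1 ** x1) ** x2) ** x3] <==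
    [:: (LOOK, [:: x1 ** x2; x0; x4]); (ORDS, [:: x4; x2; x3])]].

Definition c_allge : rules := [::
  [:: x0; PL; x1] <== [::];
  [:: x0; x1 ** x2; x3] <==
    [:: (LOOK, [:: x1; x0; x4]); (LE, [:: x3; x4]); (ALLGE, [:: x0; x2; x3])]].

(** Levels are unary, so [PL ** x6] is the successor of [x6]. A sketched negation is held to the
    strict condition, which implies the weak one. *)
Definition c_sbody : rules := [::
  [:: x0; x1; PL] <== [::];
  [:: x0; x1; (b1 ** x2) ** x3] <== [:: (SBODY, [:: x0; x1; x3])];
  [:: x0; x1; (b0 ** (b0 ** t_sign Pos) ** x2 ** x3) ** x4] <==
    [:: (LEN, [:: x3; x5]); (LOOK, [:: x2 ** x5; x0; x6]);
        (ALLGE, [:: x0; x1; x6]); (SBODY, [:: x0; x1; x4])];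
  [:: x0; x1; (b0 ** (b0 ** t_sign Neg) ** x2 ** x3) ** x4] <==
    [:: (LEN, [:: x3; x5]); (LOOK, [:: x2 ** x5; x0; x6]);
        (ALLGE, [:: x0; x1; PL ** x6]); (SBODY, [:: x0; x1; x4])];
  [:: x0; x1; (b0 ** (b1 ** x7) ** x2 ** x3) ** x4] <==
    [:: (LEN, [:: x3; x5]); (LOOK, [:: x2 ** x5; x0; x6]);
        (ALLGE, [:: x0; x1; PL ** x6]); (SBODY, [:: x0; x1; x4])]].

Definition c_srules : rules := [::
  [:: x0; x1; PL] <== [::];
  [:: x0; x1; ((b0 ** PL) ** x2) ** x3] <== [:: (SRULES, [:: x0; x1; x3])];
  [:: x0; x1; ((b1 ** x2 ** x3) ** x4) ** x5] <==
    [:: (LEN, [:: x3; x6]); (HNODES, [:: x0; x2 ** x6; x7]);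
        (SBODY, [:: x1; x7; x4]); (SRULES, [:: x0; x1; x5])]].

Definition c_allle : rules := [::
  [:: x0; PL; x1] <== [::];
  [:: x0; x1 ** x2; x3] <==
    [:: (LOOK, [:: x1; x0; x4]); (LE, [:: x4; x3]); (ALLLE, [:: x0; x2; x3])]].

(** The domain is looked up and not read off as [x4], since a repeated key stands for its first
    entry only. *)
Definition c_sdoms : rules := [::
  [:: x0; x1; PL] <== [::];
  [:: x0; x1; ((x2 ** x3) ** x4) ** x5] <==
    [:: (LOOK, [:: x2 ** x3; x0; x6]); (ORDS, [:: x6; x3; x7]);
        (LOOK, [:: (b1 ** x2) ** x3; x1; x8]); (ALLLE, [:: x1; x7; x8]);
        (SDOMS, [:: x0; x1; x5])]].

End Clauses.

Definition groups : seq rules := [::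
  c_main; c_parse; c_neq; c_look; c_mem; c_nmem; c_ispos; c_isz; c_succ;
  c_padd; c_pmul; c_zadd; c_zmul; c_quot; c_zcmp; c_ncmp; c_gcmp; c_apply;
  c_fill; c_term; c_both; c_args; c_len; c_pred; c_atom; c_csem; c_nontop;
  c_cmp; c_guard; c_addlit; c_body; c_head; c_rule; c_prog; c_facts; c_allin;
  c_nonein; c_block; c_deriv; c_closed; c_consok; c_posex; c_negex; c_le;
  c_ords; c_hnodes; c_allge; c_sbody; c_srules; c_allle; c_sdoms].

Definition horn : seq clause := mk_clauses 0 groups.

Definition start : pat := goal_pat MAIN [:: PV 0].

Lemma horn_below : all (clause_below 12) horn.
Proof. by vm_compute. Qed.

Lemma start_below : pat_below 1 start.
Proof. by vm_compute. Qed.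

(** * Meaning of the predicates *)

Fixpoint tlen (t : tree) : nat := if t is Nd _ r then (tlen r).+1 else 0.

Fixpoint tmem (x l : tree) : bool :=
  if l is Nd y r then (y == x) || tmem x r else false.

Fixpoint tlook (k t : tree) : option tree :=
  match t with
  | Nd (Nd k' v) r => if k' == k then Some v else tlook k r
  | _ => None
  end.

Fixpoint dec_name (t : tree) : name :=
  if t is Nd (Nd b _) r then (b != Lf) :: dec_name r else [::].

Definition dec_sign (t : tree) : sign := if t == t_sign Neg then Neg else Pos.

Definition dec_cmp (t : tree) : cmp :=
  head CEq [seq c <- all_cmp | t_cmp c == t].

Definition dec_arith (t : tree) : arith :=
  head OAdd [seq o <- [:: OAdd; OSub; OMul; ODiv; ODist] | t_arith o == t].

Lemma t_nameK n : dec_name (t_name n) = n.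
Proof. by rewrite /t_name /t_seq; elim: n => //= -[] n /= ->. Qed.

Lemma t_signK s : dec_sign (t_sign s) = s. Proof. by case: s. Qed.
Lemma t_cmpK c : dec_cmp (t_cmp c) = c. Proof. by case: c. Qed.
Lemma t_arithK o : dec_arith (t_arith o) = o. Proof. by case: o. Qed.

Definition tget (k t : tree) : tree := odflt Lf (tlook k t).

(** The guessed table may have any shape; total decoders with default values turn every tree into a
    substitution. *)
Definition subst_of (t : tree) : subst := Subst
  (fun q n => dec_name (tget (Nd (k_pred (t_nat n)) (t_name q)) t))
  (fun q => dec_sign (tget (Nd k_neg (t_name q)) t))
  (fun q => dec_cmp (tget (Nd k_cmp (t_name q)) t))
  (fun q => dec_arith (tget (Nd k_arith (t_name q)) t)).

Definition arith_opt (o : arith) (x y : option gterm) : option gterm :=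
  match x, y with
  | Some (GInt a), Some (GInt b) => omap GInt (arith_sem o a b)
  | _, _ => None
  end.

Definition cmp_opt (c : cmp) (x y : option gterm) : bool :=
  match c, x, y with
  | CTop, _, _ => true
  | _, Some a, Some b => cmp_sem c (gterm_compare a b)
  | _, _, _ => false
  end.

Definition domain (ds : seq (name * nat * seq name)) (q : name) (n : nat) : seq name :=
  head [::] [seq e.2 | e <- ds & e.1 == (q, n)].

Definition t_node (p : node) : tree :=
  match p with
  | NOrd p n => Nd (Nd b0 (t_name p)) (t_nat n)
  | NSk q n => Nd (Nd b1 (t_name q)) (t_nat n)
  end.

Definition head_nodes ds (p : node) : seq node :=
  if p is NSk q n then p :: [seq NOrd d n | d <- domain ds q n] else [:: p].

Definition tlevel (lv nd : tree) : nat := oapp tlen 0 (tlook nd lv).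

Definition t_ghead : option gatom -> tree := t_opt t_gatom.

Definition t_body (b : seq gatom * seq gatom) : tree :=
  Nd (t_seq t_gatom b.1) (t_seq t_gatom b.2).

Definition t_grule (r : grule) : tree :=
  Nd (t_ghead (g_head r)) (t_body (g_pos r, g_neg r)).

Definition tboth (t u : tree) : tree :=
  match t, u with Nd _ x, Nd _ y => Nd Lf (Nd x y) | _, _ => Lf end.

Definition taddlit (sg : sign) (t u : tree) : tree :=
  match t, u with
  | Nd _ g, Nd _ (Nd ps ns) =>
      Nd Lf (if sg is Pos then Nd (Nd g ps) ns else Nd ps (Nd g ns))
  | _, _ => Lf
  end.

Definition thead th (h : option satom) : tree :=
  if h is Some a then
    if eval_atom (sub_atom th a) is Some g then Nd Lf (Nd Lf (t_gatom g)) else Lf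
  else Nd Lf Lf.

Definition tblocked (ps ns m : tree) : Prop :=
  (exists2 x, tmem x ps & ~~ tmem x m) \/ (exists2 x, tmem x ns & tmem x m).

Definition tall (l m : tree) : Prop := forall x, tmem x l -> tmem x m.
Definition tnone (l m : tree) : Prop := forall x, tmem x l -> ~~ tmem x m.

Fixpoint tderiv (p m f : tree) : Prop :=
  if m is Nd a m' then
    (exists ps ns, [/\ tmem (Nd (Nd Lf a) (Nd ps ns)) p, tall ps m' & tnone ns f])
    /\ tderiv p m' f
  else True.

Definition tclosed (p f : tree) : Prop :=
  forall a ps ns, tmem (Nd (Nd Lf a) (Nd ps ns)) p -> tmem a f \/ tblocked ps ns f.

Definition tconsok (p f : tree) : Prop :=
  forall ps ns, tmem (Nd Lf (Nd ps ns)) p -> tblocked ps ns f.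

Definition texample (e : seq gatom) (gp : seq grule) (ok : bool) : Prop :=
  exists m, let p := t_seq t_grule (add_facts e gp) in
    [/\ tderiv p m m, tclosed p m &
      if ok then tconsok p m
      else exists ps ns, [/\ tmem (Nd Lf (Nd ps ns)) p, tall ps m & tnone ns m]].

Notation atom_okd ds := (atom_ok (domain ds)).

(** Meanings come in two main forms. For arithmetic on integers the goal itself guarantees that its
    arguments are numerals, which is what the side goals [ISPOS] and [ISZ] are for. Goals about
    syntax mostly presuppose encoded arguments, so that clause instances on ill-formed trees hold
    vacuously. *)
Definition S_MAIN w := exists I,
  [/\ w = tcat (enc_instance I) Lf, stratified I & exists th, satisfies I th].
Definition S_PARSE g v x w := forall G, g = t_gram G ->
  exists2 u, parses G x u & v = tcat u w.
Definition S_NEQ (a b : tree) := a <> b.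
Definition S_LOOK k t v := tlook k t = Some v.
Definition S_MEM x l := is_true (tmem x l).
Definition S_NMEM x l := is_true (~~ tmem x l).
Definition S_ISPOS x := exists p, x = t_pos p.
Definition S_ISZ x := exists z, x = t_Z z.
Definition S_SUCC x y := exists p, x = t_pos p /\ y = t_pos (Pos.succ p).
Definition S_PADD x y z := exists p q, [/\ x = t_pos p, y = t_pos q & z = t_pos (p + q)].
Definition S_PMUL x y z := exists p q, [/\ x = t_pos p, y = t_pos q & z = t_pos (p * q)].
Definition S_ZADD x y z := exists a b, [/\ x = t_Z a, y = t_Z b & z = t_Z (a + b)].
Definition S_ZMUL x y z := exists a b, [/\ x = t_Z a, y = t_Z b & z = t_Z (a * b)].
Definition S_QUOT x y z := exists a b,
  [/\ b <> 0%Z, x = t_Z a, y = t_Z b & z = t_Z (Z.quot a b)].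
Definition S_ZCMP x y c := exists a b,
  [/\ x = t_Z a, y = t_Z b & c = t_comparison (Z.compare a b)].
Definition S_NCMP x y c := forall s t,
  x = t_name s -> y = t_name t -> c = t_comparison (name_compare s t).
Definition S_GCMP x y c := forall s t,
  x = t_gterm s -> y = t_gterm t -> c = t_comparison (gterm_compare s t).
Definition S_APPLY o x y v := forall s t,
  x = t_opt t_gterm s -> y = t_opt t_gterm t ->
  v = t_opt t_gterm (arith_opt (dec_arith o) s t).
Definition S_FILL th key slot v :=
  slot = Nd b0 v \/ exists q, slot = Nd b1 q /\ tlook (Nd key q) th = Some v.
Definition S_TERM th x v := forall t, x = t_term t ->
  v = t_opt t_gterm (eval (sub_term (subst_of th) t)).
Definition S_BOTH x y v := v = tboth x y.
Definition S_ARGS th x v := forall ts, x = t_seq t_term ts ->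
  v = t_opt (t_seq t_gterm) (eval_args (map (sub_term (subst_of th)) ts)).
Definition S_LEN x n := n = t_nat (tlen x).
Definition S_PRED d th s n v := forall ds s' n',
  d = t_seq t_dom ds -> s = t_slot t_name s' -> n = t_nat n' ->
  (forall q, s' = Sk q -> th_pred (subst_of th) q n' \in domain ds q n') /\
  v = t_name (fill (fun q => th_pred (subst_of th) q n') s').
Definition S_ATOM d th x v := forall ds a, d = t_seq t_dom ds -> x = t_atom a ->
  atom_okd ds (subst_of th) a /\
  v = t_opt t_gatom (eval_atom (sub_atom (subst_of th) a)).
Definition S_CSEM c r b := forall r', r = t_comparison r' ->
  b = bit (cmp_sem (dec_cmp c) r').
Definition S_NONTOP c := dec_cmp c <> CTop.
Definition S_CMP c x y b := forall s t,
  x = t_opt t_gterm s -> y = t_opt t_gterm t -> b = bit (cmp_opt (dec_cmp c) s t).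
Definition S_GUARD (b x y : tree) := y = if b == b1 then x else Lf.
Definition S_ADDLIT sg x y v := v = taddlit (dec_sign sg) x y.
Definition S_BODY d th x v := forall ds b, d = t_seq t_dom ds -> x = t_seq t_literal b ->
  (forall s a, List.In (LAtom s a) b -> atom_okd ds (subst_of th) a) /\
  v = t_opt t_body (eval_body (map (sub_literal (subst_of th)) b)).
Definition S_HEAD d th x v := forall ds h, d = t_seq t_dom ds -> x = t_rhead h ->
  (forall a, h = Some a -> atom_okd ds (subst_of th) a) /\ v = thead (subst_of th) h.
Definition sub_rule th (r : srule) :=
  Rule (omap (sub_atom th) (r_head r)) (map (sub_literal th) (r_body r)).
Definition S_RULE d th x v := forall ds r, d = t_seq t_dom ds -> x = t_rule r ->
  (forall a, in_rule a r -> atom_okd ds (subst_of th) a) /\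
  v = t_opt t_grule (eval_rule (sub_rule (subst_of th) r)).
Definition S_PROG d th x v := forall ds p, d = t_seq t_dom ds -> x = t_seq t_rule p ->
  (forall r a, List.In r p -> in_rule a r -> atom_okd ds (subst_of th) a) /\
  v = t_seq t_grule (evaluate (sub_program (subst_of th) p)).
Definition S_FACTS x y v := forall e gp, x = t_seq t_gatom e -> y = t_seq t_grule gp ->
  v = t_seq t_grule (add_facts e gp).
Definition S_POSEX x g := forall es gp,
  x = t_seq (t_seq t_gatom) es -> g = t_seq t_grule gp ->
  forall e, List.In e es -> texample e gp true.
Definition S_NEGEX x g := forall es gp,
  x = t_seq (t_seq t_gatom) es -> g = t_seq t_grule gp ->
  forall e, List.In e es -> texample e gp false.
Definition S_LE a b := is_true (tlen a <= tlen b).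
Definition S_ORDS x n v := forall ds n', x = t_seq t_name ds -> n = t_nat n' ->
  v = t_seq t_node [seq NOrd d n' | d <- ds].
Definition S_HNODES d x v := forall ds nd, d = t_seq t_dom ds -> x = t_node nd ->
  v = t_seq t_node (head_nodes ds nd).
Definition S_ALLGE lv hs v := forall h, tmem h hs -> tlen v <= tlevel lv h.
Definition S_SBODY lv hs x := forall b, x = t_seq t_literal b ->
  forall s a, List.In (LAtom s a) b -> forall h, tmem h hs ->
  tlevel lv (t_node (atom_node a)) + (if s is Fix Pos then 0 else 1) <= tlevel lv h.
Definition S_SRULES d lv x := forall ds p, d = t_seq t_dom ds -> x = t_seq t_rule p ->
  forall r c, List.In r p -> r_head r = Some c ->
  forall s a, List.In (LAtom s a) (r_body r) ->
  forall h, List.In h (head_nodes ds (atom_node c)) ->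
  tlevel lv (t_node (atom_node a)) + (if s is Fix Pos then 0 else 1)
    <= tlevel lv (t_node h).
Definition S_ALLLE lv os u := forall o, tmem o os -> tlevel lv o <= tlen u.
Definition S_SDOMS all lv x := forall ds es, all = t_seq t_dom ds -> x = t_seq t_dom es ->
  forall e, List.In e es -> forall d, d \in domain ds e.1.1 e.1.2 ->
  tlevel lv (t_node (NOrd d e.1.2)) <= tlevel lv (t_node (NSk e.1.1 e.1.2)).

Definition ar1 (S : tree -> Prop) ts := if ts is [:: a] then S a else True.
Definition ar2 (S : tree -> tree -> Prop) ts := if ts is [:: a; b] then S a b else True.
Definition ar3 (S : tree -> tree -> tree -> Prop) ts :=
  if ts is [:: a; b; c] then S a b c else True.
Definition ar4 (S : tree -> tree -> tree -> tree -> Prop) ts :=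
  if ts is [:: a; b; c; d] then S a b c d else True.
Definition ar5 (S : tree -> tree -> tree -> tree -> tree -> Prop) ts :=
  if ts is [:: a; b; c; d; e] then S a b c d e else True.

(** Ordered by predicate number, in step with [groups]. *)
Definition sems : seq (seq tree -> Prop) := [::
  ar1 S_MAIN; ar4 S_PARSE; ar2 S_NEQ; ar3 S_LOOK; ar2 S_MEM; ar2 S_NMEM; ar1 S_ISPOS;
  ar1 S_ISZ; ar2 S_SUCC; ar3 S_PADD; ar3 S_PMUL; ar3 S_ZADD; ar3 S_ZMUL; ar3 S_QUOT;
  ar3 S_ZCMP; ar3 S_NCMP; ar3 S_GCMP; ar4 S_APPLY; ar4 S_FILL; ar3 S_TERM; ar3 S_BOTH;
  ar3 S_ARGS; ar2 S_LEN; ar5 S_PRED; ar4 S_ATOM; ar3 S_CSEM; ar1 S_NONTOP; ar4 S_CMP;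
  ar3 S_GUARD; ar4 S_ADDLIT; ar4 S_BODY; ar4 S_HEAD; ar4 S_RULE; ar4 S_PROG; ar3 S_FACTS;
  ar2 tall; ar2 tnone; ar3 tblocked; ar3 tderiv; ar2 tclosed; ar2 tconsok;
  ar2 S_POSEX; ar2 S_NEGEX; ar2 S_LE; ar3 S_ORDS; ar3 S_HNODES; ar3 S_ALLGE;
  ar3 S_SBODY; ar3 S_SRULES; ar3 S_ALLLE; ar3 S_SDOMS].

Definition sem (q : nat) : seq tree -> Prop := nth (fun=> True) sems q.

Definition meaning (t : tree) : Prop := forall q ts, t = goal q ts -> sem q ts.

Definition clause_valid (q : nat) (r : seq pat * seq (nat * seq pat)) : Prop :=
  forall s, foldr (fun b (Q : Prop) => sem b.1 (map (inst s) b.2) -> Q)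
                  (sem q (map (inst s) r.1)) r.2.

Definition group_valid (q : nat) (g : rules) : Prop :=
  forall r, List.In r g -> clause_valid q r.

Lemma meaning_closed :
  (forall q, q < size groups -> group_valid q (nth [::] groups q)) ->
  closed_under horn meaning.
Proof.
move=> valid c s /mk_clausesP[q [r [q_lt r_in ->]]] body q' ts.
rewrite inst_goal => /goal_inj[<- <-]; rewrite add0n in body *.
have := valid q q_lt r r_in s.
have {}body b : List.In b r.2 -> sem b.1 (map (inst s) b.2).
  move=> b_in; apply: (body (goal_pat b.1 b.2)); last exact: inst_goal.
  exact: (List.in_map (fun b => goal_pat b.1 b.2)).
elim: r.2 body => //= b bs IH body /(_ (body b (or_introl erefl))).
by apply: IH => b' b'_in; apply: body; right.
Qed.

Ltac clauses :=
  let r := fresh "r" in let r_in := fresh "r_in" in let s := fresh "s" in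
  intros r r_in; simpl in r_in;
  repeat (destruct r_in as [<-|r_in]; [|]); try (by case: r_in);
  intro s; rewrite /= /sem /= ?inst_const;
  move: (s 0) (s 1) (s 2) (s 3) (s 4) (s 5) (s 6) (s 7) (s 8) (s 9) (s 10) (s 11);
  clear s; move=> x0 x1 x2 x3 x4 x5 x6 x7 x8 x9 x10 x11.

Lemma valid_parse : group_valid PARSE c_parse.
Proof.
clauses.
- case=> // _; exists [::] => //; constructor.
- move=> IH [] // g h [gE hE]; subst x0 x1; have [u pu ->] := IH _ erefl.
  by exists (false :: u) => //; apply: (@parses_alt _ _ false).
- move=> IH [] // g h [gE hE]; subst x0 x1; have [u pu ->] := IH _ erefl.
  by exists (true :: u) => //; apply: (@parses_alt _ _ true).
- move=> IH1 IH2 [] // g h [gE hE]; subst x0 x1; have [u pu ->] := IH1 _ erefl.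
  have [w pw ->] := IH2 _ erefl; exists (u ++ w); first by constructor.
  by rewrite /tcat foldr_cat.
- by case=> // g _; exists [:: false] => //; constructor.
- move=> IH1 IH2 [] // g [gE]; subst x0; have [u pu ->] := IH1 _ erefl.
  have [w pw ->] := IH2 (GSeq g) erefl; exists (true :: u ++ w); first by constructor.
  by rewrite /tcat /= foldr_cat.
- by move=> IH [] // [] // _; have [u pu ->] := IH (prod_of true) erefl; exists u => //; constructor.
- by move=> IH [] // [] // _; have [u pu ->] := IH (prod_of false) erefl; exists u => //; constructor.
Qed.

(** * Soundness of the clauses *)

Section Soundness.

Local Arguments t_arith : simpl never.
Local Arguments t_cmp : simpl never.
Local Arguments t_sign : simpl never.
Local Arguments t_comparison : simpl never.

Lemma valid_neq : group_valid NEQ c_neq.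
Proof. by clauses; rewrite /S_NEQ // => h [] // => [/h|_ /h]. Qed.

Lemma valid_look : group_valid LOOK c_look.
Proof.
clauses; rewrite /S_LOOK /S_NEQ /=; first by rewrite eqxx.
by move=> /eqP/negPf ->.
Qed.

Lemma valid_mem : group_valid MEM c_mem.
Proof. by clauses; rewrite /S_MEM /= ?eqxx // => ->; rewrite orbT. Qed.

Lemma valid_nmem : group_valid NMEM c_nmem.
Proof. by clauses; rewrite /S_NMEM /S_NEQ //= => /eqP/negPf ->. Qed.

Lemma valid_ispos : group_valid ISPOS c_ispos.
Proof.
by clauses; [exists xH | move=> [p ->]; exists (xO p) | move=> [p ->]; exists (xI p)].
Qed.

Lemma valid_isz : group_valid ISZ c_isz.
Proof.
by clauses; [exists Z0 | move=> [p ->]; exists (Zpos p) | move=> [p ->]; exists (Zneg p)].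
Qed.

Lemma valid_succ : group_valid SUCC c_succ.
Proof.
clauses; first by exists xH.
- by move=> [p ->]; exists (xO p).
- by move=> [p [-> ->]]; exists (xI p).
Qed.

Lemma valid_padd : group_valid PADD c_padd.
Proof.
clauses.
- by move=> [p [-> ->]]; exists xH, p; rewrite Pos.add_1_l.
- by move=> [p ->]; exists (xO p), xH.
- by move=> [p [-> ->]]; exists (xI p), xH.
- by move=> [p [q [-> -> ->]]]; exists (xO p), (xO q).
- by move=> [p [q [-> -> ->]]]; exists (xO p), (xI q).
- by move=> [p [q [-> -> ->]]]; exists (xI p), (xO q).
- move=> [p [q [-> -> ->]]] [r [/t_pos_inj<- ->]]; exists (xI p), (xI q).
  by rewrite /= Pos.add_carry_spec.
Qed.

Lemma valid_pmul : group_valid PMUL c_pmul.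
Proof.
clauses.
- by move=> [p ->]; exists xH, p.
- by move=> [p [q [-> -> ->]]]; exists (xO p), q.
- move=> [p [q [-> -> ->]]] [q' [r [/t_pos_inj<- rE ->]]]; exists (xI p), q.
  by have /t_pos_inj<- : t_pos (xO (p * q)) = t_pos r by [].
Qed.

Lemma valid_zadd : group_valid ZADD c_zadd.
Proof.
clauses.
- by move=> [z ->]; exists Z0, z.
- by move=> [z ->]; exists z, Z0; rewrite Z.add_0_r.
- by move=> [p [q [-> -> ->]]]; exists (Zpos p), (Zpos q).
- by move=> [p [q [-> -> ->]]]; exists (Zneg p), (Zneg q).
- by move=> [p ->]; exists (Zpos p), (Zneg p); rewrite Z.add_opp_diag_r.
- move=> [p [q [-> -> ->]]]; exists (Zpos (p + q)), (Zneg p); split=> //.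
  by rewrite (_ : (_ + _)%Z = Zpos q) //; lia.
- move=> [p [q [-> -> ->]]]; exists (Zpos p), (Zneg (p + q)); split=> //.
  by rewrite (_ : (_ + _)%Z = Zneg q) //; lia.
- move=> [a [b [aE bE ->]]]; exists b, a; split=> //.
  by rewrite Z.add_comm.
Qed.

Lemma valid_zmul : group_valid ZMUL c_zmul.
Proof.
clauses.
- by move=> [z ->]; exists Z0, z.
- by move=> [z ->]; exists z, Z0; rewrite Z.mul_0_r.
- by move=> [p [q [-> -> ->]]]; exists (Zpos p), (Zpos q).
- by move=> [p [q [-> -> ->]]]; exists (Zpos p), (Zneg q).
- by move=> [p [q [-> -> ->]]]; exists (Zneg p), (Zpos q).
- by move=> [p [q [-> -> ->]]]; exists (Zneg p), (Zneg q).
Qed.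

Lemma t_Z_nonzero x y b : Nd x (Nd b1 y) = t_Z b -> b <> 0%Z.
Proof. by case: b. Qed.

Lemma t_Z_sign x y y' b b' : Nd x (Nd b1 y) = t_Z b -> Nd x (Nd b1 y') = t_Z b' ->
  exists p p', [/\ y = t_pos p, y' = t_pos p' &
    (b = Zpos p /\ b' = Zpos p') \/ (b = Zneg p /\ b' = Zneg p')].
Proof.
case: b => [|p|p] //= [-> ->]; case: b' => [|p'|p'] //= [] // ->; exists p, p'.
  by split=> //; left.
by split=> //; right.
Qed.

(** Changing signs reduces all cases to the uniqueness of division of a nonnegative by a positive
    number. *)
Lemma quot_eq a b q r : a = (b * q + r)%Z -> b <> 0%Z ->
  ((0 <= r /\ 0 <= a) \/ (r <= 0 /\ a <= 0))%Z -> (Z.abs r < Z.abs b)%Z ->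
  Z.quot a b = q.
Proof.
have pos a' b' q' r' : (0 <= a' -> 0 <= r' < b' -> a' = b' * q' + r' ->
    Z.quot a' b' = q')%Z by move=> h1 h2 h3; symmetry; exact: Z.quot_unique h3.
move=> aE b0 sgn rb; have [b_pos|b_neg] : (0 < b \/ b < 0)%Z by lia.
- case: sgn => sgn; first by apply: (pos a b q r); lia.
  by rewrite -[a]Z.opp_involutive Z.quot_opp_l // (pos (- a) b (- q) (- r))%Z; lia.
- case: sgn => sgn.
    by rewrite -[b]Z.opp_involutive Z.quot_opp_r ?(pos a (- b) (- q) r)%Z; lia.
  rewrite -[b]Z.opp_involutive -[a]Z.opp_involutive Z.quot_opp_opp; last lia.
  by rewrite (pos (- a) (- b) q (- r))%Z; lia.
Qed.

Lemma valid_quot : group_valid QUOT c_quot.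
Proof.
clauses.
- move=> [b [q [bE -> ->]]]; exists (b * q)%Z, b.
  have b0 := t_Z_nonzero bE; split=> //.
  by rewrite Z.mul_comm Z.quot_mul.
- move=> [b [q [bE -> ->]]] [m [r [/t_Z_inj mE rE aE]]] [p [d [x6E _ pE]]]; subst x6.
  exists (m + r)%Z, b; have b0 := t_Z_nonzero bE; split=> //; subst m; congr t_Z.
  have [p1 [p2 [/t_pos_inj pp1 _ sgn]]] := t_Z_sign rE aE; subst p1.
  (* By the goal [PADD] the absolute values of the remainder and of the divisor differ by the
     positive [d], so the remainder is small enough. *)
  have bE' : b = Zpos (p + d) \/ b = Zneg (p + d).
    case: b {aE sgn} bE b0 => // p' [_ p'E] _; [left | right];
      by congr (_ _); apply: t_pos_inj; rewrite -pE p'E.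
  symmetry; apply: (quot_eq erefl) => //; last by case: sgn bE' => -[-> _] [] ->; lia.
  by case: sgn => -[-> ->]; [left | right].
Qed.

Lemma valid_zcmp : group_valid ZCMP c_zcmp.
Proof.
clauses.
- by move=> [z ->]; exists z, z; rewrite Z.compare_refl.
- move=> [a [b [-> bE ->]]]; exists a, (a + b)%Z; split=> //.
  case: b bE => // p _; rewrite (_ : (_ ?= _)%Z = Lt) //.
  by apply/Z.compare_lt_iff; lia.
- move=> [a [b [-> bE ->]]]; exists (a + b)%Z, a; split=> //.
  case: b bE => // p _; rewrite (_ : (_ ?= _)%Z = Gt) //.
  by apply/Z.compare_gt_iff; lia.
Qed.

Lemma bit_inj : injective bit. Proof. by case=> [] []. Qed.

Lemma valid_ncmp : group_valid NCMP c_ncmp.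
Proof.
clauses; rewrite /S_NCMP /t_name /t_seq.
- by move=> [|b s] [|c t].
- by move=> [|b s] [|c t].
- by move=> [|b s] [|c t].
- move=> IH [|b s] [|c t] //= [x0E x1E] [x0E' x2E]; have -> : b = c by move: x0E'; rewrite x0E => -[/bit_inj].
  by rewrite eqxx; exact: IH.
- by move=> [|[] s] [|[] t].
- by move=> [|[] s] [|[] t].
Qed.

Lemma valid_gcmp : group_valid GCMP c_gcmp.
Proof.
clauses; rewrite /S_GCMP.
- by move=> [a [b [-> -> ->]]] [z|s] [z'|s'] //= [/t_Z_inj-> ] [/t_Z_inj->].
- by move=> [z|s] [z'|s'].
- by move=> [z|s] [z'|s'].
- by move=> IH [z|s] [z'|s'] //= [xE] [yE]; exact: IH.
Qed.

Lemma valid_apply : group_valid APPLY c_apply.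
Proof.
clauses; rewrite /S_APPLY.
- move=> [a [b [-> -> ->]]] [[z|s]|] [[z'|s']|] //= [/t_Z_inj->] [/t_Z_inj->].
  by rewrite ?t_arithK.
- move=> [a [b [-> -> ->]]] [[z|s]|] [[z'|s']|] //= [/t_Z_inj<-] [/t_Z_inj<-].
  by rewrite ?t_arithK /= Z.add_simpl_r.
- move=> [a [b [-> -> ->]]] [[z|s]|] [[z'|s']|] //= [/t_Z_inj->] [/t_Z_inj->].
  by rewrite ?t_arithK.
- move=> [a [b [nz -> -> ->]]] [[z|s]|] [[z'|s']|] //= [/t_Z_inj<-] [/t_Z_inj<-].
  by rewrite ?t_arithK /=; move/Z.eqb_neq: nz => ->.
- by move=> [[z|s]|] [[[]|s']|] //= _ _; rewrite ?t_arithK.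
- move=> [a [b [-> bE ->]]] [[z|s]|] [[z'|s']|] //= [/t_Z_inj<-] [/t_Z_inj<-].
  rewrite ?t_arithK /= bE (_ : Z.abs _ = b) //.
  by case: b bE => [|p|p] // _; lia.
- move=> [a [b [-> bE ->]]] [[z|s]|] [[z'|s']|] //= [/t_Z_inj<-] [/t_Z_inj<-].
  rewrite ?t_arithK /= bE (_ : Z.abs _ = b) //.
  by case: b bE => [|p|p] // _; lia.
- by move=> [[z|s]|] [[z'|s']|].
- by move=> [[z|s]|] [[z'|s']|].
- by move=> [[z|s]|] [[z'|s']|].
- by move=> [[z|s]|] [[z'|s']|].
Qed.

Lemma valid_fill : group_valid FILL c_fill.
Proof. by clauses; [left | right; exists x2]. Qed.

Lemma fill_arith th o v : S_FILL th k_arith (t_slot t_arith o) v ->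
  dec_arith v = fill (th_arith (subst_of th)) o.
Proof.
case: o => [o|q] [] //=.
- by case=> <-; rewrite t_arithK.
- by case=> x [].
- by case=> q' [[<-]] h; rewrite /= /tget h.
Qed.

Lemma fill_sign th s v : S_FILL th k_neg (t_slot t_sign s) v ->
  dec_sign v = fill (th_neg (subst_of th)) s.
Proof.
case: s => [s|q] [] //=.
- by case=> <-; rewrite t_signK.
- by case=> x [].
- by case=> q' [[<-]] h; rewrite /= /tget h.
Qed.

Lemma fill_cmp th s v : S_FILL th k_cmp (t_slot t_cmp s) v ->
  dec_cmp v = fill (th_cmp (subst_of th)) s.
Proof.
case: s => [s|q] [] //=.
- by case=> <-; rewrite t_cmpK.
- by case=> x [].
- by case=> q' [[<-]] h; rewrite /= /tget h.
Qed.

Lemma valid_term : group_valid TERM c_term.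
Proof.
clauses; rewrite /S_TERM.
- by move=> [z|s|o t1 t2] //= [->].
- by move=> [z|s|o t1 t2] //= [->].
- move=> oE t1E t2E vE [z|s|o t1 t2] //= [oE' t1E' t2E']; subst x1 x2 x3.
  by rewrite (vE _ _ (t1E _ erefl) (t2E _ erefl)) (fill_arith oE).
Qed.

Lemma valid_both : group_valid BOTH c_both.
Proof. by clauses. Qed.

Lemma valid_args : group_valid ARGS c_args.
Proof.
clauses; rewrite /S_ARGS /t_seq; first by move=> [].
move=> tE tsE -> [|t ts] //= [t' ts']; subst x1 x2.
rewrite (tE _ erefl) (tsE _ erefl) /=.
by case: (eval _) => [v|] //=; case: (eval_args _).
Qed.

Lemma valid_len : group_valid LEN c_len.
Proof. by clauses; rewrite /S_LEN // => ->. Qed.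

Lemma tlen_seq T (f : T -> tree) s : tlen (t_seq f s) = size s.
Proof. by rewrite /t_seq; elim: s => //= x s ->. Qed.

Lemma t_key_inj q n q' n' :
  Nd (t_name q) (t_nat n) = Nd (t_name q') (t_nat n') -> q = q' /\ n = n'.
Proof. by case=> /t_name_inj-> /t_nat_inj->. Qed.

Lemma tlook_doms ds q n v :
  tlook (Nd (t_name q) (t_nat n)) (t_seq t_dom ds) = Some v ->
  v = t_seq t_name (domain ds q n).
Proof.
rewrite /t_seq /domain; elim: ds => //= -[[q' n'] d] ds IH /=.
case: eqP => [/t_key_inj[-> ->] [<-]|ne]; first by rewrite eqxx.
by case: eqP => // -[qq nn]; case: ne; rewrite qq nn.
Qed.

Lemma tmem_seqP T (f : T -> tree) x s :
  reflect (exists2 y, List.In y s & x = f y) (tmem x (t_seq f s)).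
Proof.
rewrite /t_seq; elim: s => [|y s IH] /=; first by constructor=> -[].
apply: (iffP orP) => [[/eqP<-|/IH[z z_in ->]]|[z [->|z_in] xE]].
- by exists y; [left|].
- by exists z; [right|].
- by left; rewrite xE.
- by right; apply/IH; exists z.
Qed.

Lemma valid_pred : group_valid PRED c_pred.
Proof.
clauses; rewrite /S_PRED.
- by move=> ds [p|q] n //= _ [->] _.
- move=> look_th look_d mem_v ds [p|q] n //= dE [qE] nE; subst x0 x2 x3.
  have vE : tget (Nd (k_pred (t_nat n)) (t_name q)) x1 = x4 by rewrite /tget look_th.
  move: mem_v; rewrite (tlook_doms look_d) => /tmem_seqP[d /InP d_in vE'].
  by rewrite vE vE' t_nameK; split=> // q' [<-]; rewrite vE vE' t_nameK.
Qed.

Lemma valid_atom : group_valid ATOM c_atom.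
Proof.
clauses; rewrite /S_ATOM => nE predE argsE -> ds [p ts] dE [pE tsE]; subst x0 x2 x3.
have [|ok vE] := predE _ _ (size ts) erefl erefl; first by rewrite nE tlen_seq.
split; first by move=> q qE; exact: ok.
rewrite vE (argsE _ erefl) /eval_atom /=.
by case: (eval_args _).
Qed.

Lemma valid_csem : group_valid CSEM c_csem.
Proof. by clauses; rewrite /S_CSEM => -[]. Qed.

Lemma valid_nontop : group_valid NONTOP c_nontop.
Proof. by clauses; rewrite /S_NONTOP ?t_cmpK. Qed.

Lemma valid_cmp : group_valid CMP c_cmp.
Proof.
clauses; rewrite /S_CMP.
- by move=> s t _ _; rewrite ?t_cmpK.
- by move=> nt [s|] // t _ _; move: nt; rewrite /S_NONTOP; case: dec_cmp.
- by move=> nt s [t|] // _ _; move: nt; rewrite /S_NONTOP; case: dec_cmp; case: s.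
- move=> gE cE [s|] // [t|] //= [x1E] [x2E].
  by rewrite (cE _ (gE _ _ x1E x2E)); case: dec_cmp.
Qed.

Lemma valid_guard : group_valid GUARD c_guard.
Proof. by clauses. Qed.

Lemma valid_addlit : group_valid ADDLIT c_addlit.
Proof. by clauses; rewrite /S_ADDLIT ?t_signK. Qed.

Lemma cmp_holds_opt c s t : cmp_holds c s t = cmp_opt c (eval s) (eval t).
Proof. by []. Qed.

Lemma valid_body : group_valid BODY c_body.
Proof.
clauses; rewrite /S_BODY.
- by move=> ds [|l b] //.
- move=> sgE atomE bodyE -> ds [|[sg a|c t1 t2] b] //= dE [x2E x3E x4E]; subst x0 x2 x3 x4.
  have [okb ->] := bodyE _ _ erefl erefl; have [oka ->] := atomE _ _ erefl erefl.
  rewrite (fill_sign sgE); split=> [s' a' [[_ <-] //|/okb //]|].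
  case: (eval_atom _) => [g|] //=; case: (eval_body _) => [[ps ns]|] //=.
  by case: (fill _ _).
- move=> cE t1E t2E cmpE bodyE -> ds [|[sg a|c t1 t2] b] //= dE [x2E x3E x4E x5E].
  subst x0 x2 x3 x4 x5; have [okb ->] := bodyE _ _ erefl erefl.
  rewrite (cmpE _ _ (t1E _ erefl) (t2E _ erefl)) (fill_cmp cE) cmp_holds_opt.
  split=> [s' a' [//|/okb //]|].
  by case: cmp_opt.
Qed.

Lemma valid_head : group_valid HEAD c_head.
Proof.
clauses; rewrite /S_HEAD.
- by move=> ds [h|].
- move=> aE ds [h|] // dE [x2E]; subst x0 x2; have [ok vE] := aE _ _ erefl erefl.
  by split=> [a [<-] //|]; move: vE => /=; case: eval_atom.
- move=> aE ds [h|] // dE [x2E]; subst x0 x2; have [ok vE] := aE _ _ erefl erefl.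
  by split=> [a [<-] //|]; move: vE => /=; case: eval_atom => // g [->].
Qed.

Lemma valid_rule : group_valid RULE c_rule.
Proof.
clauses; rewrite /S_RULE => hE bE -> ds [h b] dE [x2E x3E]; subst x0 x2 x3.
have [okh ->] := hE _ _ erefl erefl; have [okb ->] := bE _ _ erefl erefl.
split=> [a [/= aE|[s l_in]]|]; [exact: okh | exact: okb l_in |].
rewrite /eval_rule /=; case: (eval_body _) => [[ps ns]|] //=.
  by case: h {hE okh} => [a|] //=; case: eval_atom.
by case: h {hE okh} => [a|] //=; case: eval_atom.
Qed.

Lemma valid_prog : group_valid PROG c_prog.
Proof.
clauses; rewrite /S_PROG.
- by move=> ds [|r p].
- move=> rE pE ds [|r p] // dE [x2E x3E]; subst x0 x2 x3.
  have [okr vE] := rE _ _ erefl erefl; have [okp ->] := pE _ _ erefl erefl.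
  split=> [r' a [<-|r'_in]|]; [exact: okr | exact: okp |].
  by rewrite /evaluate /= -/(sub_rule _ _); case: eval_rule vE.
- move=> rE pE ds [|r p] // dE [x2E x3E]; subst x0 x2 x3.
  have [okr vE] := rE _ _ erefl erefl; have [okp ->] := pE _ _ erefl erefl.
  split=> [r' a [<-|r'_in]|]; [exact: okr | exact: okp |].
  by rewrite /evaluate /= -/(sub_rule _ _); case: eval_rule vE => // r' [->].
Qed.

Lemma valid_facts : group_valid FACTS c_facts.
Proof.
clauses; rewrite /S_FACTS; first by move=> [].
by move=> IH [|a e] gp // [x0E x1E] x2E; subst x0; rewrite (IH e gp x1E x2E).
Qed.

Lemma valid_allin : group_valid ALLIN c_allin.
Proof.
clauses; rewrite /tall // => x0m allm x /= /orP[/eqP<-|/allm] //.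
Qed.

Lemma valid_nonein : group_valid NONEIN c_nonein.
Proof.
clauses; rewrite /tnone // => x0m allm x /= /orP[/eqP<-|/allm] //.
Qed.

Lemma valid_block : group_valid BLOCK c_block.
Proof.
clauses; rewrite /tblocked.
- by move=> x0m; left; exists x0; rewrite //= eqxx.
- by case=> [[x x_in xm]|[x x_in xm]]; [left | right]; exists x; rewrite //= x_in orbT.
- by move=> x1m; right; exists x1; rewrite //= eqxx.
- by case=> [[x x_in xm]|[x x_in xm]]; [left | right]; exists x; rewrite //= x_in orbT.
Qed.

Lemma valid_deriv : group_valid DERIV c_deriv.
Proof. by clauses => // m_in ps_in ns_in der; split=> //; exists x4, x5. Qed.

Lemma valid_closed : group_valid CLOSED c_closed.
Proof.
clauses; rewrite /tclosed //.
- by move=> x0m IH a ps ns /= /orP[/eqP[<- _]|/IH //]; left.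
- by move=> bl IH a ps ns /= /orP[/eqP[_ <- <-]|/IH //]; right.
Qed.

Lemma valid_consok : group_valid CONSOK c_consok.
Proof.
clauses; rewrite /tconsok //.
by move=> bl IH ps ns /= /orP[/eqP[_ <- <-]|/IH //].
Qed.

Lemma valid_posex : group_valid POSEX c_posex.
Proof.
clauses; rewrite /S_POSEX; first by move=> [].
move=> fE der cl cons IH [|e es] gp // [x0E x1E] x2E e' [<-|e'_in]; last exact: IH e'_in.
by exists x4; rewrite /= -(fE _ _ x0E x2E).
Qed.

Lemma valid_negex : group_valid NEGEX c_negex.
Proof.
clauses; rewrite /S_NEGEX; first by move=> [].
move=> fE der cl m_in ps_in ns_in IH [|e es] gp // [x0E x1E] x2E e' [<-|e'_in];
  last exact: IH e'_in.
by exists x4; rewrite /= -(fE _ _ x0E x2E); split=> //; exists x5, x6.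
Qed.

Lemma valid_le : group_valid LE c_le.
Proof. by clauses. Qed.

Lemma valid_ords : group_valid ORDS c_ords.
Proof.
clauses; rewrite /S_ORDS; first by move=> [].
by move=> IH [|d ds] n // [x0E x1E] x2E; rewrite (IH ds n x1E x2E) x0E x2E.
Qed.

Lemma valid_hnodes : group_valid HNODES c_hnodes.
Proof.
clauses; rewrite /S_HNODES.
- by move=> ds [p n|q n] // _ [-> ->].
- move=> look oE ds [p n|q n] // dE [x1E x2E]; subst x0 x1 x2.
  by rewrite (oE _ _ (tlook_doms look) erefl).
Qed.

Lemma valid_allge : group_valid ALLGE c_allge.
Proof.
clauses; rewrite /S_ALLGE // => look le IH h /= /orP[/eqP<-|/IH //].
by rewrite /tlevel look.
Qed.

Lemma valid_sbody : group_valid SBODY c_sbody.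
Proof.
have atom_nodeE a : t_node (atom_node a) =
    Nd (t_slot t_name (a_pred a)) (t_nat (size (a_args a))).
  by rewrite /atom_node; case: (a_pred a).
clauses; rewrite /S_SBODY.
- by move=> [].
- move=> IH [|[sg a|c t1 t2] b] // [_ x3E] s a /= [//|l_in]; exact: IH x3E _ _ l_in.
- move=> nE look ge IH [|[sg [p ts]|c t1 t2] b] // [sgE x2E x3E x4E].
  move=> s a /= [[<- <-] h h_in|]; last exact: IH.
  subst x2 x3; move: look; rewrite nE tlen_seq => look.
  case: sg sgE => // -[] // _; rewrite addn0 atom_nodeE /tlevel look; exact: ge.
- move=> nE look ge IH [|[sg [p ts]|c t1 t2] b] // [sgE x2E x3E x4E].
  move=> s a /= [[<- <-] h h_in|]; last exact: IH.
  subst x2 x3; move: look; rewrite nE tlen_seq => look.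
  case: sg sgE => // -[] // _; rewrite addn1 atom_nodeE {1}/tlevel look; exact: ge.
- move=> nE look ge IH [|[sg [p ts]|c t1 t2] b] // [sgE x2E x3E x4E].
  move=> s a /= [[<- <-] h h_in|]; last exact: IH.
  subst x2 x3; move: look; rewrite nE tlen_seq => look.
  case: sg sgE => // q _; rewrite addn1 atom_nodeE {1}/tlevel look; exact: ge.
Qed.

Lemma valid_srules : group_valid SRULES c_srules.
Proof.
clauses; rewrite /S_SRULES.
- by move=> ds [].
- move=> IH ds [|[[h|] b] p] // dE [_ x3E] r c [<- //|r_in]; exact: IH dE x3E r c r_in.
- move=> nE hE bE IH ds [|[[[h ts]|] b] p] // dE [x2E x3E x4E x5E] r c [<-|r_in];
    last exact: IH dE x5E r c r_in.
  move=> [<-] s a l_in h' h'_in; apply: bE x4E s a l_in _ _.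
  rewrite (hE ds (atom_node (Atom h ts)) dE); first by apply/tmem_seqP; exists h'.
  by rewrite nE x2E x3E tlen_seq /atom_node; case: (h).
Qed.

Lemma valid_allle : group_valid ALLLE c_allle.
Proof.
clauses; rewrite /S_ALLLE // => look le IH h /= /orP[/eqP<-|/IH //].
by rewrite /tlevel look.
Qed.

Lemma valid_sdoms : group_valid SDOMS c_sdoms.
Proof.
clauses; rewrite /S_SDOMS.
- by move=> ds [].
- move=> look oE look' le IH ds [|[[q n] z] es] // dE [x2E x3E x4E x5E] e [<-|e_in];
    last exact: IH dE x5E e e_in.
  subst x0 x2 x3; move=> d d_in /=; rewrite {2}/tlevel look'.
  apply: le; rewrite (oE _ _ (tlook_doms look) erefl).
  apply/(tmem_seqP t_node _ [seq NOrd d n | d <- domain ds q n]).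
  by exists (NOrd d n) => //; apply/List.in_map_iff; exists d; split=> //; exact/InP.
Qed.

End Soundness.

(** * Tree predicates on encoded atoms and rules *)

Lemma tmem_gatom a F : tmem (t_gatom a) (t_seq t_gatom F) = (a \in F).
Proof.
apply/tmem_seqP/InP => [[b b_in /t_gatom_inj->]|a_in] //; by exists a.
Qed.

Lemma tblockedP F r : tblocked (t_seq t_gatom (g_pos r)) (t_seq t_gatom (g_neg r))
  (t_seq t_gatom F) <-> blocked F r.
Proof.
rewrite /blocked; split.
  case=> [[x /tmem_seqP[a /InP a_in ->]]|[x /tmem_seqP[a /InP a_in ->]]];
    rewrite tmem_gatom => aF; apply/orP; [left | right]; by apply/hasP; exists a.
case/orP=> /hasP[a a_in aF]; [left | right]; exists (t_gatom a); rewrite ?tmem_gatom //.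
Qed.

Lemma tallP (l F : seq gatom) :
  tall (t_seq t_gatom l) (t_seq t_gatom F) <-> all (mem F) l.
Proof.
split=> [h|/allP h x /tmem_seqP[a /InP/h a_in ->]]; last by rewrite tmem_gatom.
by apply/allP => a a_in; rewrite /= -tmem_gatom; apply: h; rewrite tmem_gatom.
Qed.

Lemma tnoneP (l F : seq gatom) :
  tnone (t_seq t_gatom l) (t_seq t_gatom F) <-> all (fun b => b \notin F) l.
Proof.
split=> [h|/allP h x /tmem_seqP[a /InP/h a_in ->]]; last by rewrite tmem_gatom.
by apply/allP => a a_in; rewrite /= -tmem_gatom; apply: h; rewrite tmem_gatom.
Qed.

Lemma tmem_grule h ps ns p : tmem (Nd h (Nd ps ns)) (t_seq t_grule p) <->
  exists r, [/\ List.In r p, h = t_ghead (g_head r), ps = t_seq t_gatom (g_pos r) &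
                ns = t_seq t_gatom (g_neg r)].
Proof.
split=> [/tmem_seqP[r r_in [-> -> ->]]|[r [r_in -> -> ->]]]; first by exists r.
by apply/tmem_seqP; exists r.
Qed.

Lemma t_ghead_some a o : Nd Lf a = t_ghead o -> exists2 h, o = Some h & a = t_gatom h.
Proof. by case: o => // h [->]; exists h. Qed.

(** The guessed model may be any tree; being derived makes it a list of encoded atoms, since each
    entry is the head of an encoded rule. *)
Lemma tderiv_list p m f : tderiv (t_seq t_grule p) m f ->
  exists F, m = t_seq t_gatom F.
Proof.
elim: m => [|a _ m IH] /=; first by exists [::].
case=> [[ps [ns [/tmem_grule[r [_ /t_ghead_some[h _ ->] _ _]] _ _]]] /IH[F ->]].
by exists (h :: F).
Qed.

Lemma tderivP p F F' :
  tderiv (t_seq t_grule p) (t_seq t_gatom F') (t_seq t_gatom F) <-> derived p F F'.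
Proof.
elim: F' => //= a F' IH; split.
  case=> [[ps [ns [/tmem_grule[r [r_in /t_ghead_some[h rE /t_gatom_inj->] -> ->]]]]]].
  by move=> /tallP pos_r /tnoneP neg_r /IH der; split=> //; exists r.
case=> [[r [r_in rE pos_r neg_r]] /IH der]; split=> //.
exists (t_seq t_gatom (g_pos r)), (t_seq t_gatom (g_neg r)); split.
- by apply/tmem_grule; exists r; rewrite rE.
- exact/tallP.
- exact/tnoneP.
Qed.

Lemma tclosedP p F : tclosed (t_seq t_grule p) (t_seq t_gatom F) <-> closed p F.
Proof.
split=> [cl r h r_in rE|cl a ps ns].
  have [] := cl (t_gatom h) (t_seq t_gatom (g_pos r)) (t_seq t_gatom (g_neg r)).
  - by apply/tmem_grule; exists r; rewrite rE.
  - by rewrite tmem_gatom; left.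
  - by move/tblockedP; right.
move=> /tmem_grule[r [r_in /t_ghead_some[h rE ->] -> ->]].
have [hF|bl] := cl r h r_in rE; first by left; rewrite tmem_gatom.
by right; apply/tblockedP.
Qed.

Lemma tconsokP p F : tconsok (t_seq t_grule p) (t_seq t_gatom F) <->
  forall r, List.In r p -> g_head r = None -> blocked F r.
Proof.
split=> [ok r r_in rE|ok ps ns /tmem_grule[r [r_in rE -> ->]]].
  by apply/tblockedP; apply: ok; apply/tmem_grule; exists r; rewrite rE.
by apply/tblockedP; apply: ok => //; case: (g_head r) rE.
Qed.

Lemma texample_answer_set e gp : texample e gp true ->
  exists M, answer_set (add_facts e gp) M.
Proof.
case=> m [der cl ok]; have [F mE] := tderiv_list der; subst m.
exists (in_list F); apply: derived_answer_set.
- exact/tderivP.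
- exact/tclosedP.
- exact/tconsokP.
Qed.

Lemma texample_no_answer_set e gp (lev : gatom -> nat) :
  (forall r h, List.In r (add_facts e gp) -> g_head r = Some h ->
    (forall a, List.In a (g_pos r) -> lev a <= lev h) /\
    (forall a, List.In a (g_neg r) -> lev a < lev h)) ->
  texample e gp false -> ~ exists M, answer_set (add_facts e gp) M.
Proof.
move=> strat [m [der cl [ps [ns [/tmem_grule[r [r_in rE -> ->]] /[swap]]]]]].
have [F mE] := tderiv_list der; subst m => /tnoneP neg_r /tallP pos_r.
apply: (derived_no_answer_set strat (F := F) (r := r)) => //.
- exact/tderivP.
- exact/tclosedP.
- by case: (g_head r) rE.
- apply/blockedPn; split=> a /InP a_in; [exact: (allP pos_r) | exact: (allP neg_r)].
Qed.

(** If one word ends first, the other one gives a larger tree. *)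
Lemma tcat_inj w w' t : tcat w t = tcat w' t -> w = w'.
Proof.
have sz v : tsize (tcat v t) = tsize t + sumn (map (fun b => (tsize (bit b)).+1) v).
  by elim: v => [|b v IHv] /=; lia.
elim: w w' => [|b w IH] [|b' w'] //=.
- by move=> /(congr1 tsize); rewrite /= sz; case: b' => /=; lia.
- by move=> /(congr1 tsize); rewrite /= sz; case: b => /=; lia.
- by case=> /bit_inj-> /IH->.
Qed.

(** The two checks match the two sources of a direct dependency, a rule and a domain. *)
Lemma table_levels I lv : S_SRULES (t_seq t_dom (i_doms I)) lv (t_seq t_rule (i_prog I)) ->
  S_SDOMS (t_seq t_dom (i_doms I)) lv (t_seq t_dom (i_doms I)) ->
  forall sg p q, direct_dep I sg p q ->
  tlevel lv (t_node q) + strict sg <= tlevel lv (t_node p).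
Proof.
move=> /(_ _ _ erefl erefl) rules_ok /(_ _ _ erefl erefl) doms_ok sg p q.
case=> [[r [r_in [c rE pE] [s [a [l_in -> sE]]]]]|[-> [q' [n [d [-> d_in ->]]]]]].
  have p_in : List.In p (head_nodes (i_doms I) (atom_node c)).
    case: pE => [->|[q' [n [d [-> d_in ->]]]]]; first by case: atom_node => *; left.
    by right; apply/List.in_map_iff; exists d; split=> //; exact/InP.
  apply: leq_trans (rules_ok _ _ r_in rE _ _ l_in _ p_in).
  rewrite leq_add2l; case: s sE {l_in} => [sg' sE|q' _]; last by case: (sg).
  by subst sg'; case: (sg).
(* An element of a domain comes from a listed entry, and the check ranges over listed entries. *)
rewrite addn0; have [e e_in eE] : exists2 e, List.In e (i_doms I) & e.1 = (q', n).
  move: d_in; rewrite /dom; elim: (i_doms I) => //= e es IH.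
  case: eqP => [eE _|_ /IH[e' e'_in eE]]; first by exists e; [left|].
  by exists e'; [right|].
by have := doms_ok e e_in d; rewrite eE; apply.
Qed.

(** The level table serves twice: it proves stratification, and it yields the uniqueness behind the
    negative examples. *)
Lemma valid_main : group_valid MAIN c_main.
Proof.
clauses => parseE rules_ok doms_ok progE posE negE.
have [u /gen_instance[I [x1E x2E _ x4E x5E] ->] x0E] := parseE gr_instance erefl.
subst x1 x2 x4 x5; have levP := table_levels rules_ok doms_ok.
have [ok gE] := progE _ _ erefl erefl.
have ok' : in_domains I (subst_of x6) by apply/in_domainsP.
exists I; split=> //; first exact: (level_stratified levP).
exists (subst_of x6); split=> // e e_in.
  exact: texample_answer_set (posE _ _ erefl gE e e_in).
apply: texample_no_answer_set (negE _ _ erefl gE e e_in).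
exact: evaluate_level ok' levP.
Qed.

Lemma horn_closed : closed_under horn meaning.
Proof.
apply: meaning_closed.
case=> [_|]; first exact: valid_main.
case=> [_|]; first exact: valid_parse.
case=> [_|]; first exact: valid_neq.
case=> [_|]; first exact: valid_look.
case=> [_|]; first exact: valid_mem.
case=> [_|]; first exact: valid_nmem.
case=> [_|]; first exact: valid_ispos.
case=> [_|]; first exact: valid_isz.
case=> [_|]; first exact: valid_succ.
case=> [_|]; first exact: valid_padd.
case=> [_|]; first exact: valid_pmul.
case=> [_|]; first exact: valid_zadd.
case=> [_|]; first exact: valid_zmul.
case=> [_|]; first exact: valid_quot.
case=> [_|]; first exact: valid_zcmp.
case=> [_|]; first exact: valid_ncmp.
case=> [_|]; first exact: valid_gcmp.
case=> [_|]; first exact: valid_apply.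
case=> [_|]; first exact: valid_fill.
case=> [_|]; first exact: valid_term.
case=> [_|]; first exact: valid_both.
case=> [_|]; first exact: valid_args.
case=> [_|]; first exact: valid_len.
case=> [_|]; first exact: valid_pred.
case=> [_|]; first exact: valid_atom.
case=> [_|]; first exact: valid_csem.
case=> [_|]; first exact: valid_nontop.
case=> [_|]; first exact: valid_cmp.
case=> [_|]; first exact: valid_guard.
case=> [_|]; first exact: valid_addlit.
case=> [_|]; first exact: valid_body.
case=> [_|]; first exact: valid_head.
case=> [_|]; first exact: valid_rule.
case=> [_|]; first exact: valid_prog.
case=> [_|]; first exact: valid_facts.
case=> [_|]; first exact: valid_allin.
case=> [_|]; first exact: valid_nonein.
case=> [_|]; first exact: valid_block.
case=> [_|]; first exact: valid_deriv.
case=> [_|]; first exact: valid_closed.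
case=> [_|]; first exact: valid_consok.
case=> [_|]; first exact: valid_posex.
case=> [_|]; first exact: valid_negex.
case=> [_|]; first exact: valid_le.
case=> [_|]; first exact: valid_ords.
case=> [_|]; first exact: valid_hnodes.
case=> [_|]; first exact: valid_allge.
case=> [_|]; first exact: valid_sbody.
case=> [_|]; first exact: valid_srules.
case=> [_|]; first exact: valid_allle.
case=> [_|]; first exact: valid_sdoms.
by [].
Qed.

Lemma start_sound w : meaning (inst (fun=> tcat w Lf) start) -> SkASP w.
Proof.
move=> /(_ _ _ (inst_goal _ _ _)) [I [/tcat_inj -> strat sat]].
by exists I; split=> //; exact: satisfiable_yes.
Qed.

(** * Derivations of arithmetic goals *)

Lemma ders_cat H B n m gs gs' :
  ders H B n gs -> ders H B m gs' -> ders H B (n + m) (gs ++ gs').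
Proof.
move=> d d'; elim: d => // c s {}n {}gs cH sB _ IH.
by rewrite addSn /=; constructor => //; rewrite catA.
Qed.

Local Notation plen := Pos.size_nat.

(** A digit and a continuation mark, each an inner node with a bit of at most three nodes. *)
Lemma tsize_pos p : tsize (t_pos p) <= 8 * plen p.
Proof. by elim: p => //= p; lia. Qed.

(** Turns lengths into inequalities between integers, which [lia] and [nia] can combine with facts
    about values. *)
Lemma plenP p n : plen p <= n <-> (Zpos p < 2 ^ Z.of_nat n)%Z.
Proof.
elim: p n => [p IH|p IH|] [|n]; rewrite ?Nat2Z.inj_succ ?Z.pow_succ_r; try lia.
- by split=> //=; lia.
- by have := IH n; change (plen (xI p)) with (plen p).+1; rewrite ltnS; lia.
- by split=> //=; lia.
- by have := IH n; change (plen (xO p)) with (plen p).+1; rewrite ltnS; lia.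
- by [].
- by split=> // _; have := Z.pow_pos_nonneg 2 (Z.of_nat n); lia.
Qed.

Lemma plen_le p q : (p <= q)%positive -> plen p <= plen q.
Proof. by move=> le_pq; apply/plenP; have /plenP := leqnn (plen q); lia. Qed.

Definition zlen (z : Z) : nat :=
  match z with Z0 => 0 | Zpos p | Zneg p => plen p end.

Lemma zlenP z n : zlen z <= n <-> (Z.abs z < 2 ^ Z.of_nat n)%Z.
Proof.
case: z => [|p|p]; rewrite ?plenP //=.
by split=> // _; have := Z.pow_pos_nonneg 2 (Z.of_nat n); lia.
Qed.

Lemma zlen_le a b : (Z.abs a <= Z.abs b)%Z -> zlen a <= zlen b.
Proof. by move=> le_ab; apply/zlenP; have /zlenP := leqnn (zlen b); lia. Qed.

Lemma zlen_sum a b c : (Z.abs c <= Z.abs a + Z.abs b)%Z ->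
  zlen c <= (maxn (zlen a) (zlen b)).+1.
Proof.
move=> le_c; set n := maxn _ _.
have /zlenP an : zlen a <= n by apply: leq_maxl.
have /zlenP bn : zlen b <= n by apply: leq_maxr.
by apply/zlenP; rewrite Nat2Z.inj_succ Z.pow_succ_r; lia.
Qed.

Lemma zlen_mul a b : zlen (a * b) <= zlen a + zlen b.
Proof.
have /zlenP an := leqnn (zlen a); have /zlenP bn := leqnn (zlen b).
by apply/zlenP; rewrite Z.abs_mul Nat2Z.inj_add Z.pow_add_r; nia.
Qed.

Lemma zlen_quot a b : zlen (Z.quot a b) <= zlen a.
Proof.
apply: zlen_le; have [->|b0] := Z.eq_dec b 0; first by case: a.
rewrite -Z.quot_abs //; have [b1'|b1'] := Z.eq_dec (Z.abs b) 1.
  by rewrite b1' Z.quot_1_r; lia.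
have [->|a0] := Z.eq_dec (Z.abs a) 0; first by rewrite Z.quot_0_l; lia.
have := Z.quot_lt (Z.abs a) (Z.abs b); lia.
Qed.

Lemma tsize_Z z : tsize (t_Z z) <= 8 * zlen z + 8.
Proof. by case: z => //= p; have := tsize_pos p; lia. Qed.

Section Bounded.
Variable B : nat.

(* The goal is derivable in at most [n] steps on trees of size at most [B]. *)
Definition D (n q : nat) (ts : seq tree) : Prop :=
  exists2 m, m <= n & ders horn B m [:: goal q ts].

Lemma D_le n m q ts : n <= m -> D n q ts -> D m q ts.
Proof. by move=> le_nm [k le_k d]; exists k => //; exact: leq_trans le_nm. Qed.

Fixpoint D_body (s : nat -> tree) (bs : seq (nat * seq pat)) (ns : seq nat) : Prop :=
  match bs, ns with
  | b :: bs, n :: ns => D n b.1 (map (inst s) b.2) /\ D_body s bs ns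
  | [::], [::] => True
  | _, _ => False
  end.

Lemma D_bodyP s bs ns : D_body s bs ns ->
  exists2 m, m <= sumn ns & ders horn B m [seq inst s (goal_pat b.1 b.2) | b <- bs].
Proof.
elim: bs ns => [|b bs IH] [|n ns] //; first by exists 0 => //; constructor.
case=> [[m le_m d] /IH[m' le_m' d']]; exists (m + m'); first exact: leq_add.
by rewrite map_cons inst_goal -cat1s; apply: ders_cat d d'.
Qed.

Definition small (p : positive) : Prop := 8 * plen p <= B.

Lemma small_size p : small p -> tsize (t_pos p) <= B.
Proof. exact: leq_trans (tsize_pos p). Qed.

Lemma small_le p q : (p <= q)%positive -> small q -> small p.
Proof. by move=> /plen_le; rewrite /small; lia. Qed.

Lemma small_plen p : small p -> plen p <= B.
Proof. by rewrite /small; lia. Qed.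

(* Small enough for the sum of two such numbers to be represented. *)
Definition zsmall (z : Z) : Prop := 8 * zlen z + 16 <= B.

Definition zfits (z : Z) : Prop := 8 * zlen z + 8 <= B.

Lemma zsmall_fits z : zsmall z -> zfits z.
Proof. by rewrite /zsmall /zfits; lia. Qed.

Lemma zfits_size z : zfits z -> tsize (t_Z z) <= B.
Proof. exact: leq_trans (tsize_Z z). Qed.

Lemma zfits_sum a b c : zsmall a -> zsmall b -> (Z.abs c <= Z.abs a + Z.abs b)%Z ->
  zfits c.
Proof. by move=> az bz /zlen_sum; move: az bz; rewrite /zsmall /zfits; lia. Qed.

Lemma zfits_le a c : zfits a -> (Z.abs c <= Z.abs a)%Z -> zfits c.
Proof. by move=> az /zlen_le; move: az; rewrite /zfits; lia. Qed.

Hypothesis B0 : 0 < B.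

(* Resolution with the [k]-th clause of the [q]-th group. *)
Lemma D_rule q k us ns n :
  let r := nth ([::], [::]) (nth [::] groups q) k in
  k < size (nth [::] groups q) -> sumn ns < n ->
  all (fun t => tsize t <= B) us ->
  D_body (nth Lf us) r.2 ns -> D n q (map (inst (nth Lf us)) r.1).
Proof.
move=> r k_lt n_lt us_le /D_bodyP[m le_m d].
exists m.+1; first exact: leq_ltn_trans le_m n_lt.
rewrite -inst_goal; apply: (@ders_cons _ _ (mk_clause q r)).
- apply/mk_clausesP; exists q, r; split=> //.
    by move: k_lt; case: (ltnP q (size groups)) => // ?; rewrite nth_default.
  by rewrite /r; elim: (nth _ groups q) k {r m le_m d n_lt} k_lt => // r g IH [|k] //=;
    [left | move/IH; right].
- move=> x; case: (ltnP x (size us)) => x_lt; last by rewrite nth_default.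
  by have /(all_nthP Lf)/(_ x x_lt) := us_le.
- by rewrite cats0 -map_comp.
Qed.

(** Only one path is followed, towards a difference, so the size of the tree bounds the steps. *)
Lemma D_neq a b : a <> b -> tsize a <= B -> tsize b <= B -> D (tsize a) NEQ [:: a; b].
Proof.
elim: a b => [|a1 IH1 a2 IH2] [|b1 b2] // ne /= aB bB.
- by apply: (@D_rule NEQ 0 [:: b1; b2] [::]) => //=; lia.
- by apply: (@D_rule NEQ 1 [:: a1; a2] [::]) => //=; lia.
have [e1|ne1] := eqVneq a1 b1; last first.
  apply: (@D_rule NEQ 2 [:: a1; a2; b1; b2] [:: tsize a1]) => //=; [lia|lia|].
  by split=> //; apply: IH1; [exact/eqP|lia|lia].
apply: (@D_rule NEQ 3 [:: a1; a2; b1; b2] [:: tsize a2]) => //=; [lia|lia|].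
by split=> //; apply: IH2; [move=> e2; case: ne; rewrite e1 e2|lia|lia].
Qed.

Lemma D_look k t v : tlook k t = Some v -> tsize k <= B -> tsize t <= B ->
  D (tsize t) LOOK [:: k; t; v].
Proof.
elim: t => // -[|k' v'] _ r IH //= lk kB tB; move: lk; case: eqP => [<- [<-]|ne lk].
  by apply: (@D_rule LOOK 0 [:: k'; v'; r] [::]) => //=; lia.
have vB : tsize v <= B.
  by elim: r lk tB {IH} => // -[|k2 v2] _ r IHr //=; case: eqP => [_ [->]|_ /IHr]; lia.
apply: (@D_rule LOOK 1 [:: k; k'; v'; r; v] [:: tsize k'; tsize r]) => //=; [lia|lia|].
by split; [apply: D_neq => //; lia | split=> //; apply: IH => //; lia].
Qed.

Lemma D_mem x l : tmem x l -> tsize l <= B -> D (tsize l) MEM [:: x; l].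
Proof.
elim: l => // y _ r IH /= + lB; case: eqP => [<- _|_ /= xr].
  by apply: (@D_rule MEM 0 [:: y; r] [::]) => //=; lia.
have xB : tsize x <= tsize r.
  by elim: r xr {IH lB} => // z _ r IHr /= /orP[/eqP->|/IHr]; lia.
apply: (@D_rule MEM 1 [:: x; y; r] [:: tsize r]) => //=; [lia|lia|].
by split=> //; apply: IH => //; lia.
Qed.

Lemma D_nmem x l : ~~ tmem x l -> tsize x <= B -> tsize l <= B ->
  D (tsize l) NMEM [:: x; l].
Proof.
elim: l => [|y _ r IH] /= xl xB lB.
  by apply: (@D_rule NMEM 0 [:: x] [::]) => //=; lia.
move: xl; rewrite negb_or => /andP[/eqP ne xr].
apply: (@D_rule NMEM 1 [:: x; y; r] [:: tsize y; tsize r]) => //=; [lia|lia|].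
by split; [apply: D_neq => //; lia | split=> //; apply: IH => //; lia].
Qed.

Lemma D_ispos p : tsize (t_pos p) <= B -> D (tsize (t_pos p)) ISPOS [:: t_pos p].
Proof.
elim: p => [p IH|p IH|] /= pB.
- apply: (@D_rule ISPOS 2 [:: t_pos p] [:: tsize (t_pos p)]) => //=; [lia|lia|].
  by split=> //; apply: IH; lia.
- apply: (@D_rule ISPOS 1 [:: t_pos p] [:: tsize (t_pos p)]) => //=; [lia|lia|].
  by split=> //; apply: IH; lia.
- exact: (@D_rule ISPOS 0 [::] [::]).
Qed.

Lemma D_isz z : tsize (t_Z z) <= B -> D (tsize (t_Z z)) ISZ [:: t_Z z].
Proof.
case: z => [|p|p] /= pB.
- exact: (@D_rule ISZ 0 [::] [::]).
- apply: (@D_rule ISZ 1 [:: t_pos p] [:: tsize (t_pos p)]) => //=; [lia|lia|].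
  by split=> //; apply: D_ispos; lia.
- apply: (@D_rule ISZ 2 [:: t_pos p] [:: tsize (t_pos p)]) => //=; [lia|lia|].
  by split=> //; apply: D_ispos; lia.
Qed.

Lemma D_succ p : small (Pos.succ p) ->
  D B SUCC [:: t_pos p; t_pos (Pos.succ p)].
Proof.
move=> sB; have pB := small_size (small_le (q := Pos.succ p) (p := p) ltac:(lia) sB).
apply: (D_le pB); elim: p sB pB => [p IH|p IH|] sB /= pB.
- have sB' : small (Pos.succ p) by apply: small_le sB; lia.
  have := small_size sB' => spB.
  apply: (@D_rule SUCC 2 [:: t_pos p; t_pos (Pos.succ p)] [:: tsize (t_pos p)]) => //=;
    [lia|lia|].
  by split=> //; apply: IH; [exact: sB' | lia].
- apply: (@D_rule SUCC 1 [:: t_pos p] [:: tsize (t_pos p)]) => //=; [lia|lia|].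
  by split=> //; apply: D_ispos; lia.
- exact: (@D_rule SUCC 0 [::] [::]).
Qed.

Definition cost_padd := B * B.+1.

(** Each digit costs one step and at most [B] further ones for a carry or a check that the rest is a
    numeral. *)
Lemma D_padd_len p q : small (p + q) ->
  D (plen p * B.+1) PADD [:: t_pos p; t_pos q; t_pos (p + q)].
Proof.
have sizes p' q' : small (p' + q') ->
    [/\ tsize (t_pos p') <= B, tsize (t_pos q') <= B & tsize (t_pos (p' + q')) <= B].
  by move=> s; split; apply: small_size; apply: small_le s; lia.
elim: p q => [p IH|p IH|] q s; have [pB qB pqB] := sizes _ _ s.
- have sp : small p by apply: small_le s; lia.
  have spB := small_size sp; case: q s qB pqB => [q|q|] s qB pqB.
  + have s1 : small (p + q) by apply: small_le s; lia.
    have s2 : small (Pos.succ (p + q)) by apply: small_le s; lia.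
    have [_ _ pq'B] := sizes _ _ s1; have s2B := small_size s2.
    rewrite /= Pos.add_carry_spec.
    apply: (@D_rule PADD 6 [:: t_pos p; t_pos q; t_pos (p + q); t_pos (Pos.succ (p + q))]
      [:: plen p * B.+1; B]) => //=; [lia|by move: qB => /=; lia|].
    by split; [exact: IH | split=> //; exact: D_succ].
  + have s1 : small (p + q) by apply: small_le s; lia.
    have [_ _ pq'B] := sizes _ _ s1.
    apply: (@D_rule PADD 5 [:: t_pos p; t_pos q; t_pos (p + q)] [:: plen p * B.+1]) => //=;
      [lia|by move: qB => /=; lia|by split=> //; exact: IH].
  + have s2 : small (Pos.succ p) by apply: small_le s; lia.
    have s2B := small_size s2.
    apply: (@D_rule PADD 2 [:: t_pos p; t_pos (Pos.succ p)] [:: B]) => //=;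
      [lia|by move: qB => /=; lia|by split=> //; exact: D_succ].
- have sp : small p by apply: small_le s; lia.
  have spB := small_size sp; case: q s qB pqB => [q|q|] s qB pqB.
  + have s1 : small (p + q) by apply: small_le s; lia.
    have [_ _ pq'B] := sizes _ _ s1.
    apply: (@D_rule PADD 4 [:: t_pos p; t_pos q; t_pos (p + q)] [:: plen p * B.+1]) => //=;
      [lia|by move: qB => /=; lia|by split=> //; exact: IH].
  + have s1 : small (p + q) by apply: small_le s; lia.
    have [_ _ pq'B] := sizes _ _ s1.
    apply: (@D_rule PADD 3 [:: t_pos p; t_pos q; t_pos (p + q)] [:: plen p * B.+1]) => //=;
      [lia|by move: qB => /=; lia|by split=> //; exact: IH].
  + apply: (@D_rule PADD 1 [:: t_pos p] [:: B]) => //=; [lia|lia|].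
    by split=> //; apply: D_le (D_ispos _).
- rewrite Pos.add_1_l in pqB s *.
  apply: (@D_rule PADD 0 [:: t_pos q; t_pos (Pos.succ q)] [:: B]) => //=;
    [lia|by split=> //; exact: D_succ].
Qed.

Lemma D_padd p q : small (p + q) -> D cost_padd PADD [:: t_pos p; t_pos q; t_pos (p + q)].
Proof.
move=> s; apply: D_le (D_padd_len s); rewrite leq_mul2r; apply/orP; right.
by apply: small_plen; apply: small_le s; lia.
Qed.

Definition cost_pmul := B * cost_padd.+2.

Lemma D_pmul p q : small (p * q) -> D cost_pmul PMUL [:: t_pos p; t_pos q; t_pos (p * q)].
Proof.
move=> s; have pB : plen p <= B by apply: small_plen; apply: small_le s; nia.
apply: (@D_le (plen p * cost_padd.+2)); first by rewrite leq_mul2r pB orbT.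
have BB : B <= cost_padd by rewrite /cost_padd; nia.
elim: p s {pB} => [p IH|p IH|] s.
- have s1 : small (p * q) by apply: small_le s; nia.
  have s2 : small (xO (p * q)) by apply: small_le s; nia.
  have qB : tsize (t_pos q) <= B by apply/small_size; apply: small_le s; nia.
  have pB : tsize (t_pos p) <= B by apply/small_size; apply: small_le s; nia.
  have s1B := small_size s1; have sB := small_size s.
  apply: (@D_rule PMUL 2 [:: t_pos p; t_pos q; t_pos (q + xO (p * q)); t_pos (p * q)]
    [:: plen p * cost_padd.+2; cost_padd]) => //=; [lia|by move: sB => /=; lia|].
  by split; [exact: IH | split=> //; exact: (@D_padd q (xO (p * q)))].
- have s1 : small (p * q) by apply: small_le s; nia.
  have qB : tsize (t_pos q) <= B by apply/small_size; apply: small_le s; nia.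
  have pB : tsize (t_pos p) <= B by apply/small_size; apply: small_le s; nia.
  have s1B := small_size s1.
  apply: (@D_rule PMUL 1 [:: t_pos p; t_pos q; t_pos (p * q)] [:: plen p * cost_padd.+2]) => //=;
    [lia|lia|by split=> //; exact: IH].
- have qB := small_size s; move: qB => /= qB.
  apply: (@D_rule PMUL 0 [:: t_pos q] [:: B]) => //=; [lia|lia|].
  by split=> //; apply: D_le (D_ispos _).
Qed.

Definition cost_zadd := cost_padd + B + 3.

Lemma D_zadd a b : zfits a -> zfits b -> zfits (a + b) ->
  D cost_zadd ZADD [:: t_Z a; t_Z b; t_Z (a + b)].
Proof.
move=> az bz cz; have aB := zfits_size az; have bB := zfits_size bz.
have cB := zfits_size cz; rewrite /cost_zadd.
have zs p : zfits (Zpos p) -> small p by rewrite /zfits /small /=; lia.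
(* Opposite signs, with the positive operand first; the clause with the operands exchanged reduces
   to this case. *)
have base p q : zfits (Zpos p) -> zfits (Zpos q) -> zfits (Zpos p - Zpos q) ->
    D (cost_padd + B + 2) ZADD [:: t_Z (Zpos p); t_Z (Zneg q); t_Z (Zpos p - Zpos q)].
  move=> pz qz dz; have pB := zfits_size pz; have qB := zfits_size qz.
  move: pB qB => /= pB qB; have [pq|[pq|pq]] : (p = q \/ p < q \/ q < p)%positive by lia.
  - subst q; rewrite Z.pos_sub_diag.
    apply: (@D_rule ZADD 4 [:: t_pos p] [:: B]) => //=; [lia|lia|].
    by split=> //; apply: D_le (D_ispos _); lia.
  - have -> : Z.pos_sub p q = Zneg (q - p) by rewrite Z.pos_sub_lt.
    have sE : (p + (q - p))%positive = q by lia.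
    have dB := small_size (small_le (p := q - p) (q := q) ltac:(lia) (zs _ qz)).
    apply: (@D_rule ZADD 6 [:: t_pos p; t_pos q; t_pos (q - p)] [:: cost_padd]) => //=;
      [lia|lia|split=> //].
    by rewrite -[in t_pos q]sE; apply: D_padd; rewrite sE; exact: zs.
  - have -> : Z.pos_sub p q = Zpos (p - q) by rewrite Z.pos_sub_gt.
    have sE : (q + (p - q))%positive = p by lia.
    have dB := small_size (small_le (p := p - q) (q := p) ltac:(lia) (zs _ pz)).
    apply: (@D_rule ZADD 5 [:: t_pos p; t_pos q; t_pos (p - q)] [:: cost_padd]) => //=;
      [lia|lia|split=> //].
    by rewrite -[in t_pos p]sE; apply: D_padd; rewrite sE; exact: zs.
have BB : B <= cost_padd by rewrite /cost_padd; nia.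
case: a az aB cz cB => [|p|p] az aB cz cB.
- apply: (@D_rule ZADD 0 [:: t_Z b] [:: B]) => //=; [lia|lia|split=> //].
  by apply: D_le (D_isz _).
- case: b bz bB cz cB => [|q|q] bz bB cz cB.
  + apply: (@D_rule ZADD 1 [:: t_Z (Zpos p)] [:: B]) => //=; [lia|by move: aB => /=; lia|split=> //].
    exact: (@D_le _ _ ISZ [:: t_Z (Zpos p)] aB (D_isz aB)).
  + have s : small (p + q) by exact: zs.
    have := small_size s; move: aB bB => /= aB bB sB.
    apply: (@D_rule ZADD 2 [:: t_pos p; t_pos q; t_pos (p + q)] [:: cost_padd]) => //=;
      [lia|lia|by split=> //; exact: D_padd].
  + by apply: D_le (base _ _ _ _ _) => //; lia.
- case: b bz bB cz cB => [|q|q] bz bB cz cB.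
  + apply: (@D_rule ZADD 1 [:: t_Z (Zneg p)] [:: B]) => //=; [lia|by move: aB => /=; lia|split=> //].
    exact: (@D_le _ _ ISZ [:: t_Z (Zneg p)] aB (D_isz aB)).
  + have -> : (Zneg p + Zpos q)%Z = (Zpos q - Zpos p)%Z by lia.
    have cz' : zfits (Zpos q - Zpos p) by move: cz; congr (zfits _); lia.
    have := zfits_size cz'; move: aB bB => /= aB bB dB.
    apply: (@D_rule ZADD 7 [:: t_pos p; t_pos q; t_Z (Zpos q - Zpos p)]
      [:: cost_padd + B + 2]) => //=; [lia|lia|].
    by split=> //; exact: base.
  + have s : small (p + q) by exact: zs.
    have := small_size s; move: aB bB => /= aB bB sB.
    apply: (@D_rule ZADD 3 [:: t_pos p; t_pos q; t_pos (p + q)] [:: cost_padd]) => //=;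
      [lia|lia|by split=> //; exact: D_padd].
Qed.

End Bounded.

Arguments D_rule : clear implicits.

(** * Substitution tables and the remaining arithmetic goals *)

Definition sv_key (s : svar) : tree :=
  match s with
  | SPred q n => Nd (k_pred (t_nat n)) (t_name q)
  | SNeg q => Nd k_neg (t_name q)
  | SCmp q => Nd k_cmp (t_name q)
  | SArith q => Nd k_arith (t_name q)
  end.

Definition sv_val (th : subst) (s : svar) : tree :=
  match s with
  | SPred q n => t_name (th_pred th q n)
  | SNeg q => t_sign (th_neg th q)
  | SCmp q => t_cmp (th_cmp th q)
  | SArith q => t_arith (th_arith th q)
  end.

Definition covers (tbl : tree) (th : subst) (vs : seq svar) : Prop :=
  forall s, List.In s vs -> tlook (sv_key s) tbl = Some (sv_val th s).

Lemma covers_cat tbl th vs vs' :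
  covers tbl th (vs ++ vs') -> covers tbl th vs /\ covers tbl th vs'.
Proof. by move=> h; split=> s s_in; apply: h; apply/List.in_app_iff; [left | right]. Qed.

Lemma t_name_cons b s : t_name (b :: s) = Nd (Nd (bit b) Lf) (t_name s).
Proof. by []. Qed.

Lemma t_seq_cons T (f : T -> tree) x s : t_seq f (x :: s) = Nd (f x) (t_seq f s).
Proof. by []. Qed.

Lemma tlook_size k t v : tlook k t = Some v -> tsize v <= tsize t.
Proof.
by elim: t => // -[|k' v'] _ r IH //=; case: eqP => [_ [->]|_ /IH]; lia.
Qed.

Lemma tmem_size x l : tmem x l -> tsize x <= tsize l.
Proof. by elim: l => // y _ r IH /= /orP[/eqP->|/IH]; lia. Qed.

Lemma tsize_Nd t u : tsize (Nd t u) = (tsize t + tsize u).+1.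
Proof. by []. Qed.

Lemma tsize_gt0 t : 0 < tsize t.
Proof. by case: t. Qed.

Lemma size_tlen t : (tlen t).*2 < tsize t.
Proof. by elim: t => //= t1 _ t2 IH; have := tsize_gt0 t1; lia. Qed.

Lemma tsize_nat n : tsize (t_nat n) = n.*2.+1.
Proof. by rewrite /t_nat; elim: n => //= n ->; lia. Qed.

Section Bounded.
Variable B : nat.
Hypothesis B0 : 0 < B.
Local Notation D := (D B).
Local Notation rule := (D_rule B B0).
Local Notation plen := Pos.size_nat.

Lemma D_len x : tsize x <= B -> D (tsize x) LEN [:: x; t_nat (tlen x)].
Proof.
elim: x => [|y _ r IH] /= xB; first exact: (rule LEN 0 [::] [::]).
have := size_tlen r; have := tsize_nat (tlen r) => nE lt_r.
apply: (rule LEN 1 [:: y; r; t_nat (tlen r)] [:: tsize r]) => //=; try lia.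
by split=> //; apply: IH; lia.
Qed.

Definition cost_zmul := cost_pmul B + B + 2.

Lemma D_zmul a b : zfits B a -> zfits B b -> zfits B (a * b) ->
  D cost_zmul ZMUL [:: t_Z a; t_Z b; t_Z (a * b)].
Proof.
move=> az bz cz; have aB := zfits_size az; have bB := zfits_size bz.
have cB := zfits_size cz; rewrite /cost_zmul.
have zs p : zfits B (Zpos p) -> small B p by rewrite /zfits /small /=; lia.
have mul p q : zfits B (Zpos (p * q)) ->
    D (cost_pmul B) PMUL [:: t_pos p; t_pos q; t_pos (p * q)].
  by move=> pq; apply: D_pmul => //; exact: zs.
case: a az aB cz cB => [|p|p] az aB cz cB.
- rewrite Z.mul_0_l; apply: (rule ZMUL 0 [:: t_Z b] [:: B]) => //=; try lia; split=> //.
  by apply: D_le (D_isz _ _).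
- case: b bz bB cz cB => [|q|q] bz bB cz cB.
  + rewrite Z.mul_0_r; apply: (rule ZMUL 1 [:: t_Z (Zpos p)] [:: B]) => //=; try lia.
      by move: aB => /=; lia.
    by split=> //; exact: (@D_le _ _ _ ISZ [:: t_Z (Zpos p)] aB (D_isz B0 aB)).
  + move: aB bB cB => /= aB bB cB.
    apply: (rule ZMUL 2 [:: t_pos p; t_pos q; t_pos (p * q)] [:: cost_pmul B]) => //=;
      try lia; split=> //; exact: mul.
  + move: aB bB cB => /= aB bB cB.
    apply: (rule ZMUL 3 [:: t_pos p; t_pos q; t_pos (p * q)] [:: cost_pmul B]) => //=;
      try lia; split=> //; exact: mul.
- case: b bz bB cz cB => [|q|q] bz bB cz cB.
  + rewrite Z.mul_0_r; apply: (rule ZMUL 1 [:: t_Z (Zneg p)] [:: B]) => //=; try lia.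
      by move: aB => /=; lia.
    by split=> //; exact: (@D_le _ _ _ ISZ [:: t_Z (Zneg p)] aB (D_isz B0 aB)).
  + move: aB bB cB => /= aB bB cB.
    apply: (rule ZMUL 4 [:: t_pos p; t_pos q; t_pos (p * q)] [:: cost_pmul B]) => //=;
      try lia; split=> //; exact: mul.
  + move: aB bB cB => /= aB bB cB.
    apply: (rule ZMUL 5 [:: t_pos p; t_pos q; t_pos (p * q)] [:: cost_pmul B]) => //=;
      try lia; split=> //; exact: mul.
Qed.

Lemma t_Z_nonzeroE z : z <> 0%Z -> exists s p,
  [/\ t_Z z = Nd s (Nd b1 (t_pos p)), Z.abs z = Zpos p &
      s = b0 /\ z = Zpos p \/ s = b1 /\ z = Zneg p].
Proof.
case: z => // p _; [exists b0, p | exists b1, p]; split=> //; [by left | by right].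
Qed.

Definition cost_quot := cost_zmul + cost_zadd B + cost_padd B + 1.

Lemma D_quot a b : b <> 0%Z -> zfits B a -> zfits B b ->
  D cost_quot QUOT [:: t_Z a; t_Z b; t_Z (Z.quot a b)].
Proof.
move=> b0 az bz; pose q := Z.quot a b; pose r := Z.rem a b.
have aE : a = (b * q + r)%Z by exact: Z.quot_rem'.
have q_le : (Z.abs (b * q) <= Z.abs a)%Z.
  have [a_ge|a_le] : (0 <= a \/ a <= 0)%Z by lia.
    by have := Z.mul_quot_le a b a_ge b0; rewrite -/q; lia.
  by have := Z.mul_quot_ge a b a_le b0; rewrite -/q; lia.
have qz : zfits B q by move: az; rewrite /zfits; have := zlen_quot a b; rewrite -/q; lia.
have mz : zfits B (b * q) by exact: zfits_le q_le.
have rb := Z.rem_bound_abs a b b0; rewrite -/r in rb.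
have rz : zfits B r by apply: (zfits_le bz); lia.
have := zfits_size az; have := zfits_size bz; have := zfits_size qz.
have := zfits_size mz; have := zfits_size rz => rB mB qB bB aB.
have [s' [pb [bE absb sb]]] := t_Z_nonzeroE b0; rewrite -/q.
have M := D_zmul bz qz mz; move: bB; rewrite bE /= => bB.
have [r0|r0] := Z.eq_dec r 0.
  rewrite {1}(_ : a = (b * q)%Z); last lia.
  apply: (rule QUOT 0 [:: t_Z (b * q); s'; t_pos pb; t_Z q] [:: cost_zmul]) => //=;
    try lia.
  - by rewrite /cost_quot; lia.
  - by split=> //; rewrite -bE.
have a0 : a <> 0%Z by move=> a0; case: r0; rewrite /r a0; apply: Z.rem_0_l.
have [s [pa [aE' absa sa]]] := t_Z_nonzeroE a0.
have [s2 [pr [rE absr sr]]] := t_Z_nonzeroE r0.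
(* A nonzero remainder of truncated division has the sign of the dividend, as the clause demands by
   using one variable for both signs. *)
have s2E : s2 = s.
  have := Z.rem_sign_nz a b b0 r0; rewrite -/r.
  by case: sa => -[-> ->]; case: sr => -[-> ->] //.
subst s2; have pbE : (pr + (pb - pr))%positive = pb by lia.
have zs p : zfits B (Zpos p) -> small B p by rewrite /zfits /small /=; lia.
have pbs : small B pb by apply: zs; apply: (zfits_le bz); lia.
have dB := small_size (small_le (p := pb - pr) (q := pb) ltac:(lia) pbs).
move: aB rB; rewrite aE' rE /= => aB rB.
apply: (rule QUOT 1 [:: s; t_pos pa; s'; t_pos pb; t_Z q; t_Z (b * q); t_pos pr;
   t_pos (pb - pr)] [:: cost_zmul; cost_zadd B; cost_padd B]) => //=.
- by rewrite /cost_quot; lia.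
- lia.
- split; first by rewrite -bE.
  split; last by split=> //; rewrite -[in t_pos pb]pbE; apply: D_padd => //; rewrite pbE.
  by rewrite -rE -aE' aE; apply: D_zadd => //; rewrite -aE.
Qed.

Definition cost_zcmp := cost_zadd B + B + 1.

Lemma D_zcmp a b : zsmall B a -> zsmall B b ->
  D cost_zcmp ZCMP [:: t_Z a; t_Z b; t_comparison (Z.compare a b)].
Proof.
move=> az bz; have := zfits_size (zsmall_fits az); have := zfits_size (zsmall_fits bz).
move=> bB aB; case: Z.compare_spec => [ab|lt_ab|lt_ba]; rewrite /cost_zcmp.
- subst b; apply: (rule ZCMP 0 [:: t_Z a] [:: B]) => //=; try lia.
  by split=> //; apply: D_le (D_isz _ _).
- have [p pE] : exists p, (b - a)%Z = Zpos p by exists (Z.to_pos (b - a)); rewrite Z2Pos.id; lia.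
  have pz : zfits B (Zpos p) by rewrite -pE; apply: (zfits_sum az bz); lia.
  have := zfits_size pz => /= pB.
  apply: (rule ZCMP 1 [:: t_Z a; t_Z b; t_pos p] [:: cost_zadd B]) => //=; try lia.
  have {1}-> : b = (a + Zpos p)%Z by lia.
  split=> //; apply: (D_zadd B0 (zsmall_fits az) pz).
  by rewrite (_ : (_ + _)%Z = b); [exact: zsmall_fits | lia].
- have [p pE] : exists p, (a - b)%Z = Zpos p by exists (Z.to_pos (a - b)); rewrite Z2Pos.id; lia.
  have pz : zfits B (Zpos p) by rewrite -pE; apply: (zfits_sum az bz); lia.
  have := zfits_size pz => /= pB.
  apply: (rule ZCMP 2 [:: t_Z a; t_Z b; t_pos p] [:: cost_zadd B]) => //=; try lia.
  have {1}-> : a = (b + Zpos p)%Z by lia.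
  split=> //; apply: (D_zadd B0 (zsmall_fits bz) pz).
  by rewrite (_ : (_ + _)%Z = a); [exact: zsmall_fits | lia].
Qed.

Lemma tsize_comparison c : tsize (t_comparison c) <= 5.
Proof. by case: c. Qed.

Lemma D_ncmp s t : tsize (t_name s) <= B -> tsize (t_name t) <= B -> 5 <= B ->
  D (tsize (t_name s)) NCMP [:: t_name s; t_name t; t_comparison (name_compare s t)].
Proof.
move=> + + B5; elim: s t => [|b s IH] [|c t]; rewrite ?t_name_cons => sB tB; rewrite /= in sB tB.
- exact: (rule NCMP 0 [::] [::]).
- by apply: (rule NCMP 1 [:: Nd (bit c) Lf; t_name t] [::]) => //=; lia.
- by apply: (rule NCMP 2 [:: Nd (bit b) Lf; t_name s] [::]) => //=; lia.
rewrite [name_compare _ _]/=; case: eqP => [<-|bc].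
  have := tsize_comparison (name_compare s t) => cB.
  apply: (rule NCMP 3 [:: Nd (bit b) Lf; t_name s; t_name t; t_comparison (name_compare s t)]
    [:: tsize (t_name s)]) => //=; try lia.
  by split=> //; apply: IH; lia.
case: b c bc sB tB => [] [] // _ sB tB.
- by apply: (rule NCMP 5 [:: t_name s; t_name t] [::]) => //=; lia.
- by apply: (rule NCMP 4 [:: t_name s; t_name t] [::]) => //=; lia.
Qed.

Definition gsmall (g : gterm) : Prop :=
  match g with GInt z => zsmall B z | GSym s => tsize (t_name s) + 16 <= B end.

Definition cost_gcmp := cost_zcmp + B + 1.

Lemma D_gcmp x y : gsmall x -> gsmall y -> 5 <= B ->
  D cost_gcmp GCMP [:: t_gterm x; t_gterm y; t_comparison (gterm_compare x y)].
Proof.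
move=> xs ys B5; have cB := leq_trans (tsize_comparison (gterm_compare x y)) B5.
rewrite /cost_gcmp; case: x y xs ys cB => [a|s] [b|t] /= xs ys cB.
- have := zfits_size (zsmall_fits xs); have := zfits_size (zsmall_fits ys) => bB aB.
  apply: (rule GCMP 0 [:: t_Z a; t_Z b; t_comparison (Z.compare a b)] [:: cost_zcmp]) => //=;
    try lia; by split=> //; exact: D_zcmp.
- have := zfits_size (zsmall_fits xs) => aB.
  by apply: (rule GCMP 1 [:: t_Z a; t_name t] [::]) => //=; lia.
- have := zfits_size (zsmall_fits ys) => bB.
  by apply: (rule GCMP 2 [:: t_name s; t_Z b] [::]) => //=; lia.
- apply: (rule GCMP 3 [:: t_name s; t_name t; t_comparison (name_compare s t)] [:: B]) => //=;
    try lia.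
  split=> //; apply: (@D_le _ (tsize (t_name s))); [lia | apply: D_ncmp => //; lia].
Qed.

End Bounded.

(** * Evaluating a program under a substitution *)

Section EvaluationGoals.

Local Arguments t_seq : simpl never.

Lemma tsize_sign s : tsize (t_sign s) <= 5. Proof. by case: s. Qed.
Lemma tsize_cmp c : tsize (t_cmp c) <= 13. Proof. by case: c. Qed.
Lemma tsize_arith o : tsize (t_arith o) <= 13. Proof. by case: o. Qed.

Lemma zlen_tsize z : zlen z <= tsize (t_Z z).
Proof.
have pos p : Pos.size_nat p <= tsize (t_pos p) by elim: p => //= p; lia.
by case: z => //= p; have := pos p; lia.
Qed.

(** Multiplication adds lengths, sums and differences gain one digit over the longer operand, and a
    quotient is no longer than its dividend. *)
Lemma arith_len o a b z : arith_sem o a b = Some z -> zlen z <= (zlen a + zlen b).+1.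
Proof.
have sum c : (Z.abs c <= Z.abs a + Z.abs b)%Z -> zlen c <= (zlen a + zlen b).+1.
  by move=> /zlen_sum; lia.
case: o => /=.
- by case=> <-; apply: sum; lia.
- by case=> <-; apply: sum; lia.
- by case=> <-; have := zlen_mul a b; lia.
- by case: Z.eqb => // -[<-]; have := zlen_quot a b; lia.
- by case=> <-; apply: sum; lia.
Qed.

Definition val_le (n : nat) (v : option gterm) : Prop :=
  match v with
  | Some (GInt z) => zlen z <= n
  | Some (GSym s) => tsize (t_name s) <= n
  | None => True
  end.

Lemma val_le_le n m v : n <= m -> val_le n v -> val_le m v.
Proof. by case: v => [[z|s]|] //= ? ?; lia. Qed.

(** The key to polynomial certificates: a value has no more digits than its term has nodes, because
    the operator node pays for the additional digit in [arith_len]. *)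
Lemma eval_val_le th t : val_le (tsize (t_term t)) (eval (sub_term th t)).
Proof.
elim: t => [z|s|o t1 IH1 t2 IH2] /=; [by have := zlen_tsize z; lia|lia|].
case: (eval _) IH1 => [[a|//]|//] /= IH1; case: (eval _) IH2 => [[b|//]|//] /= IH2.
by case E: arith_sem => [z|] //=; have := arith_len E; lia.
Qed.

Lemma tsize_val n v : val_le n v -> tsize (t_opt t_gterm v) <= 8 * n + 12.
Proof. by case: v => [[z|s]|] /=; [have := tsize_Z z; lia | lia | lia]. Qed.

Lemma tsize_eval th t :
  tsize (t_opt t_gterm (eval (sub_term th t))) <= 24 * tsize (t_term t).
Proof. by have := tsize_val (eval_val_le th t); have := tsize_gt0 (t_term t); lia. Qed.

Lemma eval_args_cons t ts : eval_args (t :: ts) =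
  if (eval t, eval_args ts) is (Some v, Some vs) then Some (v :: vs) else None.
Proof. by []. Qed.

Lemma tsize_eval_args th ts :
  tsize (t_opt (t_seq t_gterm) (eval_args (map (sub_term th) ts))) <=
  24 * tsize (t_seq t_term ts) + 2.
Proof.
rewrite /t_seq; elim: ts => [|t ts IH] //; rewrite map_cons eval_args_cons /=.
have := tsize_eval th t.
case: (eval _) => [v|] /=; last lia.
by case: eval_args IH => [vs|] /=; lia.
Qed.

Lemma tlook_doms_some ds q n d : d \in domain ds q n ->
  tlook (Nd (t_name q) (t_nat n)) (t_seq t_dom ds) = Some (t_seq t_name (domain ds q n)).
Proof.
rewrite /domain /t_seq; elim: ds => //= -[[q' n'] d'] ds IH /=.
case: eqP => [/= [-> ->] _|ne /IH->]; first by rewrite eqxx.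
by case: eqP => // /t_key_inj[qq nn]; case: ne; rewrite qq nn.
Qed.

Section Evaluation.
(** [S] bounds the trees of the instance, [B] those of the refutation. A quadratic gap is left
    because filling a slot may put a name of size up to [S] into each atom. *)
Variables B S : nat.
Hypothesis BS : 100 * (S.+1 * S.+1) <= B.

Let B0 : 0 < B. Proof. by apply: leq_trans BS. Qed.
Let BS1 : 100 * S + 100 <= B. Proof. by apply: leq_trans BS; nia. Qed.

Local Notation D := (D B).
Local Notation rule := (D_rule B B0).

Lemma zsmall_le z : zlen z <= S -> zsmall B z.
Proof. by rewrite /zsmall; move: BS1; lia. Qed.

Definition cost_apply := (cost_quot B).+2.

Lemma D_apply o x y : val_le S x -> val_le S y -> val_le S (arith_opt o x y) ->
  D cost_apply APPLY [:: t_arith o; t_opt t_gterm x; t_opt t_gterm y;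
                         t_opt t_gterm (arith_opt o x y)].
Proof.
move=> xS yS; have oB := tsize_arith o; have xB := tsize_val xS; have yB := tsize_val yS.
have ops : cost_zadd B < cost_apply /\ cost_zmul B < cost_apply.
  by rewrite /cost_apply /cost_quot /cost_zmul; lia.
case: x xS xB => [[a|s]|] /= xS xB; first last.
- by move=> _; apply: (rule APPLY 7 [:: t_arith o; t_opt t_gterm y] [::]) => //=; lia.
- by move=> _; apply: (rule APPLY 8 [:: t_arith o; t_name s; t_opt t_gterm y] [::]) => //=; lia.
case: y yS yB => [[b|s]|] /= yS yB; first last.
- by move=> _; apply: (rule APPLY 9 [:: t_arith o; t_opt t_gterm (Some (GInt a))] [::]) => //=; lia.
- by move=> _; apply: (rule APPLY 10 [:: t_arith o; t_opt t_gterm (Some (GInt a)); t_name s] [::]) => //=; lia.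
have az := zsmall_fits (zsmall_le xS); have bz := zsmall_fits (zsmall_le yS).
have aB := zfits_size az; have bB := zfits_size bz.
case: o oB => /= oB.
- move=> cS; have cz := zsmall_fits (zsmall_le cS); have cB := zfits_size cz.
  apply: (rule APPLY 0 [:: t_Z a; t_Z b; t_Z (a + b)] [:: cost_zadd B]) => //=; try lia.
  by split=> //; exact: D_zadd.
- move=> cS; have cz := zsmall_fits (zsmall_le cS); have cB := zfits_size cz.
  apply: (rule APPLY 1 [:: t_Z a; t_Z b; t_Z (a - b)] [:: cost_zadd B]) => //=; try lia.
  have E : (a - b + b)%Z = a by lia.
  by split=> //; rewrite -[in t_Z a]E; apply: D_zadd => //; rewrite E.
- move=> cS; have cz := zsmall_fits (zsmall_le cS); have cB := zfits_size cz.
  apply: (rule APPLY 2 [:: t_Z a; t_Z b; t_Z (a * b)] [:: cost_zmul B]) => //=; try lia.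
  by split=> //; exact: D_zmul.
- case: Z.eqb_spec => [-> _|b0 cS].
    by apply: (rule APPLY 4 [:: t_Z a] [::]) => //=; lia.
  have cz := zsmall_fits (zsmall_le cS); have cB := zfits_size cz.
  apply: (rule APPLY 3 [:: t_Z a; t_Z b; t_Z (Z.quot a b)] [:: cost_quot B]) => //=; try lia.
  + by rewrite /cost_apply; lia.
  + by split=> //; exact: D_quot.
- move=> cS; have cz := zsmall_fits (zsmall_le cS); have cB := zfits_size cz.
  have [c cE] : exists c, t_Z (Z.abs (a - b)) = Nd b0 c.
    by case: (a - b)%Z => [|p|p]; eexists.
  rewrite cE; move: cB; rewrite cE /= => cB.
  have [ab|ba] : (b <= a \/ a <= b)%Z by lia.
  + apply: (rule APPLY 5 [:: t_Z a; t_Z b; c] [:: cost_zadd B]) => //=; try lia.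
    have E : (b + Z.abs (a - b))%Z = a by lia.
    by split=> //; rewrite -cE -[in t_Z a]E; apply: D_zadd => //; rewrite E.
  + apply: (rule APPLY 6 [:: t_Z a; t_Z b; c] [:: cost_zadd B]) => //=; try lia.
    have E : (a + Z.abs (a - b))%Z = b by lia.
    by split=> //; rewrite -cE -[in t_Z b]E; apply: D_zadd => //; rewrite E.
Qed.

Variables (tbl : tree) (th : subst).
Hypothesis tblB : tsize tbl <= B.

Lemma D_fill T (f : T -> tree) (F : name -> T) key s :
  (forall q, s = Sk q -> tlook (Nd key (t_name q)) tbl = Some (f (F q))) ->
  tsize (t_slot f s) <= S -> tsize key <= 10 -> tsize (f (fill F s)) <= B ->
  D B.+1 FILL [:: tbl; key; t_slot f s; f (fill F s)].
Proof.
case: s => [x|q] /= look sS kB vB.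
  by apply: (rule FILL 0 [:: tbl; key; f x] [::]) => //=; lia.
apply: (rule FILL 1 [:: tbl; key; t_name q; f (F q)] [:: B]) => //=; try lia.
split=> //; apply: D_le tblB _; apply: D_look => //; first exact: look.
by rewrite /=; lia.
Qed.

Definition cost_node := cost_apply + B + 5.

Lemma D_term t : covers tbl th (term_vars t) -> tsize (t_term t) <= S ->
  D (tsize (t_term t) * cost_node) TERM
    [:: tbl; t_term t; t_opt t_gterm (eval (sub_term th t))].
Proof.
have c0 : 5 <= cost_node by rewrite /cost_node; lia.
elim: t => [z|s|o t1 IH1 t2 IH2] cov tS.
- apply: (rule TERM 0 [:: tbl; t_Z z] [::]) => //=; move: tS => /=; nia.
- apply: (rule TERM 1 [:: tbl; t_name s] [::]) => //=; move: tS => /=; nia.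
have := eval_val_le th (TOp o t1 t2) => resS.
have val1 := eval_val_le th t1; have val2 := eval_val_le th t2.
have [covo] := covers_cat cov; move=> /covers_cat[cov1 cov2].
have resB := tsize_val resS; move: tS => /= tS.
have v1B := tsize_val val1; have v2B := tsize_val val2.
have oB := tsize_arith (fill (th_arith th) o).
apply: (rule TERM 2 [:: tbl; t_slot t_arith o; t_term t1; t_term t2;
   t_opt t_gterm (eval (sub_term th (TOp o t1 t2))); t_arith (fill (th_arith th) o);
   t_opt t_gterm (eval (sub_term th t1)); t_opt t_gterm (eval (sub_term th t2))]
  [:: B.+1; tsize (t_term t1) * cost_node; tsize (t_term t2) * cost_node; cost_apply]) => //=.
- by rewrite /cost_node; nia.
- by move: resB => /=; lia.
- split.
    apply: D_fill => //; try lia.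
    by move=> q oE; have := covo (SArith q); rewrite oE; apply; left.
  split; first by apply: IH1 => //; lia.
  split; first by apply: IH2 => //; lia.
  split=> //; apply: D_apply.
  + by apply: val_le_le val1; lia.
  + by apply: val_le_le val2; lia.
  + by apply: val_le_le resS => /=; lia.
Qed.

Lemma D_both_opt T U (f : T -> tree) (g : U -> tree) x y :
  tsize (t_opt f x) <= B -> tsize (t_opt g y) <= B ->
  D 1 BOTH [:: t_opt f x; t_opt g y; tboth (t_opt f x) (t_opt g y)].
Proof.
case: x => [x|] /= xB; last by move=> yB; apply: (rule BOTH 0 [:: t_opt g y] [::]) => //=; lia.
case: y => [y|] /= yB; last by apply: (rule BOTH 1 [:: f x] [::]) => //=; lia.
by apply: (rule BOTH 2 [:: f x; g y] [::]) => //=; lia.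
Qed.

Lemma eval_args_both t ts :
  t_opt (t_seq t_gterm) (eval_args (t :: ts)) =
  tboth (t_opt t_gterm (eval t)) (t_opt (t_seq t_gterm) (eval_args ts)).
Proof. by rewrite /=; case: eval => [v|] //; case: eval_args. Qed.

Lemma D_args ts : covers tbl th (flatten (map term_vars ts)) ->
  tsize (t_seq t_term ts) <= S ->
  D (tsize (t_seq t_term ts) * cost_node) ARGS
    [:: tbl; t_seq t_term ts; t_opt (t_seq t_gterm) (eval_args (map (sub_term th) ts))].
Proof.
have c0 : 5 <= cost_node by rewrite /cost_node; lia.
elim: ts => [|t ts IH] cov tS.
  by apply: (rule ARGS 0 [:: tbl] [::]) => //=; nia.
have [cov1 cov2] := covers_cat (cov : covers tbl th (term_vars t ++ _)).
have resB := tsize_eval_args th (t :: ts).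
have v1B := tsize_eval th t; have v2B := tsize_eval_args th ts.
move: tS; rewrite t_seq_cons /= => tS; rewrite t_seq_cons /= in resB.
apply: (rule ARGS 1 [:: tbl; t_term t; t_seq t_term ts;
   t_opt (t_seq t_gterm) (eval_args (map (sub_term th) (t :: ts)));
   t_opt t_gterm (eval (sub_term th t));
   t_opt (t_seq t_gterm) (eval_args (map (sub_term th) ts))]
  [:: tsize (t_term t) * cost_node; tsize (t_seq t_term ts) * cost_node; 1]) => //.
- by rewrite /=; nia.
- by rewrite /= ?eval_args_cons in resB *; lia.
- split; first by apply: D_term => //; lia.
  split; first by apply: IH => //; lia.
  split=> //; rewrite /= -/(eval_args _) -[X in D _ _ [:: _; _; X]]/(t_opt _ (eval_args (sub_term th t :: map (sub_term th) ts))).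
  by rewrite eval_args_both; apply: D_both_opt; lia.
Qed.

Variable ds : seq (name * nat * seq name).
Hypothesis dsS : tsize (t_seq t_dom ds) <= S.
Local Notation d := (t_seq t_dom ds).

Lemma D_pred s n : tsize (t_slot t_name s) <= S -> tsize (t_nat n) <= S ->
  (forall q, s = Sk q -> th_pred th q n \in domain ds q n /\
     tlook (sv_key (SPred q n)) tbl = Some (sv_val th (SPred q n))) ->
  D (3 * B).+1 PRED [:: d; tbl; t_slot t_name s; t_nat n;
                       t_name (fill (fun q => th_pred th q n) s)].
Proof.
case: s => [x|q] /= sS nS look.
  by apply: (rule PRED 0 [:: d; tbl; t_name x; t_nat n] [::]) => //=; lia.
have [v_in look_th] := look q erefl; have look_d := tlook_doms_some v_in.
have lS := tlook_size look_d; have vS := tlook_size look_th.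
apply: (rule PRED 1 [:: d; tbl; t_name q; t_nat n; t_name (th_pred th q n);
  t_seq t_name (domain ds q n)] [:: B; B; B]) => //=; try lia.
split; first by apply: D_le tblB _; apply: D_look => //=; lia.
split; first by apply: (@D_le _ (tsize d)); [lia | apply: D_look => //=; lia].
split=> //; apply: (@D_le _ (tsize (t_seq t_name (domain ds q n)))); first lia.
by apply: D_mem; [exact: B0 | apply/tmem_seqP; exists (th_pred th q n) => //; exact/InP | lia].
Qed.

Definition cost_atom := 4 * B + B * cost_node + 4.

Lemma fill_size a : atom_ok (domain ds) th a ->
  tsize (t_name (fill (fun q => th_pred th q (size (a_args a))) (a_pred a))) <=
  S + tsize (t_slot t_name (a_pred a)).
Proof.
rewrite /atom_ok; case: (a_pred a) => [p|q] ok /=; first lia.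
have lS := tlook_size (tlook_doms_some (ok q erefl)).
suff : tsize (t_name (th_pred th q (size (a_args a)))) <=
       tsize (t_seq t_name (domain ds q (size (a_args a)))) by lia.
by apply: tmem_size; apply/tmem_seqP; eexists; [exact/InP/(ok q erefl) |].
Qed.

(** The factor by which evaluation may enlarge a tree: [S] for a substituted predicate name, a
    constant for the values of terms. *)
Definition weight := S + 30.

Lemma tsize_eval_atom a : atom_ok (domain ds) th a ->
  tsize (t_opt t_gatom (eval_atom (sub_atom th a))) + 10 <= weight * tsize (t_atom a).
Proof.
move=> /fill_size; have := tsize_eval_args th (a_args a).
rewrite /eval_atom /weight /=; case: (eval_args _) => [vs|] /=; rewrite /t_gatom /=; nia.
Qed.

Lemma weight_le n : n <= S -> weight * n + 20 <= B.
Proof. by move=> nS; apply: leq_trans BS; rewrite /weight; nia. Qed.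

Lemma D_atom a : atom_ok (domain ds) th a -> covers tbl th (atom_vars a) ->
  tsize (t_atom a) <= S ->
  D cost_atom ATOM [:: d; tbl; t_atom a; t_opt t_gatom (eval_atom (sub_atom th a))].
Proof.
move=> ok cov aS; have := tsize_eval_atom ok; have := weight_le aS => wB resB.
have fS := fill_size ok; have argsB := tsize_eval_args th (a_args a).
have [cov1 cov2] := covers_cat cov; have nS := size_tlen (t_seq t_term (a_args a)).
have := tsize_nat (size (a_args a)) => nE; rewrite tlen_seq in nS.
have nS' : tsize (t_nat (size (a_args a))) <= S.
  rewrite nE; apply: leq_trans nS _; move: aS; rewrite /t_atom /=; lia.
have nB : tsize (t_nat (size (a_args a))) <= B by apply: leq_trans nS' _; lia.
move: aS; rewrite /t_atom /= => aS.
have -> : t_opt t_gatom (eval_atom (sub_atom th a)) =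
    tboth (t_opt t_name (Some (fill (fun q => th_pred th q (size (a_args a))) (a_pred a))))
      (t_opt (t_seq t_gterm) (eval_args (map (sub_term th) (a_args a)))).
  by rewrite /eval_atom /=; case: (eval_args _).
apply: (rule ATOM 0 [:: d; tbl; t_slot t_name (a_pred a); t_seq t_term (a_args a);
   tboth (t_opt t_name (Some (fill (fun q => th_pred th q (size (a_args a))) (a_pred a))))
      (t_opt (t_seq t_gterm) (eval_args (map (sub_term th) (a_args a))));
   t_nat (size (a_args a)); t_name (fill (fun q => th_pred th q (size (a_args a))) (a_pred a));
   t_opt (t_seq t_gterm) (eval_args (map (sub_term th) (a_args a)))]
  [:: B; (3 * B).+1; B * cost_node; 1]) => //.
- by rewrite /cost_atom /=; lia.
- rewrite /=; repeat (apply/andP; split); try lia; try exact: nB.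
  by case: (eval_args _) argsB => [vs|] /=; lia.
- split.
    rewrite -(tlen_seq t_term); apply: (@D_le _ (tsize (t_seq t_term (a_args a)))); first lia.
    by apply: D_len; lia.
  split.
    apply: D_pred; [lia|lia|move=> q qE; split; first exact: ok].
    by apply: cov1; rewrite qE; left.
  split.
    apply: D_le (D_args cov2 _); last lia.
    by rewrite leq_mul2r; apply/orP; right; lia.
  split=> //; apply: (@D_both_opt _ _ t_name _ (Some _)) => //=; lia.
Qed.

(** For the tables [CSEM] and [NONTOP], whose clauses are generated and more easily found by
    membership than by index. *)
Lemma D_fact q ps : List.In (ps, [::]) (nth [::] groups q) ->
  D 1 q (map (inst (fun=> Lf)) ps).
Proof.
move=> r_in; exists 1 => //; rewrite -inst_goal.
apply: (@ders_cons _ _ (mk_clause q (ps, [::]))) => //; last by constructor.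
apply/mk_clausesP; exists q, (ps, [::]); split=> //.
by case: (ltnP q (size groups)) r_in => // q_ge; rewrite nth_default.
Qed.

Lemma D_nontop c : c <> CTop -> D 1 NONTOP [:: t_cmp c].
Proof.
move=> nt; rewrite -{1}(inst_const (fun=> Lf) (t_cmp c)).
by apply: (@D_fact NONTOP [:: const (t_cmp c)]); case: c nt => // _; repeat (by left) || right.
Qed.

Lemma D_csem c r : D 1 CSEM [:: t_cmp c; t_comparison r; bit (cmp_sem c r)].
Proof.
have := @D_fact CSEM [:: const (t_cmp c); const (t_comparison r); const (bit (cmp_sem c r))].
by rewrite /map !inst_const; apply; case: c; case: r; repeat (by left) || right.
Qed.

Definition cost_cmp := (cost_gcmp B).+2.

Lemma val_gsmall g : val_le S (Some g) -> gsmall B g.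
Proof. by case: g => [z|s] /=; rewrite /zsmall; lia. Qed.

Lemma D_cmp c x y : val_le S x -> val_le S y ->
  D cost_cmp CMP [:: t_cmp c; t_opt t_gterm x; t_opt t_gterm y; bit (cmp_opt c x y)].
Proof.
move=> xS yS; have xB := tsize_val xS; have yB := tsize_val yS.
have cB := tsize_cmp c; rewrite /cost_cmp.
have [->|nt] : c = CTop \/ c <> CTop by case: c {cB}; (by left) || (by right).
  by apply: (rule CMP 0 [:: t_opt t_gterm x; t_opt t_gterm y] [::]) => //=; lia.
case: x xS xB => [x|] xS xB; last first.
  have -> : cmp_opt c None y = false by case: c nt {cB}.
  apply: (rule CMP 1 [:: t_cmp c; t_opt t_gterm y] [:: 1]) => //=; try lia.
  by split=> //; exact: D_nontop.
case: y yS yB => [y|] yS yB; last first.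
  have -> : cmp_opt c (Some x) None = false by case: c nt {cB}.
  apply: (rule CMP 2 [:: t_cmp c; t_opt t_gterm (Some x)] [:: 1]) => //.
    by move: xB => /=; lia.
  by split=> //; exact: D_nontop.
have -> : cmp_opt c (Some x) (Some y) = cmp_sem c (gterm_compare x y) by case: c nt {cB}.
have rB := tsize_comparison (gterm_compare x y).
have bB : tsize (bit (cmp_sem c (gterm_compare x y))) <= 3 by case: cmp_sem.
rewrite /= in xB yB.
apply: (rule CMP 3 [:: t_cmp c; t_gterm x; t_gterm y; bit (cmp_sem c (gterm_compare x y));
   t_comparison (gterm_compare x y)] [:: cost_gcmp B; 1]) => //=; try lia.
split; first by apply: D_gcmp => //; [exact: val_gsmall | exact: val_gsmall | lia].
by split=> //; exact: D_csem.
Qed.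

Lemma D_guard b x : tsize x <= B -> D 1 GUARD [:: bit b; x; if b then x else Lf].
Proof.
case: b => xB; first by apply: (rule GUARD 1 [:: x] [::]) => //=; lia.
by apply: (rule GUARD 0 [:: x] [::]) => //=; lia.
Qed.

Lemma D_addlit sg (g : option gatom) b : tsize (t_opt t_gatom g) <= B ->
  tsize (t_opt t_body b) <= B ->
  D 1 ADDLIT [:: t_sign sg; t_opt t_gatom g; t_opt t_body b;
                 taddlit sg (t_opt t_gatom g) (t_opt t_body b)].
Proof.
have sB := tsize_sign sg.
case: g => [g|] gB; last first.
  by move=> bB; apply: (rule ADDLIT 0 [:: t_sign sg; t_opt t_body b] [::]) => //=; lia.
case: b => [[ps ns]|]; rewrite /= in gB *; last first.
  by move=> bB; apply: (rule ADDLIT 1 [:: t_sign sg; t_gatom g] [::]) => //=; lia.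
move=> bB; case: sg {sB}.
- by apply: (rule ADDLIT 2 [:: t_gatom g; t_seq t_gatom ps; t_seq t_gatom ns] [::]) => //=; lia.
- by apply: (rule ADDLIT 3 [:: t_gatom g; t_seq t_gatom ps; t_seq t_gatom ns] [::]) => //=; lia.
Qed.

Definition body_ok (b : seq sliteral) : Prop :=
  forall s a, List.In (LAtom s a) b -> atom_ok (domain ds) th a.

Lemma eval_body_atom s a b :
  t_opt t_body (eval_body (map (sub_literal th) (LAtom s a :: b))) =
  taddlit (fill (th_neg th) s) (t_opt t_gatom (eval_atom (sub_atom th a)))
    (t_opt t_body (eval_body (map (sub_literal th) b))).
Proof.
rewrite /=; case: eval_atom => [g|] //; case: eval_body => [[ps ns]|] //=.
by case: (fill _ _).
Qed.

Lemma eval_body_cmp c s t b :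
  t_opt t_body (eval_body (map (sub_literal th) (LCmp c s t :: b))) =
  if cmp_opt (fill (th_cmp th) c) (eval (sub_term th s)) (eval (sub_term th t))
  then t_opt t_body (eval_body (map (sub_literal th) b)) else Lf.
Proof. by rewrite /= cmp_holds_opt; case: ifP. Qed.

Lemma tsize_eval_body b : body_ok b ->
  tsize (t_opt t_body (eval_body (map (sub_literal th) b))) <=
  weight * tsize (t_seq t_literal b) + 10.
Proof.
elim: b => [|l b IH] ok; first by rewrite /=; lia.
have {}IH := IH (fun s a h => ok s a (or_intror h)).
rewrite t_seq_cons; case: l ok => [s a|c s t] ok.
  have := tsize_eval_atom (ok s a (or_introl erefl)); rewrite eval_body_atom.
  move: IH; case: eval_body => [[ps ns]|]; case: eval_atom => [g|] //=; try nia.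
  by case: (fill _ _) => /=; nia.
by rewrite eval_body_cmp; case: ifP => _ /=; nia.
Qed.

Definition cost_literal := cost_atom + B * cost_node + B * cost_node + cost_cmp + B + 5.

Lemma D_eval_body b : body_ok b -> covers tbl th (flatten (map literal_vars b)) ->
  tsize (t_seq t_literal b) <= S ->
  D (tsize (t_seq t_literal b) * cost_literal) BODY
    [:: d; tbl; t_seq t_literal b; t_opt t_body (eval_body (map (sub_literal th) b))].
Proof.
have c0 : 0 < cost_literal by rewrite /cost_literal; lia.
elim: b => [|l b IH] ok cov bS.
  by apply: (rule BODY 0 [:: d; tbl] [::]) => //=; nia.
have [cov1 cov2] := covers_cat (cov : covers tbl th (literal_vars l ++ _)).
have resB : tsize (t_opt t_body (eval_body (map (sub_literal th) (l :: b)))) <= B.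
  by apply: leq_trans (tsize_eval_body ok) _; have := weight_le bS; lia.
have ok' : body_ok b := fun s a h => ok s a (or_intror h).
have := tsize_eval_body ok' => resB'; move: bS; rewrite t_seq_cons => /= bS.
have := IH ok' cov2 => {}IH.
have bB : tsize (t_opt t_body (eval_body (map (sub_literal th) b))) <= B.
  by apply: leq_trans resB' _; have := @weight_le (tsize (t_seq t_literal b)); lia.
have nodes n : n <= S -> n * cost_node <= B * cost_node.
  by move=> nS; rewrite leq_mul2r; apply/orP; right; lia.
case: l ok cov cov1 bS resB => [sg a|c s t] ok cov cov1 bS resB.
- have oka := ok sg a (or_introl erefl); rewrite /= in bS.
  have [covs cova] := covers_cat (cov1 : covers tbl th (slot_vars SNeg sg ++ _)).
  have resa := tsize_eval_atom oka.
  have aS : tsize (t_atom a) <= S by move: bS; rewrite /t_atom /=; lia.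
  have aB : tsize (t_opt t_gatom (eval_atom (sub_atom th a))) <= B.
    apply: leq_trans (leq_trans resa _); first exact: leq_addr.
    by apply: leq_trans (weight_le aS); exact: leq_addr.
  rewrite eval_body_atom in resB *.
  have sB := tsize_sign (fill (th_neg th) sg).
  apply: (rule BODY 1 [:: d; tbl; t_slot t_sign sg; t_atom a; t_seq t_literal b;
    taddlit (fill (th_neg th) sg) (t_opt t_gatom (eval_atom (sub_atom th a)))
      (t_opt t_body (eval_body (map (sub_literal th) b)));
    t_sign (fill (th_neg th) sg); t_opt t_gatom (eval_atom (sub_atom th a));
    t_opt t_body (eval_body (map (sub_literal th) b))]
    [:: B.+1; cost_atom; tsize (t_seq t_literal b) * cost_literal; 1]) => //.
  + by rewrite /= /cost_literal; nia.
  + rewrite /=; repeat (apply/andP; split); try lia.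
  + split.
      apply: D_fill => //; try lia.
      by move=> q qE; have := covs (SNeg q); rewrite qE; apply; left.
    split; first exact: D_atom.
    split; first by apply: IH; lia.
    by split=> //; apply: D_addlit; lia.
- rewrite /= in bS; rewrite eval_body_cmp in resB *.
  have [covc /covers_cat[covs covt]] :=
    covers_cat (cov1 : covers tbl th (slot_vars SCmp c ++ _)).
  have cB := tsize_cmp (fill (th_cmp th) c).
  have v1 := eval_val_le th s; have v2 := eval_val_le th t.
  have v1B := tsize_eval th s; have v2B := tsize_eval th t.
  set bb := cmp_opt _ _ _ in resB *; have bbB : tsize (bit bb) <= 3 by case: (bb).
  apply: (rule BODY 2 [:: d; tbl; t_slot t_cmp c; t_term s; t_term t; t_seq t_literal b;
    if bb then t_opt t_body (eval_body (map (sub_literal th) b)) else Lf;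
    t_cmp (fill (th_cmp th) c); t_opt t_gterm (eval (sub_term th s));
    t_opt t_gterm (eval (sub_term th t)); bit bb;
    t_opt t_body (eval_body (map (sub_literal th) b))]
    [:: B.+1; B * cost_node; B * cost_node; cost_cmp;
        tsize (t_seq t_literal b) * cost_literal; 1]) => //.
  + by rewrite /= /cost_literal; nia.
  + rewrite /=; repeat (apply/andP; split); try lia.
  + split.
      apply: D_fill => //; try lia.
      by move=> q qE; have := covc (SCmp q); rewrite qE; apply; left.
    split; first by apply: D_le (D_term covs _); [apply: nodes; lia | lia].
    split; first by apply: D_le (D_term covt _); [apply: nodes; lia | lia].
    split.
      by apply: D_cmp; [apply: val_le_le v1; lia | apply: val_le_le v2; lia].
    split; first by apply: IH; lia.
    by split=> //; exact: D_guard bB.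
Qed.

Lemma tsize_eval_head a : atom_ok (domain ds) th a -> tsize (t_atom a) <= S ->
  tsize (t_opt t_gatom (eval_atom (sub_atom th a))) + 10 <= B.
Proof.
move=> ok aS; apply: leq_trans (tsize_eval_atom ok) _.
by apply: leq_trans (weight_le aS); exact: leq_addr.
Qed.

Lemma D_head h : (forall a, h = Some a -> atom_ok (domain ds) th a) ->
  covers tbl th (oapp atom_vars [::] h) -> tsize (t_rhead h) <= S ->
  D cost_atom.+1 HEAD [:: d; tbl; t_rhead h; thead th h].
Proof.
case: h => [a|] ok cov hS; last by apply: (rule HEAD 0 [:: d; tbl] [::]) => //=; lia.
have aS : tsize (t_atom a) <= S by move: hS; rewrite /t_rhead /=; lia.
have aB := tsize_eval_head (ok a erefl) aS.
have := D_atom (ok a erefl) cov aS; rewrite /thead.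
move: aS => /= aS; case: (eval_atom _) aB => [g|] aB h; rewrite /= in aB h.
  apply: (rule HEAD 2 [:: d; tbl; t_atom a; t_gatom g] [:: cost_atom]) => //=; first lia.
  by repeat (apply/andP; split); lia.
apply: (rule HEAD 1 [:: d; tbl; t_atom a] [:: cost_atom]) => //=; first lia.
by repeat (apply/andP; split); lia.
Qed.

Lemma tsize_thead h : (forall a, h = Some a -> atom_ok (domain ds) th a) ->
  tsize (thead th h) <= weight * tsize (t_rhead h).
Proof.
case: h => [a|] ok; last by rewrite /weight /=; nia.
have := tsize_eval_atom (ok a erefl).
suff : tsize (thead th (Some a)) <= tsize (t_opt t_gatom (eval_atom (sub_atom th a))) + 10.
  move=> h1 h2; apply: leq_trans h1 (leq_trans h2 _).
  by rewrite leq_mul2l; apply/orP; right; rewrite /=; lia.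
by rewrite /thead; case: (eval_atom _) => [g|] /=; lia.
Qed.

Definition rule_ok (r : srule) : Prop := forall a, in_rule a r -> atom_ok (domain ds) th a.

Lemma eval_rule_both r : t_opt t_grule (eval_rule (sub_rule th r)) =
  tboth (thead th (r_head r)) (t_opt t_body (eval_body (map (sub_literal th) (r_body r)))).
Proof.
rewrite /eval_rule /=; case: eval_body => [[ps ns]|]; case: (r_head r) => [a|] //=;
  by case: eval_atom.
Qed.

Lemma tsize_eval_rule r : rule_ok r ->
  tsize (t_opt t_grule (eval_rule (sub_rule th r))) <= weight * tsize (t_rule r).
Proof.
move=> ok; have := tsize_thead (fun a h => ok a (or_introl h)).
have := @tsize_eval_body (r_body r) (fun s a h => ok a (or_intror (ex_intro _ s h))).
rewrite eval_rule_both [t_rule r]/=.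
have w30 : 30 <= weight by rewrite /weight; lia.
move: (t_opt _ _) (thead _ _) => [|x y] [|x' y'] //=; nia.
Qed.

Definition cost_rule := cost_atom + B * cost_literal + 5.

Lemma D_eval_rule r : rule_ok r -> covers tbl th (rule_vars r) -> tsize (t_rule r) <= S ->
  D cost_rule RULE [:: d; tbl; t_rule r; t_opt t_grule (eval_rule (sub_rule th r))].
Proof.
move=> ok cov rS; have okh a h := ok a (or_introl h).
have okb : body_ok (r_body r) := fun s a h => ok a (or_intror (ex_intro _ s h)).
have [covh covb] := covers_cat cov.
have resB := leq_trans (tsize_eval_rule ok) (leq_trans (leq_addr 20 _) (weight_le rS)).
move: rS; rewrite [t_rule r]/= => /= rS.
have hS : tsize (t_rhead (r_head r)) <= S by lia.
have bS : tsize (t_seq t_literal (r_body r)) <= S by lia.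
have hB := leq_trans (tsize_thead okh) (leq_trans (leq_addr 20 _) (weight_le hS)).
have bB : tsize (t_opt t_body (eval_body (map (sub_literal th) (r_body r)))) <= B.
  apply: leq_trans (tsize_eval_body okb) _; apply: leq_trans (weight_le bS).
  by rewrite leq_add2l.
rewrite eval_rule_both in resB *.
apply: (rule RULE 0 [:: d; tbl; t_rhead (r_head r); t_seq t_literal (r_body r);
  tboth (thead th (r_head r)) (t_opt t_body (eval_body (map (sub_literal th) (r_body r))));
  thead th (r_head r); t_opt t_body (eval_body (map (sub_literal th) (r_body r)))]
  [:: cost_atom.+1; B * cost_literal; 1]) => //.
- by rewrite /cost_rule /=; lia.
- by rewrite /=; repeat (apply/andP; split) => //; lia.
- split; first exact: D_head.
  split.
    by apply: D_le (D_eval_body okb covb bS); rewrite leq_mul2r; apply/orP; right; lia.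
  (* A nested option, the outer level for undefinedness and the inner one for constraints, which
     fits [D_both_opt]. *)
  split=> //; have -> : thead th (r_head r) =
      t_opt (t_opt t_gatom) (if r_head r is Some a
        then omap Some (eval_atom (sub_atom th a)) else Some None).
    by case: (r_head r) => [a|] //=; case: eval_atom.
  apply: D_both_opt bB; move: hB.
  by case: (r_head r) => [a|] //=; case: eval_atom.
Qed.

Definition prog_ok (p : sprogram) : Prop := forall r, List.In r p -> rule_ok r.

Lemma evaluate_cons r p : evaluate (sub_program th (r :: p)) =
  oapp (cons^~ (evaluate (sub_program th p))) (evaluate (sub_program th p))
    (eval_rule (sub_rule th r)).
Proof. by []. Qed.

Lemma tsize_evaluate p : prog_ok p ->
  tsize (t_seq t_grule (evaluate (sub_program th p))) <= weight * tsize (t_seq t_rule p).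
Proof.
elim: p => [|r p IH] ok; first by rewrite /weight /=; nia.
have {}IH := IH (fun r' h => ok r' (or_intror h)).
have := tsize_eval_rule (ok r (or_introl erefl)).
have w30 : 30 <= weight by rewrite /weight; lia.
rewrite evaluate_cons t_seq_cons; case: eval_rule => [g|] gB.
  by rewrite [oapp _ _ _]/= t_seq_cons; move: IH gB => /=; nia.
by apply: leq_trans IH _; rewrite leq_mul2l /=; lia.
Qed.

Lemma D_prog p : prog_ok p -> covers tbl th (svars p) -> tsize (t_seq t_rule p) <= S ->
  D (tsize (t_seq t_rule p) * cost_rule.+1) PROG
    [:: d; tbl; t_seq t_rule p; t_seq t_grule (evaluate (sub_program th p))].
Proof.
elim: p => [|r p IH] ok cov pS.
  by apply: (rule PROG 0 [:: d; tbl] [::]) => //=; lia.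
have [covr covp] := covers_cat (cov : covers tbl th (rule_vars r ++ _)).
have resB := leq_trans (tsize_evaluate ok) (leq_trans (leq_addr 20 _) (weight_le pS)).
move: pS; rewrite t_seq_cons tsize_Nd => pS.
have ok' : prog_ok p := fun r' h => ok r' (or_intror h).
have rS : tsize (t_rule r) <= S by lia.
have pS' : tsize (t_seq t_rule p) <= S by lia.
have resB' := leq_trans (tsize_evaluate ok') (leq_trans (leq_addr 20 _) (weight_le pS')).
have hr := D_eval_rule (ok r (or_introl erefl)) covr rS; have hp := IH ok' covp pS'.
have cost : sumn [:: cost_rule; tsize (t_seq t_rule p) * cost_rule.+1] <
    (tsize (t_rule r) + tsize (t_seq t_rule p)).+1 * cost_rule.+1 by rewrite /=; nia.
move: resB hr; rewrite evaluate_cons.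
case: eval_rule => [g|]; rewrite [oapp _ _ _]/=; [rewrite t_seq_cons tsize_Nd => resB|move=> _] => hr.
  apply: (rule PROG 2 [:: d; tbl; t_rule r; t_seq t_rule p; t_grule g;
    t_seq t_grule (evaluate (sub_program th p))] _ _ _ cost) => //.
  by rewrite /all; repeat (apply/andP; split) => //; lia.
apply: (rule PROG 1 [:: d; tbl; t_rule r; t_seq t_rule p;
    t_seq t_grule (evaluate (sub_program th p))] _ _ _ cost) => //.
by rewrite /all; repeat (apply/andP; split) => //; lia.
Qed.

End Evaluation.

End EvaluationGoals.

(** * Checking answer sets *)

Section CheckGoals.

Local Arguments t_seq : simpl never.
Local Arguments t_gatom : simpl never.
Local Arguments t_grule : simpl never.

Lemma t_gruleE h ps ns : t_grule (GRule h ps ns) =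
  Nd (t_opt t_gatom h) (Nd (t_seq t_gatom ps) (t_seq t_gatom ns)).
Proof. by []. Qed.

Lemma add_facts_cons a e gp :
  add_facts (a :: e) gp = GRule (Some a) [::] [::] :: add_facts e gp.
Proof. by []. Qed.

Lemma tsize_add_facts e gp : tsize (t_seq t_grule (add_facts e gp)) =
  tsize (t_seq t_gatom e) + size e * 6 + (tsize (t_seq t_grule gp)).-1.
Proof.
elim: e => [|a e IH].
  change (add_facts [::] gp) with gp; have := tsize_gt0 (t_seq t_grule gp).
  by change (tsize (t_seq t_gatom [::])) with 1; rewrite mul0n; lia.
by rewrite add_facts_cons !t_seq_cons t_gruleE !tsize_Nd IH /=; lia.
Qed.

Lemma tall_cons x l m : tall (Nd x l) m -> tmem x m /\ tall l m.
Proof.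
by move=> h; split=> [|y yl]; [move: (h x) | move: (h y)] => /= ->; rewrite ?eqxx ?yl ?orbT.
Qed.

Lemma tnone_cons x l m : tnone (Nd x l) m -> ~~ tmem x m /\ tnone l m.
Proof.
by move=> h; split=> [|y yl]; [move: (h x) | move: (h y)] => /= ->; rewrite ?eqxx ?yl ?orbT.
Qed.

Section Checks.
Variable B : nat.
Hypothesis B0 : 0 < B.
Local Notation D := (D B).
Local Notation rule := (D_rule B B0).

Definition cost_list := B * B.+1.

Lemma D_allin_size l m : tall l m -> tsize l <= B -> tsize m <= B ->
  D (tsize l * B.+1) ALLIN [:: l; m].
Proof.
elim: l => [|x _ l IH] h lB mB; first by apply: (rule ALLIN 0 [:: m] [::]) => //=; lia.
rewrite tsize_Nd in lB *; have x0 := tsize_gt0 x.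
apply: (rule ALLIN 1 [:: x; l; m] [:: B; tsize l * B.+1]) => //=; try nia.
have [xm lm] := tall_cons h; split; first by apply: (D_le mB); exact: D_mem.
by split=> //; apply: IH => //; lia.
Qed.

Lemma D_nonein_size l m : tnone l m -> tsize l <= B -> tsize m <= B ->
  D (tsize l * B.+1) NONEIN [:: l; m].
Proof.
elim: l => [|x _ l IH] h lB mB; first by apply: (rule NONEIN 0 [:: m] [::]) => //=; lia.
rewrite tsize_Nd in lB *; have x0 := tsize_gt0 x.
apply: (rule NONEIN 1 [:: x; l; m] [:: B; tsize l * B.+1]) => //=; try nia.
have [xm lm] := tnone_cons h.
split; first by apply: (D_le mB); apply: D_nmem => //; lia.
by split=> //; apply: IH => //; lia.
Qed.

Lemma D_allin l m : tall l m -> tsize l <= B -> tsize m <= B -> D cost_list ALLIN [:: l; m].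
Proof.
by move=> h lB mB; apply: D_le (D_allin_size h lB mB); rewrite leq_mul2r lB orbT.
Qed.

Lemma D_nonein l m : tnone l m -> tsize l <= B -> tsize m <= B ->
  D cost_list NONEIN [:: l; m].
Proof.
by move=> h lB mB; apply: D_le (D_nonein_size h lB mB); rewrite leq_mul2r lB orbT.
Qed.

Definition cost_block := 3 * B.

Lemma D_block ps ns m : tblocked ps ns m ->
  tsize ps <= B -> tsize ns <= B -> tsize m <= B -> D cost_block BLOCK [:: ps; ns; m].
Proof.
rewrite /cost_block => -[[x xp xm]|[x xn xm]] pB nB mB.
- apply: (@D_le _ (tsize ps + B)); first lia.
  elim: ps xp pB => // y _ ps IH /= + pB.
  have y0 := tsize_gt0 y; case: eqP => [yx|_ /=] xp.
    subst y; apply: (rule BLOCK 0 [:: x; ps; ns; m] [:: B]) => //=; try lia.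
    by split=> //; apply: (D_le mB); apply: D_nmem => //; lia.
  apply: (rule BLOCK 1 [:: y; ps; ns; m] [:: tsize ps + B]) => //=; try lia.
  by split=> //; apply: IH => //; lia.
- apply: (@D_le _ (tsize ns + B)); first lia.
  elim: ns xn nB => // y _ ns IH /= + nB.
  have y0 := tsize_gt0 y; case: eqP => [yx|_ /=] xn.
    subst y; apply: (rule BLOCK 2 [:: ps; x; ns; m] [:: B]) => //=; try lia.
    by split=> //; apply: (D_le mB); apply: D_mem.
  apply: (rule BLOCK 3 [:: ps; y; ns; m] [:: tsize ns + B]) => //=; try lia.
  by split=> //; apply: IH => //; lia.
Qed.

Definition cost_deriv := B + cost_list + cost_list + 1.

Lemma D_deriv p m f : tderiv p m f -> tsize p <= B -> tsize m <= B -> tsize f <= B ->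
  D (tsize m * cost_deriv) DERIV [:: p; m; f].
Proof.
move=> + pB + fB; have c0 : 0 < cost_deriv by rewrite /cost_deriv; lia.
elim: m => [|a _ m IH] h mB; first by apply: (rule DERIV 0 [:: p; f] [::]) => //=; lia.
case: h => -[ps [ns [r_in pos neg]]] h; rewrite tsize_Nd in mB *.
have := tmem_size r_in; rewrite !tsize_Nd => rB; have a0 := tsize_gt0 a.
apply: (rule DERIV 1 [:: p; a; m; f; ps; ns] [:: B; cost_list; cost_list; tsize m * cost_deriv])
  => //=; try lia.
- by rewrite /cost_deriv; nia.
- split; first by apply: (D_le pB); exact: D_mem.
  split; first by apply: D_allin => //; lia.
  split; first by apply: D_nonein => //; lia.
  by split=> //; apply: IH => //; lia.
Qed.

Definition cost_closed := 4 * B + 1.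

Lemma D_closed p f : tclosed (t_seq t_grule p) f ->
  tsize (t_seq t_grule p) <= B -> tsize f <= B ->
  D (tsize (t_seq t_grule p) * cost_closed) CLOSED [:: t_seq t_grule p; f].
Proof.
move=> + + fB; have c0 : 0 < cost_closed by rewrite /cost_closed; lia.
elim: p => [|[h ps ns] p IH] cl; first by move=> _; apply: (rule CLOSED 0 [:: f] [::]) => //=; lia.
rewrite t_seq_cons t_gruleE !tsize_Nd => pB.
have {}IH : D (tsize (t_seq t_grule p) * cost_closed) CLOSED [:: t_seq t_grule p; f].
  by apply: IH; [move=> a ps' ns' r_in; apply: (cl a); rewrite t_seq_cons /= r_in orbT | lia].
case: h cl pB => [a|] cl; rewrite /= => pB; last first.
  apply: (rule CLOSED 1 [:: t_body (ps, ns); t_seq t_grule p; f]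
    [:: tsize (t_seq t_grule p) * cost_closed]) => //=; try lia; nia.
have [|af|bl] := cl (t_gatom a) (t_seq t_gatom ps) (t_seq t_gatom ns).
- by rewrite t_seq_cons /= eqxx.
- apply: (rule CLOSED 2 [:: t_gatom a; t_body (ps, ns); t_seq t_grule p; f]
    [:: B; tsize (t_seq t_grule p) * cost_closed]) => //=; try lia.
    by rewrite /cost_closed; nia.
  by split; [apply: (D_le fB); exact: D_mem | split].
- apply: (rule CLOSED 3 [:: Nd b0 (t_gatom a); t_seq t_gatom ps; t_seq t_gatom ns;
    t_seq t_grule p; f] [:: cost_block; tsize (t_seq t_grule p) * cost_closed]) => //=; try lia.
    by rewrite /cost_closed /cost_block; nia.
  by split; [apply: D_block => //; lia | split].
Qed.

Lemma D_consok p f : tconsok (t_seq t_grule p) f ->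
  tsize (t_seq t_grule p) <= B -> tsize f <= B ->
  D (tsize (t_seq t_grule p) * cost_closed) CONSOK [:: t_seq t_grule p; f].
Proof.
move=> + + fB; have c0 : 0 < cost_closed by rewrite /cost_closed; lia.
elim: p => [|[h ps ns] p IH] ok; first by move=> _; apply: (rule CONSOK 0 [:: f] [::]) => //=; lia.
rewrite t_seq_cons t_gruleE !tsize_Nd => pB.
have {}IH : D (tsize (t_seq t_grule p) * cost_closed) CONSOK [:: t_seq t_grule p; f].
  by apply: IH; [move=> ps' ns' r_in; apply: ok; rewrite t_seq_cons /= r_in orbT | lia].
case: h ok pB => [a|] ok; rewrite /= => pB.
  apply: (rule CONSOK 1 [:: b0; t_gatom a; t_body (ps, ns); t_seq t_grule p; f]
    [:: tsize (t_seq t_grule p) * cost_closed]) => //=; try lia; nia.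
have bl : tblocked (t_seq t_gatom ps) (t_seq t_gatom ns) f.
  by apply: ok; rewrite t_seq_cons /= eqxx.
apply: (rule CONSOK 2 [:: b0; t_seq t_gatom ps; t_seq t_gatom ns;
    t_seq t_grule p; f] [:: cost_block; tsize (t_seq t_grule p) * cost_closed]) => //=; try lia.
  by rewrite /cost_closed /cost_block; nia.
by split; [apply: D_block => //; lia | split].
Qed.

Lemma D_facts e gp : tsize (t_seq t_grule (add_facts e gp)) <= B ->
  D (tsize (t_seq t_gatom e)) FACTS
    [:: t_seq t_gatom e; t_seq t_grule gp; t_seq t_grule (add_facts e gp)].
Proof.
elim: e => [|a e IH] eB.
  by apply: (rule FACTS 0 [:: t_seq t_grule gp] [::]) => //=; rewrite andbT.
have := tsize_add_facts e gp; have := tsize_gt0 (t_seq t_grule gp).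
move: eB; rewrite add_facts_cons !t_seq_cons t_gruleE /t_opt !tsize_Nd => eB gp0 eE.
have a0 := tsize_gt0 (t_gatom a).
apply: (rule FACTS 1 [:: t_gatom a; t_seq t_gatom e; t_seq t_grule gp;
    t_seq t_grule (add_facts e gp)] [:: tsize (t_seq t_gatom e)]) => //.
- by rewrite /sumn /=; lia.
- by rewrite /all; repeat (apply/andP; split) => //; (lia || (rewrite /t_gatom tsize_Nd; lia)).
- by split=> //; apply: IH; lia.
Qed.

Definition cost_example := B + B * cost_deriv + B * cost_closed + B * cost_closed
  + 2 * cost_list + 1.

(** Both kinds of examples at once, since they differ only in what is shown about the
    constraints. *)
Lemma D_examples q ok es gp : q = (if ok then POSEX else NEGEX) ->
  tsize (t_seq t_grule gp) <= B ->
  (forall e, List.In e es -> exists m, let p := t_seq t_grule (add_facts e gp) in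
    [/\ tderiv p m m, tclosed p m,
      if ok then tconsok p m
      else exists ps ns, [/\ tmem (Nd Lf (Nd ps ns)) p, tall ps m & tnone ns m],
      tsize p <= B & tsize m <= B]) ->
  tsize (t_seq (t_seq t_gatom) es) <= B ->
  D (tsize (t_seq (t_seq t_gatom) es) * cost_example) q
    [:: t_seq (t_seq t_gatom) es; t_seq t_grule gp].
Proof.
move=> qE gB; elim: es => [|e es IH] h esB.
  by case: ok qE {h} => ->; [apply: (rule POSEX 0 [:: t_seq t_grule gp] [::])
    | apply: (rule NEGEX 0 [:: t_seq t_grule gp] [::])] => //=; rewrite /cost_example; lia.
have {}IH := IH (fun e' e'_in => h e' (or_intror e'_in)).
have [m] := h e (or_introl erefl); cbv zeta.
set p := t_seq t_grule (add_facts e gp) => -[der cl okm pB mB].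
move: esB; rewrite t_seq_cons !tsize_Nd => esB; have e0 := tsize_gt0 (t_seq t_gatom e).
have eB : tsize (t_seq t_gatom e) <= B by lia.
have Dfacts : D B FACTS [:: t_seq t_gatom e; t_seq t_grule gp; p].
  by apply: (D_le eB); exact: D_facts.
have Dder : D (B * cost_deriv) DERIV [:: p; m; m].
  by apply: D_le (D_deriv der pB mB mB); rewrite leq_mul2r mB orbT.
have Dcl : D (B * cost_closed) CLOSED [:: p; m].
  by apply: D_le (D_closed cl pB mB); rewrite leq_mul2r pB orbT.
have {}IH := IH ltac:(lia).
rewrite /cost_example in IH *; case: ok okm qE IH {h} => okm -> IH.
  apply: (rule POSEX 1 [:: t_seq t_gatom e; t_seq (t_seq t_gatom) es; t_seq t_grule gp; p; m]
    [:: B; B * cost_deriv; B * cost_closed; B * cost_closed; _]) => //=; try lia; last first.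
  - split=> //; split=> //; split=> //; split; last by split; [exact: IH|].
    by apply: D_le (D_consok okm pB mB); rewrite leq_mul2r pB orbT.
  - nia.
have [ps [ns [r_in pos neg]]] := okm.
have := tmem_size r_in; rewrite !tsize_Nd => rB.
apply: (rule NEGEX 1 [:: t_seq t_gatom e; t_seq (t_seq t_gatom) es; t_seq t_grule gp; p; m;
    ps; ns] [:: B; B * cost_deriv; B * cost_closed; B; cost_list; cost_list; _]) => //=;
    try lia; last first.
- split=> //; split=> //; split=> //; split; first by apply: (D_le pB); exact: D_mem.
  split; first by apply: D_allin => //; lia.
  split; first by apply: D_nonein => //; lia.
  by split; [exact: IH|].
- by rewrite /cost_closed; nia.
Qed.

End Checks.

End CheckGoals.

(** * Parsing and checking levels *)

Section ParseAndLevelGoals.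

Local Arguments t_seq : simpl never.
Local Arguments t_nat : simpl never.
Local Arguments t_node : simpl never.
Local Arguments t_atom : simpl never.
Local Arguments t_literal : simpl never.
Local Arguments t_rule : simpl never.
Local Arguments t_dom : simpl never.
Local Arguments t_gram : simpl never.

Lemma t_node_inj : injective t_node.
Proof. by case=> [p n|q n] [p' n'|q' n'] //= [] /t_name_inj-> /t_nat_inj->. Qed.

Lemma tlen_nat n : tlen (t_nat n) = n.
Proof. by rewrite /t_nat; elim: n => //= n ->. Qed.

Lemma tsize_In T (f : T -> tree) x s : List.In x s -> tsize (f x) < tsize (t_seq f s).
Proof.
rewrite /t_seq; elim: s => //= y s IH [->|/IH]; first by have := tsize_gt0 (t_list (map f s)); lia.
lia.
Qed.

(* Only [GNT] makes a step without building a node of the parse tree. *)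
Definition is_nt (g : gram) : nat := if g is GNT _ then 1 else 0.

Section Levels.
Variable B : nat.
Hypothesis B0 : 0 < B.
Local Notation D := (D B).
Local Notation rule := (D_rule B B0).

Lemma tsize_tcat w v : tsize v <= tsize (tcat w v).
Proof. by elim: w => //= b w IH; lia. Qed.

Lemma tcat_cat w w' v : tcat (w ++ w') v = tcat w (tcat w' v).
Proof. by rewrite /tcat foldr_cat. Qed.

Hypothesis prodB : forall nt, tsize (t_gram (prod_of nt)) <= B.

(** Three steps per node of the parse tree: one for the node, and one for each of its at most two
    components in case it is a nonterminal. *)
Lemma D_parse g t w v : parses g t w -> tsize (t_gram g) <= B -> tsize t <= B ->
  tsize (tcat w v) <= B ->
  D (3 * tsize t + is_nt g) PARSE [:: t_gram g; tcat w v; t; v].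
Proof.
move=> p; elim: p v => {g t w} [|g h b t w _ IH|g h t u v w _ IH1 _ IH2|g|g t u v w _ IH1 _ IH2|nt t w _ IH] x gB tB wB.
- by apply: (rule PARSE 0 [:: x] [::]) => //=; rewrite andbT.
- have := tsize_gt0 t; move: gB tB wB; rewrite /= => gB tB wB t0.
  case: b IH tB wB => IH tB wB.
  + have hB : tsize (t_gram h) <= B by move: gB; rewrite /t_gram /= -!/(t_gram _); lia.
    have gB' : tsize (t_gram g) <= B by move: gB; rewrite /t_gram /= -!/(t_gram _); lia.
    apply: (rule PARSE 2 [:: t_gram g; t_gram h; tcat w x; t; x] [:: 3 * tsize t + is_nt h]) => //.
    * by case: (h); rewrite /=; lia.
    * have := tsize_tcat w x; rewrite /all; repeat (apply/andP; split) => //; move: tB wB => /=; lia.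
    * by split=> //; apply: IH => //; move: tB wB => /=; lia.
  + have hB : tsize (t_gram h) <= B by move: gB; rewrite /t_gram /= -!/(t_gram _); lia.
    have gB' : tsize (t_gram g) <= B by move: gB; rewrite /t_gram /= -!/(t_gram _); lia.
    apply: (rule PARSE 1 [:: t_gram g; t_gram h; tcat w x; t; x] [:: 3 * tsize t + is_nt g]) => //.
    * by case: (g); rewrite /=; lia.
    * have := tsize_tcat w x; rewrite /all; repeat (apply/andP; split) => //; move: tB wB => /=; lia.
    * by split=> //; apply: IH => //; move: tB wB => /=; lia.
- move: gB wB; rewrite tcat_cat /t_gram /= -!/(t_gram _) => gB wB.
  rewrite tsize_Nd in tB *; have xB := tsize_tcat w x; have wxB := tsize_tcat v (tcat w x).
  have cg : is_nt g <= 1 by case: (g). have ch : is_nt h <= 1 by case: (h).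
  apply: (rule PARSE 3 [:: t_gram g; t_gram h; tcat v (tcat w x); t; u; x; tcat w x]
    [:: 3 * tsize t + is_nt g; 3 * tsize u + is_nt h]) => //.
  + by rewrite /=; lia.
  + by rewrite /all; repeat (apply/andP; split) => //; lia.
  + by split; [apply: IH1 => //; lia | split=> //; apply: IH2 => //; lia].
- move: gB wB; rewrite /t_gram /= -!/(t_gram _) => gB wB.
  by apply: (rule PARSE 4 [:: t_gram g; x] [::]) => //=; lia.
- have gB' : tsize (t_gram g) <= B by move: gB; rewrite /t_gram /= -!/(t_gram _); lia.
  move: wB; rewrite -cat_cons tcat_cat /= => wB.
  rewrite tsize_Nd in tB *; have xB := tsize_tcat w x; have wxB := tsize_tcat v (tcat w x).
  have cg : is_nt g <= 1 by case: (g).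
  apply: (rule PARSE 5 [:: t_gram g; tcat v (tcat w x); t; u; x; tcat w x]
    [:: 3 * tsize t + is_nt g; 3 * tsize u + 0]) => //.
  + by rewrite /=; lia.
  + by rewrite /all; repeat (apply/andP; split) => //; lia.
  + by split; [apply: IH1 => //; lia | split=> //; apply: IH2 => //; lia].
- have nB := prodB nt; have xB := tsize_tcat w x.
  have c0 : is_nt (prod_of nt) = 0 by case: (nt).
  have {}IH := IH x nB tB wB; rewrite c0 in IH.
  have tt : tsize t <= B := tB.
  case: nt {nB c0 gB} IH => IH.
  + apply: (rule PARSE 6 [:: tcat w x; t; x] [:: 3 * tsize t + 0]) => //.
    * by rewrite /=; lia.
    * by rewrite /all; repeat (apply/andP; split) => //; lia.
  + apply: (rule PARSE 7 [:: tcat w x; t; x] [:: 3 * tsize t + 0]) => //.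
    * by rewrite /=; lia.
    * by rewrite /all; repeat (apply/andP; split) => //; lia.
Qed.

Lemma D_level_le a b : tlen a <= tlen b -> tsize a <= B -> tsize b <= B ->
  D (tsize a) LE [:: a; b].
Proof.
elim: a b => [|x _ a IH] [|y b] //= ab aB bB.
- by apply: (rule LE 0 [:: Lf] [::]) => //=; lia.
- by apply: (rule LE 0 [:: Nd y b] [::]) => //=; lia.
have x0 := tsize_gt0 x; apply: (rule LE 1 [:: x; a; y; b] [:: tsize a]) => //=; try lia.
by split=> //; apply: IH => //; lia.
Qed.

Lemma t_nodeE d n : t_node (NOrd d n) = Nd (Nd b0 (t_name d)) (t_nat n).
Proof. by []. Qed.

Definition ord_nodes (ds : seq name) n := [seq NOrd d n | d <- ds].

Lemma t_node_skE q n : t_node (NSk q n) = Nd (Nd b1 (t_name q)) (t_nat n).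
Proof. by []. Qed.

Lemma ord_nodes_cons d ds n : ord_nodes (d :: ds) n = NOrd d n :: ord_nodes ds n.
Proof. by []. Qed.

Lemma D_ords ds n : tsize (t_seq t_name ds) <= B -> tsize (t_nat n) <= B ->
  tsize (t_seq t_node (ord_nodes ds n)) <= B ->
  D (tsize (t_seq t_name ds)) ORDS
    [:: t_seq t_name ds; t_nat n; t_seq t_node (ord_nodes ds n)].
Proof.
elim: ds => [|d ds IH] dB nB rB.
  by apply: (rule ORDS 0 [:: t_nat n] [::]) => //=; rewrite andbT.
move: dB rB; rewrite ord_nodes_cons !t_seq_cons t_nodeE !tsize_Nd => dB rB.
have d0 := tsize_gt0 (t_name d).
apply: (rule ORDS 1 [:: t_name d; t_seq t_name ds; t_nat n; t_seq t_node (ord_nodes ds n)]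
  [:: tsize (t_seq t_name ds)]) => //.
- by rewrite /=; lia.
- by rewrite /all; repeat (apply/andP; split) => //; lia.
- by split=> //; apply: IH => //; lia.
Qed.

Variable ds : seq (name * nat * seq name).
Local Notation d := (t_seq t_dom ds).
Hypothesis dB : tsize d <= B.

Definition cost_hnodes := 2 * B + 1.

(** A nonempty domain guarantees a declared entry, without which the lookup would fail. *)
Lemma D_hnodes nd :
  (forall q n, nd = NSk q n -> exists v, v \in domain ds q n) ->
  tsize (t_node nd) <= B -> tsize (t_seq t_node (head_nodes ds nd)) <= B ->
  D cost_hnodes HNODES [:: d; t_node nd; t_seq t_node (head_nodes ds nd)].
Proof.
case: nd => [p n|q n] dom nB.
  move: nB; rewrite t_nodeE !tsize_Nd => nB _; apply: (rule HNODES 0 [:: d; t_name p; t_nat n] [::]) => //.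
    by rewrite /cost_hnodes /=; lia.
  by rewrite /all; repeat (apply/andP; split) => //; lia.
rewrite [head_nodes _ _]/= -/(ord_nodes _ _) t_seq_cons tsize_Nd => rB.
move: nB; rewrite t_node_skE !tsize_Nd => nB.
have [v /tlook_doms_some look] := dom q n erefl; have lB := tlook_size look.
apply: (rule HNODES 1 [:: d; t_name q; t_nat n;
  t_seq t_node (ord_nodes (domain ds q n) n); t_seq t_name (domain ds q n)] [:: B; B]) => //.
- by rewrite /= /cost_hnodes; lia.
- by rewrite /all; repeat (apply/andP; split) => //; lia.
- split; first by apply: (D_le dB); apply: D_look => //; rewrite /=; lia.
  by split=> //; apply: (@D_le _ (tsize (t_seq t_name (domain ds q n))));
    [lia | apply: D_ords => //; lia].
Qed.

Variables (lv : tree) (lev : node -> nat).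
Hypothesis lvB : tsize lv <= B.

Definition known (nd : node) : Prop := tlook (t_node nd) lv = Some (t_nat (lev nd)).

Lemma known_size nd : known nd -> tsize (t_nat (lev nd)) <= B.
Proof. by move/tlook_size; lia. Qed.

Definition cost_allge := B * (2 * B + 1).

Lemma D_look_level nd : known nd -> tsize (t_node nd) <= B ->
  D B LOOK [:: t_node nd; lv; t_nat (lev nd)].
Proof. by move=> nd_known ndB; apply: (D_le lvB); apply: D_look. Qed.

Lemma D_allge nds k : (forall nd, List.In nd nds -> known nd /\ k <= lev nd) ->
  tsize (t_seq t_node nds) <= B -> tsize (t_nat k) <= B ->
  D cost_allge ALLGE [:: lv; t_seq t_node nds; t_nat k].
Proof.
move=> h nB kB; apply: (@D_le _ (tsize (t_seq t_node nds) * (2 * B + 1))).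
  by rewrite leq_mul2r nB orbT.
elim: nds h nB => [|nd nds IH] h nB.
  by apply: (rule ALLGE 0 [:: lv; t_nat k] [::]) => //=; rewrite ?andbT; lia.
have [nd_known le_k] := h nd (or_introl erefl); have levB := known_size nd_known.
move: nB; rewrite t_seq_cons tsize_Nd => nB; have n0 := tsize_gt0 (t_node nd).
apply: (rule ALLGE 1 [:: lv; t_node nd; t_seq t_node nds; t_nat k; t_nat (lev nd)]
  [:: B; B; tsize (t_seq t_node nds) * (2 * B + 1)]) => //.
- by rewrite /=; nia.
- by rewrite /all; repeat (apply/andP; split) => //; lia.
- split; first by apply: D_look_level => //; lia.
  split; first by apply: (D_le kB); apply: D_level_le; rewrite ?tlen_nat.
  by split=> //; apply: IH; [move=> nd' nd'_in; apply: h; right | lia].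
Qed.

Lemma D_allle nds k : (forall nd, List.In nd nds -> known nd /\ lev nd <= k) ->
  tsize (t_seq t_node nds) <= B -> tsize (t_nat k) <= B ->
  D cost_allge ALLLE [:: lv; t_seq t_node nds; t_nat k].
Proof.
move=> h nB kB; apply: (@D_le _ (tsize (t_seq t_node nds) * (2 * B + 1))).
  by rewrite leq_mul2r nB orbT.
elim: nds h nB => [|nd nds IH] h nB.
  by apply: (rule ALLLE 0 [:: lv; t_nat k] [::]) => //=; rewrite ?andbT; lia.
have [nd_known le_k] := h nd (or_introl erefl); have levB := known_size nd_known.
move: nB; rewrite t_seq_cons tsize_Nd => nB; have n0 := tsize_gt0 (t_node nd).
apply: (rule ALLLE 1 [:: lv; t_node nd; t_seq t_node nds; t_nat k; t_nat (lev nd)]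
  [:: B; B; tsize (t_seq t_node nds) * (2 * B + 1)]) => //.
- by rewrite /=; nia.
- by rewrite /all; repeat (apply/andP; split) => //; lia.
- split; first by apply: D_look_level => //; lia.
  split; first by apply: (D_le levB); apply: D_level_le; rewrite ?tlen_nat.
  by split=> //; apply: IH; [move=> nd' nd'_in; apply: h; right | lia].
Qed.

Definition drop_sign (s : slot sign) : nat := if s is Fix Pos then 0 else 1.

Lemma atom_nodeE a : t_node (atom_node a) =
  Nd (t_slot t_name (a_pred a)) (t_nat (size (a_args a))).
Proof. by rewrite /atom_node; case: (a_pred a). Qed.

Lemma tsize_atom_node a : tsize (t_node (atom_node a)) <= tsize (t_atom a).
Proof.
rewrite atom_nodeE /t_atom !tsize_Nd tsize_nat ltnS leq_add2l -(tlen_seq t_term).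
exact: size_tlen.
Qed.

Lemma tsize_args a : tsize (t_seq t_term (a_args a)) <= tsize (t_atom a).
Proof. by rewrite /t_atom tsize_Nd; apply: leqW; exact: leq_addl. Qed.

Lemma D_len_args a : tsize (t_atom a) <= B ->
  D B LEN [:: t_seq t_term (a_args a); t_nat (size (a_args a))].
Proof.
move=> /(leq_trans (tsize_args a)) aB; rewrite -(tlen_seq t_term).
by apply: (D_le aB); exact: D_len.
Qed.

Definition cost_slit := 2 * B + cost_allge + 1.

Lemma D_sbody nds b :
  (forall s a, List.In (LAtom s a) b -> known (atom_node a) /\
    forall nd, List.In nd nds -> known nd /\ lev (atom_node a) + drop_sign s <= lev nd) ->
  nds <> [::] ->
  tsize (t_seq t_node nds) <= B -> tsize (t_seq t_literal b) <= B ->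
  D (tsize (t_seq t_literal b) * cost_slit) SBODY [:: lv; t_seq t_node nds; t_seq t_literal b].
Proof.
move=> + nds0 nB; elim: b => [|l b IH] h bB.
  by apply: (rule SBODY 0 [:: lv; t_seq t_node nds] [::]) => //=; rewrite /cost_slit ?andbT; lia.
move: bB; rewrite t_seq_cons tsize_Nd => bB; have l0 := tsize_gt0 (t_literal l).
have {}IH : D (tsize (t_seq t_literal b) * cost_slit) SBODY
    [:: lv; t_seq t_node nds; t_seq t_literal b].
  by apply: IH; [move=> s a a_in; apply: h; right | lia].
case: l h bB l0 => [s a|c t u] h bB l0; last first.
  apply: (rule SBODY 1 [:: lv; t_seq t_node nds; Nd (t_slot t_cmp c) (Nd (t_term t) (t_term u));
    t_seq t_literal b] [:: tsize (t_seq t_literal b) * cost_slit]) => //.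
  - by rewrite /= /cost_slit; nia.
  - by move: bB; rewrite /t_literal /all !tsize_Nd; repeat (apply/andP; split) => //; lia.
have [a_known le_h] := h s a (or_introl erefl).
have aB : tsize (t_atom a) <= B by move: bB; rewrite /t_literal !tsize_Nd; lia.
have aN := tsize_atom_node a; have levB := known_size a_known.
(* The level of some head bounds the level plus sign of the body atom, hence the numeral for the
   latter fits into [B]. *)
have [nd nd_in] : exists nd, List.In nd nds.
  by case: (nds) nds0 => // nd ? _; exists nd; left.
have [nd_known le_nd] := le_h nd nd_in; have := known_size nd_known; rewrite tsize_nat => ndB.
have look := D_look_level a_known (leq_trans aN aB).
have allge : D cost_allge ALLGE
    [:: lv; t_seq t_node nds; t_nat (lev (atom_node a) + drop_sign s)].
  by apply: D_allge => //; rewrite tsize_nat; lia.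
have len := D_len_args aB.
have cost : sumn [:: B; B; cost_allge; tsize (t_seq t_literal b) * cost_slit] <
    (tsize (t_literal (LAtom s a)) + tsize (t_seq t_literal b)).+1 * cost_slit.
  have lt_c : B + B + cost_allge < cost_slit by rewrite /cost_slit; lia.
  by move: lt_c l0; rewrite [sumn _]/=; move: cost_slit (tsize (t_literal _)) => x y; nia.
rewrite atom_nodeE in look aN; rewrite tsize_Nd in aN.
have argsB := leq_trans (tsize_args a) aB.
have sB : tsize (t_slot t_sign s) <= B by move: bB; rewrite /t_literal !tsize_Nd; lia.
have usB : all (fun t => tsize t <= B) [:: lv; t_seq t_node nds; t_slot t_name (a_pred a);
    t_seq t_term (a_args a); t_seq t_literal b; t_nat (size (a_args a)); t_nat (lev (atom_node a))].
  by rewrite /all; repeat (apply/andP; split) => //; lia.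
case: s {h le_h le_nd} bB l0 allge cost sB => [[]|q] bB l0 allge cost sB.
- apply: (rule SBODY 2 _ _ _ _ cost usB) => //.
  by rewrite addn0 in allge.
- apply: (rule SBODY 3 _ _ _ _ cost usB) => //.
  by rewrite addn1 in allge.
- apply: (rule SBODY 4 [:: lv; t_seq t_node nds; t_slot t_name (a_pred a);
    t_seq t_term (a_args a); t_seq t_literal b; t_nat (size (a_args a));
    t_nat (lev (atom_node a)); t_name q] _ _ _ cost) => //.
  + move: usB sB => /= usB sB; move: usB; rewrite /all.
    move=> /and5P[-> -> -> -> /and4P[-> -> -> _]]; lia.
  + by rewrite addn1 in allge.
Qed.

Definition cost_srule := B + cost_hnodes + B * cost_slit + 1.

Lemma D_srules p :
  (forall r c, List.In r p -> r_head r = Some c ->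
    [/\ forall q n, atom_node c = NSk q n -> exists v, v \in domain ds q n,
      tsize (t_seq t_node (head_nodes ds (atom_node c))) <= B &
      forall s a, List.In (LAtom s a) (r_body r) -> known (atom_node a) /\
        forall nd, List.In nd (head_nodes ds (atom_node c)) ->
          known nd /\ lev (atom_node a) + drop_sign s <= lev nd]) ->
  tsize (t_seq t_rule p) <= B ->
  D (tsize (t_seq t_rule p) * cost_srule) SRULES [:: d; lv; t_seq t_rule p].
Proof.
elim: p => [|[h b] p IH] ok pB.
  by apply: (rule SRULES 0 [:: d; lv] [::]) => //=; rewrite /cost_srule ?andbT; lia.
have {}IH : tsize (t_seq t_rule p) <= B ->
    D (tsize (t_seq t_rule p) * cost_srule) SRULES [:: d; lv; t_seq t_rule p].
  by apply: IH => r c r_in; apply: ok; right.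
move: pB; rewrite t_seq_cons /t_rule [r_head _]/= [r_body _]/= -/t_rule !tsize_Nd => pB.
have {}IH := IH ltac:(lia).
case: h ok pB => [c|] ok pB; last first.
  move: pB => /= pB.
  apply: (rule SRULES 1 [:: d; lv; t_seq t_literal b; t_seq t_rule p]
    [:: tsize (t_seq t_rule p) * cost_srule]) => //.
  - by rewrite /= /cost_srule; nia.
  - by rewrite /all; repeat (apply/andP; split) => //; lia.
have [dom nB body] := ok _ c (or_introl erefl) erefl.
have cB : tsize (t_atom c) <= B by move: pB; rewrite (tsize_Nd b1 (t_atom c)); lia.
have len := D_len_args cB; have cN := tsize_atom_node c.
have hnodes := D_hnodes dom (leq_trans cN cB) nB.
rewrite atom_nodeE in hnodes cN; rewrite tsize_Nd in cN.
have argsB := leq_trans (tsize_args c) cB.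
apply: (rule SRULES 2 [:: d; lv; t_slot t_name (a_pred c); t_seq t_term (a_args c);
    t_seq t_literal b; t_seq t_rule p; t_nat (size (a_args c));
    t_seq t_node (head_nodes ds (atom_node c))]
  [:: B; cost_hnodes; B * cost_slit; tsize (t_seq t_rule p) * cost_srule]) => //.
- have lt_c : B + cost_hnodes + B * cost_slit < cost_srule by rewrite /cost_srule; lia.
  by move: lt_c; rewrite [sumn _]/=; move: cost_srule (B * cost_slit) => x y; nia.
- by rewrite /all; repeat (apply/andP; split) => //; lia.
- split=> //; split=> //; split; last by split.
  apply: (@D_le _ (tsize (t_seq t_literal b) * cost_slit)).
    by rewrite leq_mul2r; apply/orP; right; lia.
  by apply: D_sbody => //; [case: (atom_node c) | lia].
Qed.

Lemma tlook_doms_in e es : List.In e es ->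
  tlook (Nd (t_name e.1.1) (t_nat e.1.2)) (t_seq t_dom es) =
  Some (t_seq t_name (domain es e.1.1 e.1.2)).
Proof.
case: e => -[q' n'] v'; rewrite /domain; elim: es => //= -[[q n] v] es IH e_in.
rewrite ?t_seq_cons /=; case: eqP => [/t_key_inj[-> ->]|ne]; first by rewrite eqxx.
case: eqP => [[qE nE]|_]; first by case: ne; rewrite qE nE.
by case: e_in => [[qE nE _]|/IH //]; case: ne; rewrite qE nE.
Qed.

Lemma t_domE e :
  t_dom e = Nd (Nd (t_name e.1.1) (t_nat e.1.2)) (t_seq t_name e.2).
Proof. by []. Qed.

Definition cost_sdom := 3 * B + cost_allge + 1.

Lemma D_sdoms es :
  (forall e, List.In e es -> [/\ List.In e ds,
     known (NSk e.1.1 e.1.2), tsize (t_node (NSk e.1.1 e.1.2)) <= B,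
     tsize (t_seq t_node (ord_nodes (domain ds e.1.1 e.1.2) e.1.2)) <= B &
     forall v, v \in domain ds e.1.1 e.1.2 ->
       known (NOrd v e.1.2) /\ lev (NOrd v e.1.2) <= lev (NSk e.1.1 e.1.2)]) ->
  tsize (t_seq t_dom es) <= B ->
  D (tsize (t_seq t_dom es) * cost_sdom) SDOMS [:: d; lv; t_seq t_dom es].
Proof.
elim: es => [|e es IH] ok eB.
  by apply: (rule SDOMS 0 [:: d; lv] [::]) => //=; rewrite /cost_sdom ?andbT; lia.
have {}IH : tsize (t_seq t_dom es) <= B ->
    D (tsize (t_seq t_dom es) * cost_sdom) SDOMS [:: d; lv; t_seq t_dom es].
  by apply: IH => e' e'_in; apply: ok; right.
have [e_in q_known qB rB le_q] := ok e (or_introl erefl).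
have look := tlook_doms_in e_in; have lB := tlook_size look; have levB := known_size q_known.
move: eB; rewrite t_seq_cons t_domE !tsize_Nd => eB.
have {}IH := IH ltac:(lia).
apply: (rule SDOMS 1 [:: d; lv; t_name e.1.1; t_nat e.1.2; t_seq t_name e.2; t_seq t_dom es;
    t_seq t_name (domain ds e.1.1 e.1.2); t_seq t_node (ord_nodes (domain ds e.1.1 e.1.2) e.1.2);
    t_nat (lev (NSk e.1.1 e.1.2))]
  [:: B; B; B; cost_allge; tsize (t_seq t_dom es) * cost_sdom]) => //.
- have lt_c : B + B + B + cost_allge < cost_sdom by rewrite /cost_sdom; lia.
  by move: lt_c; rewrite [sumn _]/=; move: cost_sdom => x; nia.
- by rewrite /all; repeat (apply/andP; split) => //; lia.
- split; first by apply: (D_le dB); apply: D_look => //; rewrite /=; lia.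
  split.
    apply: (@D_le _ (tsize (t_seq t_name (domain ds e.1.1 e.1.2)))); first lia.
    by apply: D_ords => //; lia.
  split; first exact: (D_look_level q_known qB).
  split; last by split.
  by apply: D_allle => // nd /List.in_map_iff[v [<- /InP /le_q]].
Qed.

End Levels.

End ParseAndLevelGoals.

(** * Sizes of the guessed tables and models *)

Section TableSizes.

Local Arguments t_seq : simpl never.
Local Arguments t_nat : simpl never.
Local Arguments t_node : simpl never.
Local Arguments t_atom : simpl never.
Local Arguments t_literal : simpl never.
Local Arguments t_rule : simpl never.
Local Arguments t_dom : simpl never.
Local Arguments t_gatom : simpl never.
Local Arguments t_grule : simpl never.

Lemma tlook_table T (k f : T -> tree) x s : injective k -> List.In x s ->
  tlook (k x) (t_seq (fun x => Nd (k x) (f x)) s) = Some (f x).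
Proof.
move=> k_inj; rewrite /t_seq; elim: s => //= y s IH x_in.
by case: eqP => [/k_inj->//|ne]; case: x_in => [yx|/IH //]; case: ne; rewrite yx.
Qed.

Lemma tsize_seq_le T (f : T -> tree) s K :
  (forall x, List.In x s -> tsize (f x) <= K) -> tsize (t_seq f s) <= size s * K.+1 + 1.
Proof.
rewrite /t_seq; elim: s => //= x s IH h; have := h x (or_introl erefl).
by have := IH (fun y y_in => h y (or_intror y_in)); lia.
Qed.

Lemma size_lt_tsize T (f : T -> tree) s : size s < tsize (t_seq f s).
Proof. by have := size_tlen (t_seq f s); rewrite tlen_seq; lia. Qed.

Lemma size_flatten_le T U (f : T -> tree) (g : T -> seq U) s :
  (forall x, List.In x s -> size (g x) <= tsize (f x)) ->
  size (flatten (map g s)) < tsize (t_seq f s).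
Proof.
rewrite /t_seq; elim: s => //= x s IH h; rewrite size_cat; have := h x (or_introl erefl).
by have := IH (fun y y_in => h y (or_intror y_in)); lia.
Qed.

(** Without repetitions, the elements of [s] can be removed from [s'] one by one. This bounds the
    guessed model by the list of rule heads. *)
Lemma tsize_uniq (T : eqType) (f : T -> tree) s s' : uniq s -> {subset s <= s'} ->
  tsize (t_seq f s) <= tsize (t_seq f s').
Proof.
have rm x l : x \in l -> tsize (t_seq f l) = (tsize (f x) + tsize (t_seq f (rem x l))).+1.
  elim: l => // y l IH; rewrite inE t_seq_cons tsize_Nd [rem _ _]/= eq_sym.
  by case: eqVneq => [->//|_] /IH->; rewrite t_seq_cons tsize_Nd; lia.
elim: s s' => [|x s IH] s'; first by move=> _ _; exact: tsize_gt0.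
rewrite cons_uniq => /andP[xs us] sub; have xs' : x \in s' by apply: sub; rewrite inE eqxx.
rewrite t_seq_cons tsize_Nd (rm x s' xs') ltnS leq_add2l; apply: IH => // y ys.
have : y \in s' by apply: sub; rewrite inE ys orbT.
by rewrite (perm_mem (perm_to_rem xs')) inE; case: eqP => // yx; rewrite -yx ys in xs.
Qed.

Lemma tsize_heads p : tsize (t_seq t_gatom (rule_heads p)) <= tsize (t_seq t_grule p).
Proof.
elim: p => [|[h ps ns] p IH] //; rewrite t_seq_cons t_gruleE !tsize_Nd.
case: h => [a|]; last first.
  by change (rule_heads (_ :: p)) with (rule_heads p); lia.
change (rule_heads (_ :: p)) with (a :: rule_heads p).
by rewrite t_seq_cons [t_opt _ _]/= !(tsize_Nd _ (t_gatom a), tsize_Nd (t_gatom a) _); lia.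
Qed.

(** * Variables of a program *)

Lemma sv_key_inj : injective sv_key.
Proof.
case=> [q n|q|q|q] [q' n'|q'|q'|q'] //= [].
- by move=> /t_nat_inj-> /t_name_inj->.
- by move=> /t_name_inj->.
- by move=> /t_name_inj->.
- by move=> /t_name_inj->.
Qed.

(** A single [K] bounds the number of variables and, up to a constant for tags, the size of their
    keys, so that both estimates add up together along the syntax. *)
Definition few_vars (K : nat) (vs : seq svar) : Prop :=
  size vs <= K /\ forall s, List.In s vs -> tsize (sv_key s) <= K + 20.

Lemma few_vars_cat K K' k vs vs' : few_vars K vs -> few_vars K' vs' -> K + K' <= k ->
  few_vars k (vs ++ vs').
Proof.
move=> [n1 h1] [n2 h2] le_k; split; first by rewrite size_cat; lia.
by move=> s /List.in_app_iff[/h1|/h2]; lia.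
Qed.

Lemma few_vars_flatten T (f : T -> tree) g s :
  (forall x, List.In x s -> few_vars (tsize (f x)) (g x)) ->
  few_vars (tsize (t_seq f s)) (flatten (map g s)).
Proof.
move=> h; split; first by apply/ltnW/size_flatten_le => x /h[].
move=> v /In_flatten[vs /List.in_map_iff[x [<- x_in]]] v_in.
have [_ /(_ v v_in)] := h x x_in; have := tsize_In f x_in; lia.
Qed.

Lemma few_vars_slot T (f : T -> tree) g k s :
  (forall q, s = Sk q -> tsize (sv_key (g q)) <= tsize (t_name q) + k) ->
  few_vars (tsize (t_slot f s) + (k - 20)) (slot_vars g s).
Proof.
case: s => [x|q] h; split=> //=; try lia.
by move=> s [<-|//]; have := h q erefl; lia.
Qed.

Lemma few_vars_term t : few_vars (tsize (t_term t)) (term_vars t).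
Proof.
elim: t => [z|s|o t1 IH1 t2 IH2] /=; [by split| by split|].
have slotP : few_vars (tsize (t_slot t_arith o) + (20 - 20)) (slot_vars SArith o).
  by apply: few_vars_slot => q _ /=; rewrite /k_arith /=; lia.
apply: few_vars_cat slotP (few_vars_cat IH1 IH2 (leqnn _)) _; lia.
Qed.

Lemma few_vars_atom a : few_vars (tsize (t_atom a)) (atom_vars a).
Proof.
have [n2 h2] : few_vars (tsize (t_seq t_term (a_args a))) (flatten (map term_vars (a_args a))).
  by apply: few_vars_flatten => t _; exact: few_vars_term.
have aE : tsize (t_atom a) =
  (tsize (t_slot t_name (a_pred a)) + tsize (t_seq t_term (a_args a))).+1 by [].
have argsE : tsize (t_nat (size (a_args a))) <= tsize (t_seq t_term (a_args a)).
  by rewrite tsize_nat -(tlen_seq t_term); exact: size_tlen.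
rewrite aE; move: n2 h2 argsE; rewrite /atom_vars.
move: (tsize (t_seq _ _)) (size (a_args a)) => k n n2 h2 argsE; split.
  rewrite size_cat; move: n2; case: (a_pred a) => [p|q] /=; lia.
move=> s /List.in_app_iff[|/h2]; last lia.
by case: (a_pred a) => //= q [<-|//] /=; change (tsize (t_nat 3)) with 7; lia.
Qed.

Lemma tsize_lit_atom s a :
  tsize (t_literal (LAtom s a)) = (tsize (t_slot t_sign s) + tsize (t_atom a)).+3.
Proof. by []. Qed.

Lemma tsize_lit_cmp c t u : tsize (t_literal (LCmp c t u)) =
  (3 + (tsize (t_slot t_cmp c) + (tsize (t_term t) + tsize (t_term u)).+1).+1).+1.
Proof. by []. Qed.

Lemma few_vars_literal l : few_vars (tsize (t_literal l)) (literal_vars l).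
Proof.
case: l => [s a|c t u]; rewrite ?tsize_lit_atom ?tsize_lit_cmp.
- have slotP : few_vars (tsize (t_slot t_sign s) + (20 - 20)) (slot_vars SNeg s).
    by apply: few_vars_slot => q _ /=; rewrite /k_neg /=; lia.
  by apply: few_vars_cat slotP (few_vars_atom a) _; lia.
- have slotP : few_vars (tsize (t_slot t_cmp c) + (20 - 20)) (slot_vars SCmp c).
    by apply: few_vars_slot => q _ /=; rewrite /k_cmp /=; lia.
  apply: few_vars_cat slotP (few_vars_cat (few_vars_term t) (few_vars_term u) (leqnn _)) _.
  lia.
Qed.

Lemma few_vars_rule r : few_vars (tsize (t_rule r)) (rule_vars r).
Proof.
have [n1 h1] : few_vars (tsize (t_rhead (r_head r))) (oapp atom_vars [::] (r_head r)).
  case: (r_head r) => [a|]; last by split.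
  have [na ha] := few_vars_atom a; change (few_vars (3 + tsize (t_atom a)).+1 (atom_vars a)).
  by split=> [|s /ha]; lia.
have P : few_vars (tsize (t_seq t_literal (r_body r))) (flatten (map literal_vars (r_body r))).
  by apply: few_vars_flatten => l _; exact: few_vars_literal.
by apply: few_vars_cat (conj n1 h1) P _; rewrite /t_rule tsize_Nd.
Qed.

Lemma few_svars p : few_vars (tsize (t_seq t_rule p)) (svars p).
Proof. by apply: few_vars_flatten => r _; exact: few_vars_rule. Qed.

Lemma domain_in ds q n v : v \in domain ds q n ->
  exists e, [/\ List.In e ds, e.1 = (q, n) & v \in e.2].
Proof.
rewrite /domain; elim: ds => //= e ds IH.
case: eqP => [eE v_in|_ /IH[e' [e'_in e'E v_in]]]; first by exists e; split=> //; left.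
by exists e'; split=> //; right.
Qed.

Section Instance.
Variables (I : instance) (th : subst) (S : nat).
Hypothesis strat : stratified I.
Hypothesis th_ok : in_domains I th.
Hypothesis progS : tsize (t_seq t_rule (i_prog I)) <= S.
Hypothesis domsS : tsize (t_seq t_dom (i_doms I)) <= S.

Definition subst_table : tree :=
  t_seq (fun s => Nd (sv_key s) (sv_val th s)) (svars (i_prog I)).

Lemma subst_table_covers : covers subst_table th (svars (i_prog I)).
Proof. by move=> s s_in; apply: tlook_table; first exact: sv_key_inj. Qed.

Lemma tsize_domain q n v : v \in domain (i_doms I) q n ->
  tsize (t_seq t_name (domain (i_doms I) q n)) <= S.
Proof. by move/tlook_doms_some/tlook_size/leq_trans; apply. Qed.

(** At most [S] entries, each of linear size; the value of a sketched predicate is bounded by the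
    listed domain that contains it. *)
Lemma tsize_subst_table : tsize subst_table <= 100 * (S.+1 * S.+1).
Proof.
have [nS kS] := few_svars (i_prog I).
apply: leq_trans (tsize_seq_le (K := 2 * S + 40) _) _ => [s s_in|].
  have := kS s s_in; rewrite tsize_Nd.
  suff : tsize (sv_val th s) <= S + 13 by lia.
  case: s s_in => [q n|q|q|q] s_in /=.
  - have v_in := th_ok s_in; have := tsize_domain v_in.
    by have /InP/(tsize_In t_name) := v_in; rewrite /dom -/(domain (i_doms I) q n); lia.
  - by have := tsize_sign (th_neg th q); lia.
  - by have := tsize_cmp (th_cmp th q); lia.
  - by have := tsize_arith (th_arith th q); lia.
move: nS; move: (size _) => m nS; have mS := leq_trans nS progS.
by apply: (@leq_trans (S * (2 * S + 40).+1 + 1)); [rewrite leq_add2r leq_mul2r mS orbT | nia].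
Qed.

Definition head_node (r : srule) : option node := omap atom_node (r_head r).

(** Covers every predicate whose level is looked up by the verifier. Repetitions do no harm, since
    they carry equal levels. *)
Definition all_nodes : seq node :=
  pmap head_node (i_prog I) ++ body_nodes I ++
  flatten [seq NSk e.1.1 e.1.2 :: ord_nodes e.2 e.1.2 | e <- i_doms I].

Definition level_table : tree :=
  t_seq (fun nd => Nd (t_node nd) (t_nat (level I nd))) all_nodes.

Lemma known_all nd : List.In nd all_nodes -> known level_table (level I) nd.
Proof. by move=> nd_in; apply: tlook_table; first exact: t_node_inj. Qed.

Lemma in_all_nodes_head r a : List.In r (i_prog I) -> r_head r = Some a ->
  List.In (atom_node a) all_nodes.
Proof.
move=> r_in rE; apply/List.in_app_iff; left; apply/In_pmap; exists r => //.
by rewrite /head_node rE.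
Qed.

Lemma in_body_nodes nd : List.In nd (body_nodes I) <-> exists r s a,
  [/\ List.In r (i_prog I), List.In (LAtom s a) (r_body r) & nd = atom_node a].
Proof.
rewrite /body_nodes In_flatten; split.
  case=> _ /List.in_map_iff[r [<- r_in]] /In_pmap[[s a|//] l_in [<-]].
  by exists r, s, a.
case=> r [s [a [r_in l_in ->]]]; eexists; first by apply/List.in_map_iff; exists r.
by apply/In_pmap; exists (LAtom s a).
Qed.

Lemma in_all_nodes_body r s a : List.In r (i_prog I) -> List.In (LAtom s a) (r_body r) ->
  List.In (atom_node a) all_nodes.
Proof.
move=> r_in l_in; apply/List.in_app_iff; right; apply/List.in_app_iff; left.
by apply/in_body_nodes; exists r, s, a.
Qed.

Lemma in_all_nodes_dom e nd : List.In e (i_doms I) ->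
  List.In nd (NSk e.1.1 e.1.2 :: ord_nodes e.2 e.1.2) -> List.In nd all_nodes.
Proof.
move=> e_in nd_in; apply/List.in_app_iff; right; apply/List.in_app_iff; right.
by apply/In_flatten; eexists; [apply/List.in_map_iff; exists e | exact: nd_in].
Qed.

Lemma in_all_nodes_ord q n v : v \in domain (i_doms I) q n ->
  List.In (NOrd v n) all_nodes.
Proof.
move=> /domain_in[e [e_in eE v_in]]; apply: (in_all_nodes_dom e_in); right.
by rewrite eE; apply/List.in_map_iff; exists v; split=> //; exact/InP.
Qed.

Lemma tsize_prog_atom r a : List.In r (i_prog I) -> in_rule a r -> tsize (t_atom a) <= S.
Proof.
move=> r_in a_in; have := tsize_In t_rule r_in; rewrite {1}/t_rule tsize_Nd => rS.
case: a_in => [rE|[s /(tsize_In t_literal)]].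
  by move: rS; rewrite rE [t_rhead _]/= (tsize_Nd _ (t_atom a)); lia.
by rewrite tsize_lit_atom; lia.
Qed.

Lemma tsize_dom e : List.In e (i_doms I) ->
  [/\ tsize (t_name e.1.1) <= S, tsize (t_nat e.1.2) <= S & tsize (t_seq t_name e.2) <= S].
Proof. by move=> /(tsize_In t_dom); rewrite t_domE !tsize_Nd => eS; split; lia. Qed.

Lemma tsize_all_nodes nd : List.In nd all_nodes -> tsize (t_node nd) <= 2 * S + 6.
Proof.
have atomS a : tsize (t_atom a) <= S -> tsize (t_node (atom_node a)) <= 2 * S + 6.
  by have := tsize_atom_node a; lia.
case/List.in_app_iff.
  case/In_pmap => r r_in; rewrite /head_node; case rE: (r_head r) => [a|] // [<-].
  by apply/atomS/(tsize_prog_atom r_in); left.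
case/List.in_app_iff.
  case/in_body_nodes => r [s [a [r_in l_in ->]]].
  by apply/atomS/(tsize_prog_atom r_in); right; exists s.
case/In_flatten => _ /List.in_map_iff[e [<- e_in]].
have [qS nS dS] := tsize_dom e_in.
case=> [<-|/List.in_map_iff[v [<- /(tsize_In t_name) vS]]].
  by rewrite t_node_skE !tsize_Nd /=; lia.
by rewrite t_nodeE !tsize_Nd /=; lia.
Qed.

Lemma size_body_nodes : size (body_nodes I) <= S.
Proof.
apply: leq_trans progS; apply/ltnW/size_flatten_le => r _.
rewrite size_pmap; apply: leq_trans (count_size _ _) _.
rewrite /t_rule tsize_Nd; apply: leqW.
by apply: leq_trans (ltnW (size_lt_tsize t_literal (r_body r))) _; exact: leq_addl.
Qed.

Lemma tsize_level_table : tsize level_table <= 100 * (S.+1 * S.+1).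
Proof.
apply: leq_trans (tsize_seq_le (K := 4 * S + 8) _) _ => [nd /tsize_all_nodes ndS|].
  have := level_le_size I nd; have := size_body_nodes.
  by rewrite tsize_Nd tsize_nat; lia.
have nS : size all_nodes <= 3 * S.
  rewrite /all_nodes !size_cat.
  have n1 : size (pmap head_node (i_prog I)) <= S.
    rewrite size_pmap; apply: leq_trans (count_size _ _) _.
    by apply: leq_trans progS; apply/ltnW/size_lt_tsize.
  have n2 := size_body_nodes.
  suff : size (flatten [seq NSk e.1.1 e.1.2 :: ord_nodes e.2 e.1.2 | e <- i_doms I]) <= S.
    by lia.
  apply: leq_trans domsS; apply/ltnW/size_flatten_le => e _.
  by rewrite t_domE tsize_Nd /= size_map; have := size_lt_tsize t_name e.2; lia.
apply: (@leq_trans (3 * S * (4 * S + 8).+1 + 1)); last nia.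
by rewrite leq_add2r leq_mul2r nS orbT.
Qed.

Lemma tsize_ord_nodes ds n : tsize (t_seq t_name ds) <= S -> tsize (t_nat n) <= S ->
  tsize (t_seq t_node (ord_nodes ds n)) <= S * (2 * S + 5) + 1.
Proof.
move=> dS nS; apply: leq_trans (tsize_seq_le (K := 2 * S + 4) _) _ => [nd|].
  case/List.in_map_iff=> v [<- /(tsize_In t_name) vS].
  by rewrite t_nodeE !tsize_Nd /=; lia.
have := size_lt_tsize t_name ds; rewrite size_map => dsS.
by rewrite leq_add2r; apply: leq_mul; lia.
Qed.

End Instance.

End TableSizes.

(** * Completeness of the verifier *)

Section MainGoal.

Local Arguments t_seq : simpl never.
Local Arguments t_gram : simpl never.
Local Arguments t_instance : simpl never.

Definition cost_main B := 3 * B + B * cost_srule B + B * cost_sdom B +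
  B * (cost_rule B).+1 + B * cost_example B + B * cost_example B + 1.

Section Main.
Variables (I : instance) (th : subst) (S B : nat).
Hypothesis strat : stratified I.
Hypothesis th_sat : satisfies I th.
Hypothesis sizeS : tsize (t_instance I) <= S.
Hypothesis BS : 100 * (S.+1 * S.+1) <= B.
Hypothesis wB : tsize (tcat (enc_instance I) Lf) <= B.

Let gp := evaluate (sub_program th (i_prog I)).

Let sizes : [/\ tsize (t_seq t_rule (i_prog I)) <= S, tsize (t_seq t_dom (i_doms I)) <= S,
  tsize (t_seq (t_seq t_gatom) (i_pos I)) <= S,
  tsize (t_seq (t_seq t_gatom) (i_neg I)) <= S & 9 <= S].
Proof.
have := tsize_gt0 (t_seq t_rule (i_prog I)); have := tsize_gt0 (t_seq t_dom (i_doms I)).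
have := tsize_gt0 (t_seq t_pref (i_prefs I)).
have := tsize_gt0 (t_seq (t_seq t_gatom) (i_pos I)).
have := tsize_gt0 (t_seq (t_seq t_gatom) (i_neg I)).
by move: sizeS; rewrite /t_instance !tsize_Nd; split; lia.
Qed.

Let dom_ok : in_domains I th. Proof. by case: th_sat. Qed.

Let prog_okI : prog_ok th (i_doms I) (i_prog I).
Proof. by move=> r r_in a a_in; apply: (proj1 (in_domainsP I th) dom_ok) a_in. Qed.

Let tblB : tsize (subst_table I th) <= B.
Proof. by case: sizes => p d _ _ _; apply: leq_trans (tsize_subst_table dom_ok p d) BS. Qed.

Let lvB : tsize (level_table I) <= B.
Proof. by case: sizes => p d _ _ _; apply: leq_trans (tsize_level_table p d) BS. Qed.

Let gp_size : tsize (t_seq t_grule gp) <= (S + 30) * S.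
Proof.
have [p d _ _ _] := sizes; apply: leq_trans (tsize_evaluate BS tblB d prog_okI) _.
by rewrite /weight leq_mul2l p orbT.
Qed.

(** The perfect model serves both signs: it is an answer set if it violates no constraint, and if it
    violates one there is no answer set. Its size is bounded since it lists rule heads without
    repetition. *)
Lemma example_witness e (ok : bool) : tsize (t_seq t_gatom e) <= S ->
  (if ok then has_answer_set I th e else ~ has_answer_set I th e) ->
  exists m, let p := t_seq t_grule (add_facts e gp) in
    [/\ tderiv p m m, tclosed p m,
      if ok then tconsok p m
      else exists ps ns, [/\ tmem (Nd Lf (Nd ps ns)) p, tall ps m & tnone ns m],
      tsize p <= B & tsize m <= B].
Proof.
move=> eS has; have levP := fun sg p q => @direct_dep_level I sg p q strat.
have [F [uF subF der cl]] := exists_perfect (evaluate_level (e := e) dom_ok levP).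
have pB : tsize (t_seq t_grule (add_facts e gp)) <= B.
  rewrite tsize_add_facts; have := size_lt_tsize t_gatom e => szE.
  by apply: leq_trans BS; move: gp_size; nia.
exists (t_seq t_gatom F); split=> //.
- exact/tderivP.
- exact/tclosedP.
- case: ok has => has.
    apply/tconsokP => r r_in rE; case: (boolP (blocked F r)) => // nb.
    by case: (derived_no_answer_set (evaluate_level dom_ok levP) der cl r_in rE nb).
  have [r [r_in rE]] : exists r,
      [/\ List.In r (add_facts e gp), g_head r = None & ~~ blocked F r].
    apply: NNPP => no; apply: has; exists (in_list F).
    apply: derived_answer_set der cl _ => r r_in rE; case: (boolP (blocked F r)) => // nb.
    by case: no; exists r.
  move=> /blockedPn[pos neg]; exists (t_seq t_gatom (g_pos r)), (t_seq t_gatom (g_neg r)).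
  split.
  + by apply/tmem_grule; exists r; rewrite rE.
  + by apply/tallP/allP => a /InP /pos.
  + by apply/tnoneP/allP => a /InP /neg.
- exact: leq_trans (tsize_uniq t_gatom uF subF) (leq_trans (tsize_heads _) pB).
Qed.

Let B0 : 0 < B. Proof. by apply: leq_trans BS. Qed.

Lemma D_main : D B (cost_main B) MAIN [:: tcat (enc_instance I) Lf].
Proof.
have [pS dS posS negS S10] := sizes; have SB : 10 * S + 200 <= B by apply: leq_trans BS; nia.
have big : 2000 <= B by apply: leq_trans BS; nia.
have [pB dB posB negB] : [/\ tsize (t_seq t_rule (i_prog I)) <= B,
  tsize (t_seq t_dom (i_doms I)) <= B, tsize (t_seq (t_seq t_gatom) (i_pos I)) <= B &
  tsize (t_seq (t_seq t_gatom) (i_neg I)) <= B] by split; lia.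
have gB : tsize (t_seq t_grule gp) <= B.
  by apply: leq_trans BS; apply: leq_trans gp_size _; nia.
have iB : tsize (t_instance I) <= B by lia.
have ndB nd : List.In nd (all_nodes I) -> tsize (t_node nd) <= B.
  by move=> /(tsize_all_nodes pS dS); lia.
have ordB v n : tsize (t_seq t_name v) <= S -> tsize (t_nat n) <= S ->
    tsize (t_seq t_node (ord_nodes v n)) + 2 * S + 20 <= B.
  move=> vS nS; have := tsize_ord_nodes pS dS vS nS => oS.
  by apply: leq_trans BS; nia.
have levP := fun sg p q => @direct_dep_level I sg p q strat.
have parse : D B (3 * B) PARSE
    [:: t_gram gr_instance; tcat (enc_instance I) Lf; t_instance I; Lf].
  apply: (@D_le _ (3 * tsize (t_instance I) + is_nt gr_instance)).
    by change (is_nt gr_instance) with 0; lia.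
  apply: D_parse => //.
  - by case; apply: leq_trans big; vm_compute.
  - by apply/gen_instance; exists I.
  - by apply: leq_trans big; vm_compute.
have nodesB r c : List.In r (i_prog I) -> r_head r = Some c ->
    tsize (t_seq t_node (head_nodes (i_doms I) (atom_node c))) <= B.
  move=> r_in rE; have cS := tsize_prog_atom pS dS r_in (or_introl rE).
  have c_in := in_all_nodes_head r_in rE; have := tsize_all_nodes pS dS c_in.
  move: (tsize_atom_node c); case cE: (atom_node c) => [p n|q n] cN cN'.
    by rewrite t_seq_cons tsize_Nd [tsize (t_seq _ [::])]/=; lia.
  rewrite [head_nodes _ _]/= -/(ord_nodes _ _) t_seq_cons tsize_Nd.
  have [v v_in] : exists v, v \in domain (i_doms I) q n.
    move: cE; rewrite /atom_node; case qE: (a_pred c) => [//|q'] [<- <-].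
    by exists (th_pred th q' (size (a_args c))); apply: (prog_okI r_in (or_introl rE) qE).
  have nS : tsize (t_nat n) <= S.
    by apply: leq_trans cS; apply: leq_trans cN; rewrite t_node_skE tsize_Nd; lia.
  by have := ordB _ _ (tsize_domain dS v_in) nS; lia.
have srules : D B (B * cost_srule B) SRULES
    [:: t_seq t_dom (i_doms I); level_table I; t_seq t_rule (i_prog I)].
  apply: (@D_le _ (tsize (t_seq t_rule (i_prog I)) * cost_srule B)).
    by rewrite leq_mul2r pB orbT.
  apply: (D_srules B0 dB (lev := level I) lvB) => // r c r_in rE; split.
  - move=> q n; rewrite /atom_node; case qE: (a_pred c) => [//|q'] [<- <-].
    by exists (th_pred th q' (size (a_args c))); apply: (prog_okI r_in (or_introl rE) qE).
  - exact: nodesB rE.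
  - move=> s a l_in; split; first exact/known_all/(in_all_nodes_body r_in l_in).
    move=> nd nd_in; have head_nd : in_head I r nd.
      exists c => //; move: nd_in; case: (atom_node c) => [p n|q n] /=.
        by case=> // <-; left.
      case=> [<-|/List.in_map_iff[v [<- /InP v_in]]]; first by left.
      by right; exists q, n, v.
    split.
      apply/known_all; move: nd_in (in_all_nodes_head r_in rE).
      case: (atom_node c) => [p n|q n] /=; first by case=> // <-.
      by case=> [<- //|/List.in_map_iff[v [<- /InP v_in]] _]; exact: in_all_nodes_ord v_in.
    (* A sketched negation gives dependencies of both signs; the negative one is the stronger. *)
    have dep : direct_dep I (if s is Fix Pos then Pos else Neg) nd (atom_node a).
      left; exists r; split=> //; exists s, a; split=> //.
      by case: (s) => [[]|].
    by have := levP _ _ _ dep; case: (s) => [[]|].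
have sdoms : D B (B * cost_sdom B) SDOMS
    [:: t_seq t_dom (i_doms I); level_table I; t_seq t_dom (i_doms I)].
  apply: (@D_le _ (tsize (t_seq t_dom (i_doms I)) * cost_sdom B)).
    by rewrite leq_mul2r dB orbT.
  apply: (D_sdoms B0 dB (lev := level I) lvB) => // e e_in.
  have e_node : List.In (NSk e.1.1 e.1.2) (all_nodes I).
    by apply: (in_all_nodes_dom e_in); left.
  have [qS nS _] := tsize_dom pS dS e_in.
  split=> //; first exact: known_all.
  - exact: ndB.
  - have [[v v_in]|none] := classic (exists v, v \in domain (i_doms I) e.1.1 e.1.2).
      by have := ordB _ _ (tsize_domain dS v_in) nS; lia.
    (* A declared predicate may have an empty domain, for which [tsize_domain] gives no bound. *)
    suff -> : domain (i_doms I) e.1.1 e.1.2 = [::] by rewrite /=; lia.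
    by case: (domain _ _ _) none => // v vs no; case: no; exists v; rewrite inE eqxx.
  - move=> v v_in; split; first exact/known_all/(in_all_nodes_ord v_in).
    have dep : direct_dep I Pos (NSk e.1.1 e.1.2) (NOrd v e.1.2).
      by right; split=> //; exists e.1.1, e.1.2, v.
    by have := levP _ _ _ dep; rewrite addn0.
have prog : D B (B * (cost_rule B).+1) PROG [:: t_seq t_dom (i_doms I); subst_table I th;
    t_seq t_rule (i_prog I); t_seq t_grule gp].
  apply: (@D_le _ (tsize (t_seq t_rule (i_prog I)) * (cost_rule B).+1)).
    by rewrite leq_mul2r pB orbT.
  by apply: (D_prog BS) => //; exact: subst_table_covers.
have exB e es : List.In e es -> tsize (t_seq (t_seq t_gatom) es) <= S ->
    tsize (t_seq t_gatom e) <= S.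
  by move=> /(tsize_In (t_seq t_gatom)); lia.
case: th_sat => _ pos neg.
have posex : D B (B * cost_example B) POSEX [:: t_seq (t_seq t_gatom) (i_pos I); t_seq t_grule gp].
  apply: (@D_le _ (tsize (t_seq (t_seq t_gatom) (i_pos I)) * cost_example B)).
    by rewrite leq_mul2r posB orbT.
  apply: (@D_examples B B0 _ true) => // e e_in.
  by apply: (@example_witness e true); [exact: exB e_in posS | exact: pos].
have negex : D B (B * cost_example B) NEGEX [:: t_seq (t_seq t_gatom) (i_neg I); t_seq t_grule gp].
  apply: (@D_le _ (tsize (t_seq (t_seq t_gatom) (i_neg I)) * cost_example B)).
    by rewrite leq_mul2r negB orbT.
  apply: (@D_examples B B0 _ false) => // e e_in.
  by apply: (@example_witness e false); [exact: exB e_in negS | exact: neg].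
have prefS : tsize (t_seq t_pref (i_prefs I)) <= B.
  by move: iB; rewrite /t_instance !tsize_Nd; lia.
apply: (D_rule B B0 MAIN 0 [:: tcat (enc_instance I) Lf; t_seq t_rule (i_prog I);
    t_seq t_dom (i_doms I); t_seq t_pref (i_prefs I); t_seq (t_seq t_gatom) (i_pos I);
    t_seq (t_seq t_gatom) (i_neg I); subst_table I th; level_table I; t_seq t_grule gp]
  [:: 3 * B; B * cost_srule B; B * cost_sdom B; B * (cost_rule B).+1;
      B * cost_example B; B * cost_example B]) => //.
- by rewrite [sumn _]/= /cost_main; lia.
- by rewrite /all; repeat (apply/andP; split) => //; lia.
Qed.

End Main.

End MainGoal.

(** * Polynomial bounds *)

(** Exact values and not bounds: the costs are built from sums, products and successors, so
    monotonicity never has to be discussed. *)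
Definition polynomial (f : nat -> nat) : Prop :=
  exists p : {poly nat}, forall n, p.[n]%R = f n.

Lemma polynomial_id : polynomial id.
Proof. by exists 'X%R => n; rewrite hornerX. Qed.

Lemma polynomial_const c : polynomial (fun=> c).
Proof. by exists c%:P%R => n; rewrite hornerC. Qed.

Lemma polynomial_add f g : polynomial f -> polynomial g -> polynomial (fun n => f n + g n).
Proof. by case=> p pE [q qE]; exists (p + q)%R => n; rewrite hornerD pE qE. Qed.

Lemma polynomial_mul f g : polynomial f -> polynomial g -> polynomial (fun n => f n * g n).
Proof. by case=> p pE [q qE]; exists (p * q)%R => n; rewrite hornerM pE qE. Qed.

Lemma polynomial_succ f : polynomial f -> polynomial (fun n => (f n).+1).
Proof.
case=> p pE; exists (p + 1)%R => n; rewrite hornerD pE hornerC.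
exact: addn1.
Qed.

Ltac polynomials :=
  repeat first [ assumption | exact: polynomial_id | exact: polynomial_const
    | apply: polynomial_add | apply: polynomial_mul | apply: polynomial_succ ].

Lemma polynomial_cost_main f : polynomial f -> polynomial (fun n => cost_main (f n)).
Proof.
move=> fP; rewrite /cost_main /cost_srule /cost_sdom /cost_rule /cost_example /cost_slit
  /cost_hnodes /cost_allge /cost_atom /cost_literal /cost_node /cost_cmp /cost_gcmp
  /cost_zcmp /cost_apply /cost_quot /cost_zmul /cost_zadd /cost_pmul /cost_padd
  /cost_deriv /cost_closed /cost_list.
polynomials.
Qed.

(** The constants are those of [t_instance_size]; [tree_bound] is then the least [B] that the size
    estimates admit. *)
Definition size_bound (n : nat) : nat := 44 * n + 10.
Definition tree_bound (n : nat) : nat := 100 * ((size_bound n).+1 * (size_bound n).+1).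

Lemma polynomial_tree_bound : polynomial tree_bound.
Proof. by rewrite /tree_bound /size_bound; polynomials. Qed.

Theorem theorem2 : in_NP SkASP.
Proof.
have [q qE] := polynomial_tree_bound.
have [p pE] := polynomial_cost_main polynomial_tree_bound.
apply: (@horn_in_NP 12 horn start meaning SkASP p q _ horn_below start_below horn_closed) => //.
- exact: start_sound.
- move=> w [I [-> strat [th [th_sat _]]]]; rewrite pE qE /start inst_goal.
  set n := size _.
  suff [m le_m d] : D (tree_bound n) (cost_main (tree_bound n)) MAIN
      [:: tcat (enc_instance I) Lf] by exists m.
  apply: (D_main (S := size_bound n) strat th_sat) => //; first exact: t_instance_size.
  have tcat_size v : tsize (tcat v Lf) <= 4 * size v + 1.
    by elim: v => //= -[] v IH; rewrite /=; lia.
  by apply: leq_trans (tcat_size _) _; rewrite -/n /tree_bound /size_bound; nia.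
Qed.
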